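(* Let $\alpha\in\,]0,1[$, let $\Lambda=z_0+\vec\Lambda$ be a $\mathbb{Z}$-grid in $\mathbb{C}$, and let $\phi,\psi:\mathbb{N}\to\,]0,+\infty[$ with $\phi(N)\to+\infty$, $\frac{\phi(N)}{N^{1-\alpha}}\to\lambda\in[0,+\infty]$ and $\psi(N)=\big(\frac{N^{2-\alpha}}{\phi(N)}\big)^2$. For $N\geq1$ and integers $N',N''\geq0$ with $N'+N''\geq1$ define $$\mathcal{R}^{\alpha,\Lambda,\mathrm{lvl}}_{N,N',N''}=\frac{1}{(N'+N'')\psi(N)}\sum_{k=-N'}^{N''-1}\ \sum_{\substack{n,m\in\Lambda,\ n\neq m\\ 0<|n|,|m|\leq N}}\Delta_{\phi(N)(n^{[\alpha,k]}-m^{[\alpha,k]})}.$$ Then, as $\min\{N,N'+N''\}\to\infty$, $\mathcal{R}^{\alpha,\Lambda,\mathrm{lvl}}_{N,N',N''}$ converges vaguely to $\rho_{\alpha,\vec\Lambda,\lambda}\,\mathrm{Leb}_{\mathbb{C}}$.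
   Context: For $\beta\in\mathbb{R}$, $k\in\mathbb{Z}$ and $z\in\mathbb{C}^*$, the level-$k$ $\beta$ power is $z^{[\beta,k]}=|z|^\beta e^{i\beta\omega_k}$ where $\omega_k$ is the representative of $\arg(z)$ in $[2\pi k,2\pi(k+1)[$. $\Delta_w$ is the Dirac mass at $w$. $\mathrm{covol}_{\vec\Lambda}$ is the area of a fundamental parallelogram of $\vec\Lambda$. The density $\rho_{\alpha,\vec\Lambda,\lambda}$ is $0$ if $\lambda=+\infty$; the constant $\frac{\pi}{\alpha^2(2-\alpha)\mathrm{covol}_{\vec\Lambda}^2}$ if $\lambda=0$; and for $\lambda\in\,]0,\infty[$, $\rho(z)=\frac{\alpha^{\frac{2}{1-\alpha}}}{(1-\alpha)\mathrm{covol}_{\vec\Lambda}}(|z|/\lambda)^{-\frac{4-2\alpha}{1-\alpha}}\sum_{p\in\vec\Lambda,\ |p|\leq|z|/(\alpha\lambda)}|p|^{\frac{2}{1-\alpha}}$ (and $0$ at $z=0$). Convergence as $\min\{N,N'+N''\}\to\infty$ means: for every continuous compactly supported $f$ and every $\varepsilon>0$ there is $M$ with $|\mathcal{R}(f)-\int f\rho|<\varepsilon$ whenever $N\geq M$ and $N'+N''\geq M$. *)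

(* Defs.v *)
From HB Require Import structures.
From mathcomp Require Import all_boot all_order all_algebra.
From mathcomp Require Import complex.
From mathcomp Require Import all_classical all_reals all_analysis.

Set Implicit Arguments.
Unset Strict Implicit.
Unset Printing Implicit Defensive.

Import Order.TTheory GRing.Theory Num.Theory.
Import numFieldNormedType.Exports.

Local Open Scope classical_set_scope.
Local Open Scope ring_scope.
Local Open Scope complex_scope.

(* The library's norm on R[i] takes values in R[i]; [cmod] is the modulus as an
   element of R. *)
Definition cmod (R : realType) (z : R[i]) : R := ComplexField.Normc.normc z.

Definition argset (R : realType) (k : int) (z : R[i]) : set R :=
  [set w : R | (2 * pi * k%:~R <= w < 2 * pi * (k + 1)%:~R) /\
               z = (cmod z)%:C * (cos w +i* sin w)].

(* [argset k z] is a singleton for z != 0; the default value 0 is only reached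
   on junk input. *)
Definition arg_lvl (R : realType) (k : int) (z : R[i]) : R := xget 0 (argset k z).

Definition pow_lvl (R : realType) (b : R) (k : int) (z : R[i]) : R[i] :=
  (cmod z `^ b)%:C * (cos (b * arg_lvl k z) +i* sin (b * arg_lvl k z)).

Definition Rfree2 (R : realType) (w1 w2 : R[i]) : Prop :=
  forall s t : R, s%:C * w1 + t%:C * w2 = 0 -> s = 0 /\ t = 0.

Definition lattice (R : realType) (w1 w2 : R[i]) : set R[i] :=
  [set z | exists a b : int, z = a%:~R * w1 + b%:~R * w2].

Definition grid (R : realType) (z0 w1 w2 : R[i]) : set R[i] :=
  [set z0 + p | p in lattice w1 w2].

Definition parallelogram (R : realType) (w1 w2 : R[i]) : set R[i] :=
  [set z | exists s t : R, [/\ 0 <= s < 1, 0 <= t < 1 & z = s%:C * w1 + t%:C * w2]].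

(* The complex plane has no measurable structure in the library: Lebesgue measure
   on it is the planar Lebesgue measure read through (x, y) |-> x + iy. *)
Definition leb2 (R : realType) :=
  (@lebesgue_measure R \x @lebesgue_measure R)%E.

Definition toC (R : realType) (p : R * R) : R[i] := p.1 +i* p.2.

Definition area (R : realType) (A : set R[i]) : R :=
  fine (@leb2 R (@toC R @^-1` A)).

Definition integralC (R : realType) (g : R[i] -> R) : R :=
  Rintegral (@leb2 R) setT (fun p => g (toC p)).

Definition covol (R : realType) (w1 w2 : R[i]) : R := area (parallelogram w1 w2).

Definition rho (R : realType) (a : R) (w1 w2 : R[i]) (lam : \bar R) (z : R[i]) : R :=
  match lam with
  | +oo%E => 0
  | -oo%E => 0 (* junk: lam ranges over [0, +oo] *)
  | l%:E =>
    if l == 0 then pi / (a ^+ 2 * (2 - a) * covol w1 w2 ^+ 2)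
    else if z == 0 then 0
    else (a `^ (2 / (1 - a))) / ((1 - a) * covol w1 w2)
         * ((cmod z / l) `^ (- ((4 - 2 * a) / (1 - a))))
         * \sum_(p \in [set p : R[i] | lattice w1 w2 p /\ cmod p <= cmod z / (a * l)])
             (cmod p `^ (2 / (1 - a)))
  end.

Definition pairs (R : realType) (L : set R[i]) (N : nat) : set (R[i] * R[i]) :=
  [set nm | [/\ L nm.1, L nm.2, nm.1 != nm.2,
                0 < cmod nm.1 <= N%:R & 0 < cmod nm.2 <= N%:R]].

(* The value on f of the normalised sum of Dirac masses. The level
   k = j - N' runs over -N', ..., N'' - 1. For a grid L the index set of the inner
   sum is finite; \sum_(_ \in _) would be 0 if there were infinitely many nonzero
   terms. *)
Definition corr_lvl (R : realType) (a : R) (L : set R[i]) (phi psi : nat -> R)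
    (N N' N'' : nat) (f : R[i] -> R) : R :=
  ((N' + N'')%:R * psi N)^-1 *
  \sum_(j < N' + N'') \sum_(nm \in pairs L N)
     f ((phi N)%:C * (pow_lvl a (j%:Z - N'%:Z) nm.1 - pow_lvl a (j%:Z - N'%:Z) nm.2)).

(* R[i]^o is R[i] with the topology of its norm. *)
Definition test_function (R : realType) (f : R[i] -> R) : Prop :=
  continuous (f : R[i]^o -> R) /\ compact (closure [set z : R[i]^o | f z != 0]).

(* Vague convergence, as min(N, N' + N'') tends to infinity, of a family of
   functionals to the measure of density d with respect to Lebesgue measure. The
   family is only considered at N >= 1 and N' + N'' >= 1. *)
Definition vague_cvg (R : realType) (mu : nat -> nat -> nat -> (R[i] -> R) -> R)
    (d : R[i] -> R) : Prop :=
  forall f : R[i] -> R, test_function f ->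
  forall eps : R, 0 < eps ->
  exists M : nat, forall N N' N'' : nat,
    (1 <= N)%N -> (1 <= N' + N'')%N -> (M <= N)%N -> (M <= N' + N'')%N ->
    `| mu N N' N'' f - integralC (fun z => f z * d z) | < eps.

(* Main.v *)
Require Import Defs.
From HB Require Import structures.
From mathcomp Require Import all_boot all_order all_algebra.
From mathcomp Require Import complex.
From mathcomp Require Import all_classical all_reals all_analysis.
From mathcomp Require Import measurable_realfun.
From mathcomp Require Import ring lra zify.
Import Order.TTheory GRing.Theory Num.Theory.
Import numFieldNormedType.Exports.
Local Open Scope classical_set_scope.
Local Open Scope ring_scope.
Local Open Scope complex_scope.

(* Write l = phi(N) / N^(1-a). The chord estimate |n - m| <= C N^(1-a) |n^[a,k] - m^[a,k]|
   shows that only the pairs (n, m) with |n - m| <= C1 / l contribute, and for these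
   n^[a,k] - m^[a,k] is close to a n^[a-1,k] (n - m). So for n = N r e^(iu) at level k the inner
   sum is close to the sum over p in the lattice of f(l a r^(a-1) e^(i(a-1)(u + 2 pi k)) p).
   Summing over n in small polar cells replaces n by its equidistribution in the disc. Summing
   over k makes the argument (a-1)(u + 2 pi k) run through an arithmetic progression of total
   length (1-a) 2 pi K, which averages f over all rotations and leaves
   l^2 sum_p F(l a r^(a-1) |p|), with F the radial average of f, to be integrated against
   2 pi r dr / covol.
   - If l -> +oo there is no pair left.
   - If l -> lam > 0, the substitution s = lam a |p| r^(a-1) turns the integral in r into the
     integral of f against the p-th summand of the density.
   - If l -> 0, the sum over p is a Riemann sum of the integral of f / (a^2 covol), with an extra
     factor r^(2-2a), and the integral of 2 pi r^(3-2a) dr is pi / (2-a). *)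

Set Implicit Arguments.
Unset Strict Implicit.
Unset Printing Implicit Defensive.

Local Notation Re := (@complex.Re _).
Local Notation Im := (@complex.Im _).

(** * Powers in the complex plane *)

(** The difficulty is uniformity in l, which may tend to 0, to a positive limit or to +oo, so that
    the relevant differences p = n - m range over a growing, bounded or vanishing number of lattice
    vectors. Since psi(N) = N^2/l^2, every inner sum carries a factor l^2, and the number of nonzero
    p with |p| <= C1/l is at most a constant times l^-2 for every l > 0. Perturbing the argument of
    f by a relative error d, which f tolerates uniformly because its support is compact, therefore
    costs O(e) for all l at once. The only further constraint is C1/l <= eta N: the shells of
    differences must be small compared with the cells. It follows from phi(N) -> +oo, because C1/l =
    C1 N^(1-a)/phi(N). The number Q of rings and of sectors is fixed before N and K = N' + N'' grow.
    The counting error is then O(Q^2/N) and the averaging error O(1/K), with no condition linking N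
    to K or on the position of the block of levels. What remains is a sum depending on l and Q only,
    treated separately for lam = 0 and lam > 0. *)

Definition cis (R : realType) (t : R) : R[i] := cos t +i* sin t.

Section complex_modulus.
Variable R : realType.
Implicit Types (z w : R[i]) (x y t : R).

Lemma cmodE x y : cmod (x +i* y) = Num.sqrt (x ^+ 2 + y ^+ 2).
Proof. by []. Qed.

Lemma cmod_sqr z : cmod z ^+ 2 = Re z ^+ 2 + Im z ^+ 2.
Proof. by case: z => x y; rewrite cmodE sqr_sqrtr// addr_ge0// sqr_ge0. Qed.

Lemma cmod_ge0 z : 0 <= cmod z.
Proof. by case: z => x y; rewrite cmodE sqrtr_ge0. Qed.

Lemma cmod0 : cmod (0 : R[i]) = 0.
Proof. exact: ComplexField.Normc.normc0. Qed.

Lemma cmod_eq0 z : (cmod z == 0) = (z == 0).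
Proof.
apply/eqP/eqP => [|->]; last exact: cmod0.
exact: ComplexField.Normc.eq0_normc.
Qed.

Lemma cmod_gt0 z : (0 < cmod z) = (z != 0).
Proof. by rewrite lt_neqAle cmod_ge0 andbT eq_sym cmod_eq0. Qed.

Lemma cmodM z w : cmod (z * w) = cmod z * cmod w.
Proof. exact: ComplexField.Normc.normcM. Qed.

Lemma cmodN z : cmod (- z) = cmod z.
Proof. by case: z => x y; rewrite /cmod/= !sqrrN. Qed.

Lemma ler_cmodD z w : cmod (z + w) <= cmod z + cmod w.
Proof.
have := ler_normD z w.
by rewrite !normc_def -!(rmorphD (real_complex R)) lecR; case: z w => ? ? [? ?].
Qed.

Lemma cmodB z w : cmod (z - w) = cmod (w - z).
Proof. by rewrite -cmodN opprB. Qed.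

Lemma ler_cmodB z w : cmod (z - w) <= cmod z + cmod w.
Proof. by rewrite -(cmodN w) ler_cmodD. Qed.

Lemma ler_cmod_dist z w : `|cmod z - cmod w| <= cmod (z - w).
Proof.
rewrite ler_norml; apply/andP; split.
  have := ler_cmodD z (w - z); rewrite addrC subrK cmodB; lra.
have := ler_cmodD w (z - w); rewrite addrC subrK; lra.
Qed.

Lemma cmodC x : cmod x%:C = `|x|.
Proof. by rewrite /cmod/= expr0n addr0 sqrtr_sqr. Qed.

Lemma ler_norm_Re z : `|Re z| <= cmod z.
Proof.
case: z => x y; rewrite cmodE -sqrtr_sqr/= ler_wsqrtr//.
by rewrite lerDl sqr_ge0.
Qed.

Lemma ler_norm_Im z : `|Im z| <= cmod z.
Proof.
case: z => x y; rewrite cmodE -sqrtr_sqr/= ler_wsqrtr//.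
by rewrite lerDr sqr_ge0.
Qed.

Lemma cmod_le_ReIm z : cmod z <= `|Re z| + `|Im z|.
Proof.
rewrite -(@ler_sqr _ (cmod z)) ?nnegrE ?addr_ge0// ?cmod_ge0// cmod_sqr.
rewrite sqrrD !real_normK ?num_real//.
by rewrite lerD2r lerDl mulrn_wge0// mulr_ge0.
Qed.

Lemma cmod_cis t : cmod (cis t) = 1.
Proof. by rewrite cmodE cos2Dsin2 sqrtr1. Qed.

Lemma cmodMC x z : 0 <= x -> cmod (x%:C * z) = x * cmod z.
Proof. by move=> x0; rewrite cmodM cmodC ger0_norm. Qed.

Lemma cis0 : cis 0 = 1 :> R[i].
Proof. by rewrite /cis cos0 sin0. Qed.

Lemma cisD x y : cis (x + y) = cis x * cis y.
Proof. by rewrite /cis cosD sinD; simpc; congr (_ +i* _); ring. Qed.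

Lemma cisN x : cis (- x) * cis x = 1.
Proof. by rewrite -cisD addNr cis0. Qed.

Lemma cis2piM (k : int) : cis (2 * pi * k%:~R) = 1 :> R[i].
Proof.
have nat_case n : cis (2 * pi * n%:R) = 1 :> R[i].
  elim: n => [|n IH]; first by rewrite mulr0 cis0.
  have -> : n.+1%:R = n%:R + 1 :> R by rewrite natr1.
  rewrite mulrDr cisD IH mul1r mulr1 /cis mulr_natl.
  by rewrite cos2pi sin2pi.
case: (intP k) => [|n|n]; rewrite ?mulr0 ?cis0//.
  exact: nat_case.
by have := cisN (2 * pi * n.+1%:R); rewrite nat_case mulr1 rmorphN mulrN.
Qed.

Lemma cis_shift t (k : int) : cis (t + 2 * pi * k%:~R) = cis t.
Proof. by rewrite cisD cis2piM mulr1. Qed.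

(** * Arguments and levels of powers *)

Lemma cos_eq1 x : - (2 * pi) < x < 2 * pi -> cos x = 1 -> x = 0.
Proof.
move=> xpi; have -> : x = (x / 2) *+ 2 by rewrite mulr2n; field.
rewrite cos_mulr2n cos2sin2 => h.
have /eqP : sin (x / 2) ^+ 2 = 0 by rewrite mulr2n in h; lra.
rewrite sqrf_eq0 => /eqP s0.
have [x0|x0|->] := ltrgtP x 0; last by rewrite mul0r mul0rn.
  have := @sin_gt0_pi R (- x / 2); rewrite mulNr sinN s0 oppr0 ltxx => H.
  by have : false by apply: H; apply/andP; split; lra.
have := @sin_gt0_pi R (x / 2); rewrite s0 ltxx => H.
by have : false by apply: H; apply/andP; split; lra.
Qed.

Lemma cis_inj x y : `|x - y| < 2 * pi -> cis x = cis y -> x = y.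
Proof.
move=> xy h; apply/subr0_eq/cos_eq1; first by rewrite -ltr_norml.
have : cis (x - y) = 1 by rewrite cisD h mulrC cisN.
by case.
Qed.

Lemma argset_nonempty z : z != 0 ->
  exists2 t, 0 <= t < 2 * pi & z = (cmod z)%:C * cis t.
Proof.
move=> z0; have m0 : 0 < cmod z by rewrite cmod_gt0.
have mN : cmod z != 0 by rewrite gt_eqF.
case: z z0 m0 mN => x y _; set m := cmod _ => m0 mN.
have m2 : m ^+ 2 = x ^+ 2 + y ^+ 2 by rewrite cmod_sqr.
set c := x / m; set s := y / m.
have cs : c ^+ 2 + s ^+ 2 = 1.
  by rewrite /c /s !expr_div_n -mulrDl -m2 divff// expf_neq0.
have c1 : -1 <= c <= 1 by apply/andP; split; nra.
have sE : Num.sqrt (1 - c ^+ 2) = `|s|.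
  by rewrite -cs addrC addKr sqrtr_sqr.
have zE t : cos t = c -> sin t = s -> x +i* y = m%:C * cis t.
  move=> ct st; rewrite /cis ct st; simpc; rewrite /c /s.
  by congr (_ +i* _); field.
have [s0|s0] := leP 0 s.
  exists (acos c); first by rewrite acos_ge0//=; have := acos_lepi c1; have := @pi_gt0 R; lra.
  by apply: zE; rewrite ?acosK// sin_acos// sE ger0_norm.
exists (2 * pi - acos c).
  have := acos_lepi c1; have := @pi_gt0 R => p0 p1.
  suff : 0 < acos c by move=> ?; apply/andP; split; lra.
  rewrite acos_gt0//; apply/andP; split; first by case/andP: c1.
  by rewrite lt_neqAle; case/andP: c1 => _ ->; rewrite andbT; apply/eqP => c1; nra.
apply: zE.
  by rewrite mulr_natl addrC cosD2pi cosN acosK.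
by rewrite mulr_natl addrC sinD2pi sinN sin_acos// sE ltr0_norm// opprK.
Qed.

Definition arg z : R := arg_lvl 0 z.

Lemma arg_lvlE z (k : int) : z != 0 -> arg_lvl k z = arg z + 2 * pi * k%:~R.
Proof.
move=> z0; have [t t2 zt] := argset_nonempty z0.
have H (j : int) : arg_lvl j z = t + 2 * pi * j%:~R.
  have jt : argset j z (t + 2 * pi * j%:~R).
    split; first by rewrite rmorphD/=; apply/andP; split; lra.
    by rewrite -/(cis _) cis_shift.
  apply: xget_unique => // u [u2 zu].
  rewrite rmorphD/= in u2.
  apply: cis_inj; first by rewrite ltr_norml; apply/andP; split; lra.
  apply: (@mulfI _ (cmod z)%:C); first by rewrite fmorph_eq0 cmod_eq0.
  by rewrite cis_shift -zt.
by rewrite /arg !H mulr0 addr0.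
Qed.

Lemma arg_itv z : z != 0 -> 0 <= arg z < 2 * pi.
Proof.
move=> z0; have [t t2 zt] := argset_nonempty z0.
have : argset 0 z (arg z).
  apply: (@xgetPex _ 0 (argset 0 z)); exists t; split => //.
  by rewrite mulr0 add0r mulr1.
by case; rewrite mulr0 add0r mulr1.
Qed.

Lemma cmod_cis_arg z : z = (cmod z)%:C * cis (arg z).
Proof.
have [->|z0] := eqVneq z 0; first by rewrite cmod0 mul0r.
have [t t2 zt] := argset_nonempty z0.
have : argset 0 z (arg z).
  apply: (@xgetPex _ 0 (argset 0 z)); exists t; split => //.
  by rewrite mulr0 add0r mulr1.
by case.
Qed.

Lemma pow_lvlE b (k : int) z : z != 0 ->
  pow_lvl b k z = (cmod z `^ b)%:C * cis (b * (arg z + 2 * pi * k%:~R)).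
Proof. by move=> z0; rewrite /pow_lvl arg_lvlE. Qed.

(* Law of cosines, in half-angle form. *)
Lemma cmod_polarB_sqr (r s t u : R) :
  cmod (r%:C * cis t - s%:C * cis u) ^+ 2 =
  (r - s) ^+ 2 + 4 * r * s * sin ((t - u) / 2) ^+ 2.
Proof.
have -> : sin ((t - u) / 2) ^+ 2 = (1 - cos (t - u)) / 2.
  have {2}-> : t - u = ((t - u) / 2) *+ 2 by rewrite mulr2n; field.
  by rewrite cos_mulr2n sin2cos2 mulr2n; field.
rewrite cmod_sqr /cis; simpc => /=; rewrite cosB.
have := cos2Dsin2 t; have := cos2Dsin2 u => hu ht.
have -> : forall c s' c' s'' : R, (r * c + - (s * c')) ^+ 2 + (r * s' + - (s * s'')) ^+ 2
  = r ^+ 2 * (c ^+ 2 + s' ^+ 2) + s ^+ 2 * (c' ^+ 2 + s'' ^+ 2)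
    - 2 * r * s * (c * c' + s' * s'') by move=> *; ring.
by rewrite hu ht; field.
Qed.

(** * Elementary inequalities for trigonometric, exponential and power functions *)

Lemma sin_le_id (x : R) : 0 <= x -> sin x <= x.
Proof.
move=> x0; have [->|xn0] := eqVneq x 0; first by rewrite sin0.
have xp : 0 < x by rewrite lt_neqAle eq_sym xn0.
have cs : {within `[0, x], continuous (@sin R)}.
  by apply: continuous_subspaceT => y; exact: continuous_sin.
have [y _] := @MVT R sin cos 0 x xp (fun y _ => is_derive_sin y) cs.
rewrite sin0 !subr0 => ->; have := cos_le1 y; nra.
Qed.

Lemma norm_sin_le (x : R) : `|sin x| <= `|x|.
Proof.
wlog x0 : x / 0 <= x.
  move=> H; have [/H//|/ltW x0] := leP 0 x.
  by rewrite -normrN -sinN -(normrN x) H// oppr_ge0.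
rewrite (ger0_norm x0) ler_norml sin_le_id// andbT.
have [x1|x1] := leP x 1.
  have : 0 <= sin x by apply: sin_ge0_pi; rewrite x0/=; have := @pi_ge2 R; lra.
  lra.
have := sin_geN1 x; lra.
Qed.

Lemma one_subr_cos_le (x : R) : 0 <= 1 - cos x <= x ^+ 2 / 2.
Proof.
apply/andP; split; first by rewrite subr_ge0 cos_le1.
have -> : 1 - cos x = 2 * sin (x / 2) ^+ 2.
  have {1}-> : x = (x / 2) *+ 2 by rewrite mulr2n; field.
  by rewrite cos_mulr2n sin2cos2 mulr2n; field.
have : sin (x / 2) ^+ 2 <= (x / 2) ^+ 2.
  by rewrite -(real_normK (num_real (sin _))) -(real_normK (num_real (x / 2))) lerXn2r ?nnegrE// norm_sin_le.
rewrite expr_div_n; lra.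
Qed.

Lemma sinB_id_le (x : R) : `|sin x - x| <= `|x| ^+ 3 / 2.
Proof.
wlog x0 : x / 0 <= x.
  move=> H; have [/H//|/ltW x0] := leP 0 x.
  by have := H (- x); rewrite oppr_ge0 sinN -opprD !normrN; exact.
have [->|xn0] := eqVneq x 0; first by rewrite sin0 subrr normr0 expr0n/= mul0r.
have xp : 0 < x by rewrite lt_neqAle eq_sym xn0.
have cs : {within `[0, x], continuous (@sin R)}.
  by apply: continuous_subspaceT => y; exact: continuous_sin.
have [y] := @MVT R sin cos 0 x xp (fun y _ => is_derive_sin y) cs.
rewrite in_itv/= => /andP[y0 yx].
rewrite sin0 !subr0 => ->; rewrite (ger0_norm x0) ler_norml.
have /andP[h1 h2] := one_subr_cos_le y.
have yx2 : y ^+ 2 <= x ^+ 2 by rewrite lerXn2r ?nnegrE// ltW.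
apply/andP; split; first by rewrite exprS; nra.
have : 0 <= x ^+ 3 by rewrite exprn_ge0.
nra.
Qed.

(** For x <= 1 the cubic remainder already gives x/2; beyond 1 monotonicity gives sin x >= sin 1 >=
    1/2, while x/4 <= pi/8. *)
Lemma sin_ge_quarter (x : R) : 0 <= x <= pi / 2 -> x / 4 <= sin x.
Proof.
move=> /andP[x0 xpi]; have [x1|x1] := leP x 1.
  have := sinB_id_le x; rewrite (ger0_norm x0) ler_norml => /andP[+ _].
  have : x ^+ 3 <= x by rewrite exprS; nra.
  lra.
have : sin 1 <= sin x.
  have [->//|/eqP ne] := eqVneq x 1.
  rewrite ltW// ltr_sin// in_itv/=; have := @pihalf_ge1 R => ?; apply/andP; split; lra.
have := sinB_id_le 1; rewrite normr1 ler_norml => /andP[+ _].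
have := @pihalf_lt2 R; rewrite expr1n; lra.
Qed.

Lemma norm_sin_half_ge (x : R) : `|x| <= pi -> `|x| <= 8 * `|sin (x / 2)|.
Proof.
wlog x0 : x / 0 <= x.
  move=> H; have [/H//|/ltW x0] := leP 0 x.
  by rewrite -(normrN x) -(normrN (sin _)) -sinN -mulNr; apply: H; rewrite oppr_ge0.
rewrite (ger0_norm x0) => xpi.
have : x / 2 / 4 <= sin (x / 2) by apply: sin_ge_quarter; apply/andP; split; lra.
move=> h; rewrite ger0_norm; lra.
Qed.

(** The upper bound comes from exp(x) (1 - x) <= 1, which is the lower bound 1 + x taken at -x. *)
Lemma expR_quad (x : R) : `|x| <= 1 / 2 -> 0 <= expR x - 1 - x <= 2 * x ^+ 2.
Proof.
rewrite ler_norml => /andP[x1 x2]; have := expR_ge1Dx x => h.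
apply/andP; split; first by lra.
have := expR_ge1Dx (- x); rewrite expRN => h2.
have e0 := expR_gt0 x.
have : expR x * (1 - x) <= 1.
  by have := ler_wpM2l (ltW e0) h2; rewrite mulfV// gt_eqF.
nra.
Qed.

(** Young's inequality for the product of t^a and 1, with conjugate exponents 1/a and 1/(1-a). *)
Lemma powR_Bernoulli (a t : R) : 0 < a < 1 -> 0 <= t -> t `^ a <= 1 + a * (t - 1).
Proof.
move=> /andP[a0 a1] t0.
have := @conjugate_powR R (t `^ a) 1 a^-1 (1 - a)^-1 (powR_ge0 _ _) ler01.
rewrite mulr1 powR1 mul1r !invrK -powRrM mulfV ?gt_eqF// powRr1//.
move=> H; have : t `^ a <= t * a + (1 - a) by apply: H; rewrite ?invr_gt0 ?subr_gt0//; lra.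
lra.
Qed.

(** For 0 <= y <= 2 pi the angle a y/2 stays in [0, a pi] with a pi < pi, so its sine vanishes only
    at y = 0. Up to pi/2 the sine is bounded below linearly, beyond pi/2 by sin (a pi). *)
Lemma sin_half_le (a : R) : 0 < a < 1 -> exists2 C : R, 1 <= C &
  forall y, `|y| <= 2 * pi -> `|sin (y / 2)| <= C * `|sin (a * y / 2)|.
Proof.
move=> /andP[a0 a1]; have p0 := @pi_gt0 R.
have sa : 0 < sin (a * pi) by apply: sin_gt0_pi; apply/andP; split; nra.
have sV : 0 < (sin (a * pi))^-1 by rewrite invr_gt0.
have aV : 1 < a^-1 by rewrite invf_gt1.
exists (4 / a + (sin (a * pi))^-1); first by lra.
move=> y; wlog y0 : y / 0 <= y.
  move=> H; have [/H//|/ltW y0] := leP 0 y.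
  by have := H (- y); rewrite oppr_ge0 mulrN !mulNr !sinN !normrN; exact.
rewrite (ger0_norm y0) => y2.
have [ay|ay] := leP (a * y / 2) (pi / 2).
  have h : a * y / 2 / 4 <= sin (a * y / 2) by apply: sin_ge_quarter; rewrite ay andbT; nra.
  have h1 : `|sin (y / 2)| <= y / 2.
    by rewrite (le_trans (norm_sin_le _))// ger0_norm; lra.
  have h2 : y / 2 = 4 / a * (a * y / 2 / 4) by field; rewrite gt_eqF.
  have h3 : 0 <= a * y by rewrite mulr_ge0// ltW.
  have h4 : 0 <= sin (a * y / 2) by lra.
  rewrite (ger0_norm h4) (le_trans h1)// h2 mulrDl.
  have : 4 / a * (a * y / 2 / 4) <= 4 / a * sin (a * y / 2) by rewrite ler_pM2l// divr_gt0.
  have := mulr_ge0 (ltW sV) h4; lra.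
have h : sin (a * pi) <= sin (a * y / 2).
  have sE (x : R) : sin x = sin (pi - x) by rewrite addrC sinDpi sinN opprK.
  rewrite (sE (a * pi)) (sE (a * y / 2)).
  rewrite leNgt ltr_sin -?leNgt ?in_itv/=.
  - nra.
  - apply/andP; split; nra.
  - apply/andP; split; nra.
rewrite (le_trans (sin_max _))// ger0_norm; last by lra.
rewrite mulrDl.
have : 1 <= (sin (a * pi))^-1 * sin (a * y / 2).
  by rewrite mulrC ler_pdivlMr// mul1r.
have : 0 <= 4 / a * sin (a * y / 2) by rewrite mulr_ge0 ?divr_ge0// ltW//; lra.
lra.
Qed.

(** By the half-angle law of cosines both squared chords are a radial part plus an angular part,
    compared separately: the radial parts by [powR_Bernoulli], the angular ones by [sin_half_le].
    The level drops out because both powers are taken at the same one, so that the two arguments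
    differ by less than 2 pi. *)
Lemma pow_lvl_chord (a : R) : 0 < a < 1 -> exists2 C : R, 1 <= C &
  forall (k : int) (n m : R[i]) (M : R), n != 0 -> m != 0 ->
    cmod n <= M -> cmod m <= M ->
    cmod (n - m) <= C * M `^ (1 - a) * cmod (pow_lvl a k n - pow_lvl a k m).
Proof.
move=> ha; have [C' C1 HC] := sin_half_le ha; case/andP: (ha) => a0 a1.
have aV : 1 < a^-1 by rewrite invf_gt1.
exists (C' / a); first by nra.
move=> k n m M; wlog mn : n m / cmod m <= cmod n.
  move=> H n0 m0 nM mM; have [/H|/ltW/H h] := leP (cmod m) (cmod n); first exact.
  by rewrite cmodB [X in _ <= _ * X]cmodB; exact: h.
move=> n0 m0 nM mM; have rp : 0 < cmod n by rewrite cmod_gt0.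
have sp : 0 < cmod m by rewrite cmod_gt0.
rewrite !pow_lvlE//.
set r := cmod n in rp mn nM *; set s := cmod m in sp mn mM *.
apply: (@le_trans _ _ (C' / a * r `^ (1 - a) *
    cmod ((r `^ a)%:C * cis (a * (arg n + 2 * pi * k%:~R)) -
          (s `^ a)%:C * cis (a * (arg m + 2 * pi * k%:~R))))); last first.
  rewrite ler_wpM2r ?cmod_ge0// ler_wpM2l//; first by nra.
  by apply: ge0_ler_powR => //; rewrite ?nnegrE; lra.
rewrite [X in cmod (X - _)](cmod_cis_arg n) [X in cmod (_ - X)](cmod_cis_arg m) -/r -/s.
have P0 := powR_gt0 (1 - a) rp; set P := r `^ (1 - a) in P0 *.
rewrite -ler_sqr ?nnegrE; last 2 first.
- exact: cmod_ge0.
- by rewrite !mulr_ge0 ?cmod_ge0// ?invr_ge0; lra.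
rewrite exprMn !cmod_polarB_sqr.
have -> : (a * (arg n + 2 * pi * k%:~R) - a * (arg m + 2 * pi * k%:~R)) / 2
  = a * (arg n - arg m) / 2 by ring.
set y := arg n - arg m.
have y2 : `|y| <= 2 * pi.
  have := arg_itv n0; have := arg_itv m0 => h1 h2.
  by rewrite ler_norml /y; apply/andP; split; lra.
have ra0 := powR_gt0 a rp; have sa0 := powR_gt0 a sp.
have Pra : P * r `^ a = r by rewrite -powRD ?subrK ?powRr1 ?ltW//; apply/implyP => _; rewrite gt_eqF.
(* Bernoulli at t = s/r, multiplied by r = P r^a. *)
have h1 : a * (r - s) <= P * (r `^ a - s `^ a).
  have := powR_Bernoulli ha (divr_ge0 (ltW sp) (ltW rp)).
  rewrite powRM ?invr_ge0 ?(ltW rp) ?(ltW sp)// -powR_inv1 ?(ltW rp)// -powRrM mulN1r powRN => h.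
  have := ler_wpM2l (ltW rp) h.
  have -> : r * (s `^ a / r `^ a) = P * s `^ a by rewrite -{1}Pra; field; rewrite gt_eqF.
  have -> : r * (1 + a * (s * r `^ (-1) - 1)) = r + a * (s - r).
    by rewrite powR_inv1 ?ltW//; field; rewrite gt_eqF.
  rewrite [P * (_ - _)]mulrBr Pra; lra.
have h2 : r * s <= P ^+ 2 * (r `^ a * s `^ a).
  have -> : P ^+ 2 * (r `^ a * s `^ a) = (P * r `^ a) * (P * s `^ a) by ring.
  rewrite Pra ler_pM2l//.
  have {1}-> : s = s `^ (1 - a) * s `^ a.
    by rewrite -powRD ?subrK ?powRr1 ?ltW//; apply/implyP => _; rewrite gt_eqF.
  by rewrite ler_pM2r//; apply: ge0_ler_powR => //; rewrite ?nnegrE; lra.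
have h3 := HC _ y2.
have h3' : sin (y / 2) ^+ 2 <= C' ^+ 2 * sin (a * y / 2) ^+ 2.
  rewrite -(real_normK (num_real (sin (y / 2)))) -(real_normK (num_real (sin (a * y / 2)))).
  by rewrite -exprMn lerXn2r ?nnegrE// mulr_ge0//; lra.
have e1 : (r - s) ^+ 2 <= (C' / a * P) ^+ 2 * (r `^ a - s `^ a) ^+ 2.
  rewrite -exprMn lerXn2r ?nnegrE ?subr_ge0//.
    rewrite !mulr_ge0 ?invr_ge0 ?subr_ge0//; try lra.
    by apply: ge0_ler_powR => //; rewrite ?nnegrE; lra.
  have -> : C' / a * P * (r `^ a - s `^ a) = (C' / a) * (P * (r `^ a - s `^ a)) by ring.
  have : C' / a * (a * (r - s)) <= C' / a * (P * (r `^ a - s `^ a)).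
    by rewrite ler_pM2l// divr_gt0//; lra.
  have -> : C' / a * (a * (r - s)) = C' * (r - s) by field; rewrite gt_eqF.
  nra.
have e2 : 4 * r * s * sin (y / 2) ^+ 2 <=
    (C' / a * P) ^+ 2 * (4 * r `^ a * s `^ a * sin (a * y / 2) ^+ 2).
  have -> : (C' / a * P) ^+ 2 * (4 * r `^ a * s `^ a * sin (a * y / 2) ^+ 2)
    = (4 * (P ^+ 2 * (r `^ a * s `^ a))) * ((a^-1) ^+ 2 * (C' ^+ 2 * sin (a * y / 2) ^+ 2)) by ring.
  have -> : 4 * r * s * sin (y / 2) ^+ 2 = (4 * (r * s)) * sin (y / 2) ^+ 2 by ring.
  apply: ler_pM; rewrite ?sqr_ge0//.
  - by rewrite !mulr_ge0// ltW.
  - by rewrite ler_pM2l.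
  - have aV2 : 1 <= a^-1 ^+ 2 by nra.
    by rewrite (le_trans h3')// ler_peMl//; apply: mulr_ge0; exact: sqr_ge0.
rewrite mulrDr; exact: lerD.
Qed.

Lemma expC_quad (x y : R) : `|x| <= 1 / 2 -> `|y| <= 1 / 2 ->
  cmod ((expR x)%:C * cis y - 1 - (x +i* y)) <= 8 * (`|x| + `|y|) ^+ 2.
Proof.
move=> x2 y2; have /andP[e1 e2] := expR_quad x2.
have /andP[c1 c2] := one_subr_cos_le y; have s1 := sinB_id_le y.
apply: le_trans (cmod_le_ReIm _) _.
rewrite /cis; simpc => /=.
have x2E : x ^+ 2 = `|x| ^+ 2 by rewrite real_normK ?num_real.
have y2E : y ^+ 2 = `|y| ^+ 2 by rewrite real_normK ?num_real.
have nx := normr_ge0 x; have ny := normr_ge0 y.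
have xle := ler_norm x; have xge := ler_norm (- x); rewrite normrN in xge.
have re : `|expR x * cos y - 1 - x| <= 2 * `|x| ^+ 2 + `|y| ^+ 2.
  have -> : expR x * cos y - 1 - x = (expR x - 1 - x) * cos y - (1 + x) * (1 - cos y) by ring.
  have := ler_normB ((expR x - 1 - x) * cos y) ((1 + x) * (1 - cos y)).
  rewrite !normrM (ger0_norm e1) (ger0_norm c1) => h.
  have h1 : (expR x - 1 - x) * `|cos y| <= 2 * `|x| ^+ 2.
    by rewrite -x2E (le_trans _ e2)// ler_piMr// cos_max.
  have h2 : `|1 + x| * (1 - cos y) <= `|y| ^+ 2.
    rewrite ger0_norm; last by lra.
    rewrite -y2E; nra.
  lra.
have im : `|expR x * sin y - y| <= 2 * `|x| * `|y| + `|y| ^+ 2.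
  have -> : expR x * sin y - y = (expR x - 1) * sin y + (sin y - y) by ring.
  have := ler_normD ((expR x - 1) * sin y) (sin y - y).
  rewrite normrM => h.
  have h1 : `|expR x - 1| <= 2 * `|x|.
    have : x ^+ 2 <= `|x| / 2 by rewrite x2E; nra.
    by rewrite ler_norml => ?; apply/andP; split; lra.
  have h2 : `|expR x - 1| * `|sin y| <= 2 * `|x| * `|y| by rewrite ler_pM// norm_sin_le.
  have h3 : `|y| ^+ 3 / 2 <= `|y| ^+ 2.
    have : 0 <= `|y| ^+ 2 by rewrite sqr_ge0.
    rewrite exprS; nra.
  lra.
nra.
Qed.

Lemma pow_lvlM (a : R) (k : int) z : z != 0 -> pow_lvl (a - 1) k z * z = pow_lvl a k z.
Proof.
move=> z0; rewrite !pow_lvlE//.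
rewrite [X in _ * X = _](cmod_cis_arg z).
have zp : 0 < cmod z by rewrite cmod_gt0.
have -> : cmod z `^ a = cmod z `^ (a - 1) * cmod z.
  rewrite -[X in _ = _ * X]powRr1 ?ltW// -powRD ?subrK//.
  by apply/implyP => _; rewrite gt_eqF.
rewrite rmorphM/= -!mulrA; congr (_ * _); rewrite mulrCA; congr (_ * _).
rewrite -cisD -[RHS](cis_shift _ (- k)); congr cis; rewrite rmorphN/=; ring.
Qed.

(** Write m = n exp(x + iy) with y the difference of the arguments. At a common level m^[a,k] =
    n^[a,k] exp(ax + iay) exactly, and both exponentials have quadratic remainders. With u = |n -
    m|/|n| one gets |x| <= 2u and |y| <= 8u, so each remainder is at most 8 (10u)^2, and two of them
    make 1600 u^2. Bounding y by the chord requires |y| <= pi: across the cut, close points have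
    distant arguments. *)
Lemma pow_lvl_linear (a : R) (k : int) (n m : R[i]) : 0 < a < 1 ->
  n != 0 -> m != 0 -> `|arg n - arg m| <= pi -> cmod (n - m) <= cmod n / 20 ->
  cmod (pow_lvl a k n - pow_lvl a k m - a%:C * (pow_lvl (a - 1) k n * (n - m)))
    <= 1600 * cmod n `^ a * (cmod (n - m) / cmod n) ^+ 2.
Proof.
move=> /andP[a0 a1] n0 m0 ynm nm.
have rp : 0 < cmod n by rewrite cmod_gt0.
have sp : 0 < cmod m by rewrite cmod_gt0.
set r := cmod n in rp nm *.
pose s := cmod m; pose q := s / r; pose y := arg m - arg n; pose x := ln q.
have qp : 0 < q by rewrite divr_gt0.
have qE : expR x = q by rewrite lnK.
pose E x y : R[i] := (expR x)%:C * cis y - 1.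
have mE : m = n * (1 + E x y).
  rewrite /E addrC subrK qE {1}(cmod_cis_arg m) {1}(cmod_cis_arg n) -/r -/s.
  have -> : s = r * q by rewrite /q mulrC divfK ?gt_eqF.
  have -> : arg m = arg n + y by rewrite /y addrC subrK.
  by rewrite cisD rmorphM/=; ring.
have pmE : pow_lvl a k m = pow_lvl a k n * (1 + E (a * x) (a * y)).
  rewrite /E addrC subrK !pow_lvlE// -/r -/s.
  have -> : s `^ a = r `^ a * expR (a * x).
    have -> : s = r * q by rewrite /q mulrC divfK ?gt_eqF.
    by rewrite powRM ?ltW// (mulrC a) expRM qE.
  have -> : a * (arg m + 2 * pi * k%:~R) = a * (arg n + 2 * pi * k%:~R) + a * y by rewrite /y; ring.
  by rewrite cisD rmorphM/=; ring.
set u := cmod (n - m) / r.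
have uE : u = cmod (E x y).
  rewrite /u mE -[X in X - _]mulr1 -mulrBr cmodM opprD addrA subrr sub0r cmodN -/r.
  by rewrite mulrC mulKf// gt_eqF.
have u0 : 0 <= u by rewrite uE cmod_ge0.
have u20 : u <= 1 / 20 by rewrite /u ler_pdivrMr//; lra.
have -> : pow_lvl a k n - pow_lvl a k m - a%:C * (pow_lvl (a - 1) k n * (n - m))
   = - (pow_lvl a k n * (E (a * x) (a * y) - a%:C * E x y)).
  rewrite pmE mE -[pow_lvl a k n]pow_lvlM//; ring.
have -> : 1600 * r `^ a * u ^+ 2 = r `^ a * (1600 * u ^+ 2) by ring.
rewrite cmodN cmodM; have -> : cmod (pow_lvl a k n) = r `^ a.
  by rewrite pow_lvlE// cmodMC ?powR_ge0// cmod_cis mulr1.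
rewrite ler_wpM2l ?powR_ge0//.
have q1 : `|q - 1| <= u.
  have := ler_cmod_dist ((expR x)%:C * cis y) 1.
  rewrite -/(E x y) -uE cmodMC ?expR_ge0// cmod_cis mulr1 qE.
  by have -> : cmod (1 : R[i]) = 1 by rewrite -[1 in LHS]/(1%:C) cmodC normr1.
have q1' := q1; rewrite ler_norml in q1'; case/andP: q1' => q1l q1r.
have x2u : `|x| <= 2 * u.
  rewrite ler_norml; apply/andP; split.
    have : - x <= q^-1 - 1.
      rewrite /x -lnV ?posrE//; have := @le_ln1Dx _ (q^-1 - 1).
      have -> : 1 + (q^-1 - 1) = q^-1 by ring.
      have qV : 0 < q^-1 by rewrite invr_gt0.
      apply; lra.
    have : q^-1 - 1 <= 2 * u.
      rewrite lerBlDr -[q^-1]mul1r ler_pdivrMr//; nra.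
    lra.
  have := @le_ln1Dx _ (q - 1); have -> : 1 + (q - 1) = q by ring.
  rewrite -/x; lra.
have yu : `|y| <= 8 * u.
  have y' : `|y| <= pi by rewrite /y -normrN opprB.
  rewrite (le_trans (norm_sin_half_ge y'))// ler_pM2l//.
  rewrite -ler_sqr ?nnegrE// real_normK ?num_real// uE.
  have := cmod_polarB_sqr q 1 y 0; rewrite cis0 mulr1 subr0 => h.
  rewrite /E qE -[X in _ - X]/(1%:C) h; have := sqr_ge0 (q - 1); have := sqr_ge0 (sin (y / 2)); nra.
have nax (z : R) : `|a * z| <= `|z|.
  by rewrite normrM (ger0_norm (ltW a0)) ler_piMl// ltW.
have x12 : `|x| <= 1 / 2 by lra.
have y12 : `|y| <= 1 / 2 by lra.
have g1 := expC_quad x12 y12.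
have g2 := expC_quad (le_trans (nax x) x12) (le_trans (nax y) y12).
rewrite -/(E x y) in g1; rewrite -/(E (a * x) (a * y)) in g2.
have -> : E (a * x) (a * y) - a%:C * E x y =
    (E (a * x) (a * y) - (a * x +i* (a * y))) - a%:C * (E x y - (x +i* y)).
  have -> : a * x +i* (a * y) = a%:C * (x +i* y) by simpc.
  by ring.
apply: le_trans (ler_cmodB _ _) _; rewrite (cmodMC _ (ltW a0)).
have b1 : (`|x| + `|y|) ^+ 2 <= 100 * u ^+ 2.
  have -> : 100 * u ^+ 2 = (10 * u) ^+ 2 by ring.
  by rewrite lerXn2r ?nnegrE ?addr_ge0//; lra.
have b2 : (`|a * x| + `|a * y|) ^+ 2 <= 100 * u ^+ 2.
  by apply: le_trans b1; rewrite lerXn2r ?nnegrE ?addr_ge0// lerD.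
have c0 := cmod_ge0 (E x y - (x +i* y)).
have : a * cmod (E x y - (x +i* y)) <= cmod (E x y - (x +i* y)) by rewrite ler_piMl// ltW.
lra.
Qed.

End complex_modulus.

(** * Planar Lebesgue measure, discs and sectors *)

(** [leb2] is a plain definition; the measure structure of the product is copied onto it. *)
HB.instance Definition _ (R : realType) :=
  Measure.copy (@leb2 R) (@lebesgue_measure R \x @lebesgue_measure R)%E.

Section planar_measure.
Variable R : realType.
Implicit Types (z w : R[i]) (A B : set R[i]).

Lemma lebesgue_measure_shift (c : R) (X : set R) : measurable X ->
  lebesgue_measure ((fun y : R => y + c) @^-1` X) = lebesgue_measure X.
Proof.
move=> mX.
have mf : measurable_fun [set: measurableTypeR R] (fun y : measurableTypeR R => (y + c : measurableTypeR R)).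
  by apply: measurable_funD.
pose m' := pushforward (@lebesgue_measure R) (fun y : measurableTypeR R => (y + c : measurableTypeR R)).
pose m'' := measure_function_pushforward__canonical__measure_function_Measure (@lebesgue_measure R) mf.
apply/esym; apply: (@lebesgue_measure_unique R m'') => // _ [[x y] _ <-]/=.
rewrite /pushforward.
have -> : (fun y : R => y + c) @^-1` `]x, y]%classic = `]x - c, y - c]%classic.
  by apply/seteqP; split => u /=; rewrite !in_itv/= => /andP[h1 h2]; apply/andP; split; lra.
rewrite !lebesgue_measure_itv/= !lte_fin ltrD2r.
by case: ifP => // _; congr (_%:E); ring.
Qed.

(** Translations and rotations of the plane are compositions of shears, and a shear only translates
    each fibre. Invariance of area under both thus reduces to translation invariance on the line. *)
Definition shearX (u : R -> R) (p : R * R) : R * R := (p.1 + u p.2, p.2).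
Definition shearY (u : R -> R) (p : R * R) : R * R := (p.1, p.2 + u p.1).

Lemma measurable_shearX (u : R -> R) : measurable_fun setT u ->
  measurable_fun setT (shearX u).
Proof.
move=> mu; apply: measurable_fun_pair => //.
by apply: measurable_funD => //; exact: measurableT_comp.
Qed.

Lemma measurable_shearY (u : R -> R) : measurable_fun setT u ->
  measurable_fun setT (shearY u).
Proof.
move=> mu; apply: measurable_fun_pair => //.
by apply: measurable_funD => //; exact: measurableT_comp.
Qed.

Lemma leb2_shearY (u : R -> R) (X : set (R * R)) : measurable_fun setT u ->
  measurable X -> leb2 (shearY u @^-1` X) = leb2 X.
Proof.
move=> mu mX; apply: eq_integral => x _ /=.
rewrite -(@lebesgue_measure_shift (u x) (xsection X x)); last exact: measurable_xsection.
by congr lebesgue_measure; apply/seteqP; split => y; rewrite /xsection /= !inE.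
Qed.

Lemma leb2E (X : set (R * R)) : measurable X ->
  leb2 X = (@lebesgue_measure R \x^ @lebesgue_measure R)%E X.
Proof.
by move=> mX; apply: product_measure_unique => // A B mA mB; exact: product_measure2E.
Qed.

(** The fibres translated here are the horizontal ones, so the product measure is first rewritten
    with the order of integration exchanged. *)
Lemma leb2_shearX (u : R -> R) (X : set (R * R)) : measurable_fun setT u ->
  measurable X -> leb2 (shearX u @^-1` X) = leb2 X.
Proof.
move=> mu mX; rewrite !leb2E//; last first.
  by rewrite -[_ @^-1` _]setTI; apply: measurable_shearX.
apply: eq_integral => y _ /=.
rewrite -(@lebesgue_measure_shift (u y) (ysection X y)); last exact: measurable_ysection.
by congr lebesgue_measure; apply/seteqP; split => x; rewrite /ysection /= !inE.
Qed.

Definition measurable_plane A := measurable (@toC R @^-1` A).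

Lemma measurable_preimageT d (T : measurableType d) (f : T -> R) (X : set R) :
  measurable_fun setT f -> measurable X -> measurable (f @^-1` X).
Proof. by move=> mf mX; rewrite -[_ @^-1` _]setTI; exact: mf. Qed.

Lemma leb2_translate (c : R[i]) A : measurable_plane A ->
  leb2 (@toC R @^-1` ((fun z => z + c) @^-1` A)) = leb2 (@toC R @^-1` A).
Proof.
move=> mA.
transitivity (leb2 (shearX (cst (Re c)) @^-1` (shearY (cst (Im c)) @^-1` (@toC R @^-1` A)))).
  by congr leb2; apply/seteqP; split => -[x y]; rewrite /toC/=; case: c.
rewrite leb2_shearX ?leb2_shearY//.
by rewrite -[_ @^-1` _]setTI; apply: measurable_shearY.
Qed.

Lemma measurable_plane_translate (c : R[i]) A : measurable_plane A ->
  measurable_plane ((fun z => z + c) @^-1` A).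
Proof.
move=> mA; rewrite /measurable_plane.
have -> : @toC R @^-1` ((fun z => z + c) @^-1` A) =
    shearX (cst (Re c)) @^-1` (shearY (cst (Im c)) @^-1` (@toC R @^-1` A)).
  by apply/seteqP; split => -[x y]; rewrite /toC/=; case: c.
rewrite -[_ @^-1` _]setTI; apply: measurable_shearX => //.
by rewrite -[_ @^-1` _]setTI; apply: measurable_shearY.
Qed.

(* A plane rotation is a product of three shears. *)
Lemma rotation_shears (t : R) A : sin t != 0 ->
  let u := fun x : R => - ((1 - cos t) / sin t) * x in
  @toC R @^-1` ((fun z => z * cis t) @^-1` A) =
  shearX u @^-1` (shearY (fun x => sin t * x) @^-1` (shearX u @^-1` (@toC R @^-1` A))).
Proof.
move=> s0 u.
have E (x y : R) : toC (x, y) * cis t =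
    toC (shearX u (shearY (fun x => sin t * x) (shearX u (x, y)))).
  rewrite /toC/= /cis; simpc.
  have cs := cos2Dsin2 t.
  have c2 : cos t ^+ 2 = 1 - sin t ^+ 2 by rewrite -cs addrK.
  congr (_ +i* _); rewrite /u; field: c2 => //.
by apply/seteqP; split => -[x y]; rewrite /preimage/= ?E// -E.
Qed.

Lemma leb2_rotate (t : R) A : sin t != 0 -> measurable_plane A ->
  leb2 (@toC R @^-1` ((fun z => z * cis t) @^-1` A)) = leb2 (@toC R @^-1` A).
Proof.
move=> s0 mA; rewrite rotation_shears//; set u := fun x : R => _.
have mul_meas (c : R) : measurable_fun setT (fun x : R => c * x).
  by apply: measurable_funM.
have m1 : measurable (shearX u @^-1` (@toC R @^-1` A)).
  by rewrite -[_ @^-1` _]setTI; apply: measurable_shearX => //; exact: mul_meas.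
rewrite leb2_shearX; [|exact: mul_meas|]; last first.
  by rewrite -[_ @^-1` _]setTI; apply: measurable_shearY => //; exact: mul_meas.
rewrite leb2_shearY; [|exact: mul_meas|exact: m1].
by rewrite leb2_shearX//; exact: mul_meas.
Qed.

Definition bndC A := exists r : R, forall z, A z -> cmod z <= r.

Lemma leb2_rect (a b c d : R) : a <= b -> c <= d ->
  leb2 (`[a, b]%classic `*` `[c, d]%classic) = ((b - a) * (d - c))%:E.
Proof.
move=> ab cd; transitivity (lebesgue_measure `[a, b]%classic * lebesgue_measure `[c, d]%classic)%E.
  exact: product_measure1E.
rewrite !lebesgue_measure_itv/= !lte_fin.
move: ab cd; rewrite !le_eqVlt => /predU1P[->|->] /predU1P[->|->];
  by rewrite ?ltxx ?subrr ?mul0e ?mule0 ?mul0r ?mulr0.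
Qed.

Lemma leb2_lty A : measurable_plane A -> bndC A -> (leb2 (@toC R @^-1` A) < +oo)%E.
Proof.
move=> mA [r Ar].
pose q := Num.max 0 r.
have q0 : 0 <= q by rewrite le_max lexx.
apply: (@le_lt_trans _ _ (leb2 (`[-q, q]%classic `*` `[-q, q]%classic))); last first.
  by rewrite leb2_rect ?ltry//; lra.
apply: le_measure; rewrite ?inE//.
  by apply: measurableX.
move=> [x y] /Ar /= h.
have hq : cmod (x +i* y) <= q by rewrite le_max h orbT.
have h1 := le_trans (ler_norm_Re _) hq; have h2 := le_trans (ler_norm_Im _) hq.
by split => /=; rewrite in_itv/= -ler_norml.
Qed.

Lemma leb2_fin A : measurable_plane A -> bndC A -> leb2 (@toC R @^-1` A) \is a fin_num.
Proof. by move=> mA bA; rewrite ge0_fin_numE ?measure_ge0// leb2_lty. Qed.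

Lemma leb2_area A : measurable_plane A -> bndC A ->
  leb2 (@toC R @^-1` A) = (area A)%:E.
Proof. by move=> mA bA; rewrite fineK// leb2_fin. Qed.

Lemma area_ge0 A : 0 <= area A.
Proof. by rewrite fine_ge0// measure_ge0. Qed.

Lemma sub_bndC A B : A `<=` B -> bndC B -> bndC A.
Proof. by move=> AB [r Br]; exists r => z /AB /Br. Qed.

Lemma bndCU A B : bndC A -> bndC B -> bndC (A `|` B).
Proof.
move=> [r Ar] [s Bs]; exists (Num.max r s) => z [/Ar h|/Bs h]; by rewrite le_max h ?orbT.
Qed.

Lemma measurable_planeU A B : measurable_plane A -> measurable_plane B -> measurable_plane (A `|` B).
Proof. exact: measurableU. Qed.

Lemma measurable_planeI A B : measurable_plane A -> measurable_plane B -> measurable_plane (A `&` B).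
Proof. exact: measurableI. Qed.

Lemma measurable_planeD A B : measurable_plane A -> measurable_plane B -> measurable_plane (A `\` B).
Proof. exact: measurableD. Qed.

Lemma le_area A B : measurable_plane A -> measurable_plane B -> bndC B -> A `<=` B ->
  area A <= area B.
Proof.
move=> mA mB bB AB; rewrite -lee_fin -!leb2_area//; last exact: sub_bndC bB.
by apply: le_measure; rewrite ?inE// => p /AB.
Qed.

Lemma areaU A B : measurable_plane A -> measurable_plane B -> bndC A -> bndC B ->
  A `&` B = set0 -> area (A `|` B) = area A + area B.
Proof.
move=> mA mB bA bB AB; apply: EFin_inj.
rewrite EFinD -!leb2_area//; [|exact: measurable_planeU|exact: bndCU].
rewrite preimage_setU measureU//.
by rewrite -preimage_setI AB preimage_set0.
Qed.

Lemma area_set0 : area (set0 : set R[i]) = 0.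
Proof. by rewrite /area preimage_set0 measure0. Qed.

Lemma area_leU A B : measurable_plane A -> measurable_plane B -> bndC A -> bndC B ->
  area (A `|` B) <= area A + area B.
Proof.
move=> mA mB bA bB; rewrite -lee_fin EFinD -!leb2_area//; [|exact: measurable_planeU|exact: bndCU].
by rewrite preimage_setU; exact: measureU2.
Qed.

Lemma area_bigcup_seq (I : choiceType) (s : seq I) (F : I -> set R[i]) :
  uniq s -> (forall i, measurable_plane (F i)) -> (forall i, bndC (F i)) ->
  (forall i j z, F i z -> F j z -> i = j) ->
  [/\ measurable_plane (\bigcup_(i in [set` s]) F i), bndC (\bigcup_(i in [set` s]) F i) &
   area (\bigcup_(i in [set` s]) F i) = \sum_(i <- s) area (F i)].
Proof.
move=> us mF bF dF; elim: s us => [_|i s IH /= /andP[si us]].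
  rewrite big_nil set_nil bigcup_set0; split; last exact: area_set0.
    by rewrite /measurable_plane preimage_set0.
  by exists 0.
have [m b e] := IH us.
have -> : \bigcup_(j in [set` i :: s]) F j = F i `|` \bigcup_(j in [set` s]) F j.
  apply/seteqP; split => z.
    by move=> [j /=]; rewrite inE => /predU1P[->|js] Fj; [left|right; exists j].
  by move=> [Fi|[j js Fj]]; [exists i => //=; rewrite inE eqxx|exists j => //=; rewrite inE js orbT].
split; [exact: measurable_planeU|exact: bndCU|].
rewrite big_cons -e areaU//; apply/seteqP; split => // z [Fi [j js Fj]].
by have ij := dF _ _ _ Fi Fj; move: si; rewrite ij js.
Qed.

Lemma area_translate (c : R[i]) A : measurable_plane A ->
  area ((fun z => z + c) @^-1` A) = area A.
Proof. by move=> mA; rewrite /area leb2_translate. Qed.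

Lemma area_rotate (t : R) A : sin t != 0 -> measurable_plane A ->
  area ((fun z => z * cis t) @^-1` A) = area A.
Proof. by move=> t0 mA; rewrite /area leb2_rotate. Qed.

Lemma measurable_fun_cmod : measurable_fun setT (fun p : R * R => cmod (toC p)).
Proof.
have -> : (fun p : R * R => cmod (toC p)) =
    @Num.sqrt R \o (fun p : R * R => p.1 ^+ 2 + p.2 ^+ 2) by [].
apply: measurableT_comp.
  by apply: continuous_measurable_fun; exact: sqrt_continuous.
by apply: measurable_funD; apply: measurable_funX.
Qed.

Lemma measurable_plane_cmod (X : set R) : measurable X -> measurable_plane [set z | X (cmod z)].
Proof. by move=> mX; exact: (measurable_preimageT measurable_fun_cmod mX). Qed.

Lemma measurable_fun_ImM (w : R[i]) : measurable_fun setT (fun p : R * R => Im (toC p * w)).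
Proof.
case: w => c d.
have -> : (fun p : R * R => Im (toC p * (c +i* d))) = (fun p => p.1 * d + p.2 * c) by [].
by apply: measurable_funD; apply: measurable_funM.
Qed.

Lemma measurable_plane_ImM (w : R[i]) (X : set R) : measurable X ->
  measurable_plane [set z | X (Im (z * w))].
Proof. by move=> mX; exact: (measurable_preimageT (measurable_fun_ImM w) mX). Qed.

(** * Areas of discs, annuli, strips and sectors *)

Lemma integral_half_circle (r : R) : 0 < r ->
  (\int[lebesgue_measure]_(x in `[(- r)%R, r]) (2 * Num.sqrt (r ^+ 2 - x ^+ 2))%:E = (pi * r ^+ 2)%:E)%E.
Proof.
move=> r0.
pose d : R -> R := fun x => r ^+ 2 - x ^+ 2.
pose c : R -> R := Num.sqrt \o d.
pose q : R -> R := fun x => x * (r + c x)^-1.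
(* [2 atan (x / (r + sqrt (r^2 - x^2)))] is [asin (x / r)], in a form that is visibly continuous at [r] and [-r]. *)
pose F : R -> R := fun x => x * c x + 2 * r ^+ 2 * atan (q x).
have dd : continuous d.
  by move=> x; apply: cvgB; [exact: cvg_cst|exact: exprn_continuous].
have cc : continuous c.
  by move=> x; apply: continuous_comp; [exact: dd|exact: sqrt_continuous].
have c0 x : 0 <= c x by exact: sqrtr_ge0.
have rcp x : 0 < r + c x by rewrite ltr_pwDl.
have rc x : r + c x != 0 by rewrite gt_eqF.
have cF : continuous F.
  move=> x; apply: cvgD; first by apply: cvgM; [exact: cvg_id|exact: cc].
  apply: cvgM; first exact: cvg_cst.
  apply: continuous_comp; last exact: continuous_atan.
  apply: cvgM; first exact: cvg_id.
  by apply: cvgV; [exact: rc|apply: cvgD; [exact: cvg_cst|exact: cc]].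
have dF x : x \in `]- r, r[ -> is_derive x 1 F (2 * c x).
  rewrite in_itv/= => /andP[x1 x2].
  have rx : 0 < r ^+ 2 - x ^+ 2 by nra.
  have cx : 0 < c x by rewrite /c/= sqrtr_gt0.
  have cE : c x ^+ 2 = r ^+ 2 - x ^+ 2 by rewrite sqr_sqrtr// ltW.
  have dc : is_derive x 1 c (- (x / c x)).
    have d1 : is_derive x 1 d (- (2 * x)).
      apply: is_derive_eq; rewrite /GRing.scale/=; ring.
    have h := @is_derive1_comp R Num.sqrt d x _ _ (@is_derive1_sqrt R (d x) rx) d1.
    apply: is_derive_eq h _; rewrite -/(c x) -[Num.sqrt _]/(c x); field; rewrite gt_eqF//.
  have dq : is_derive x 1 q (r / (c x * (r + c x))).
    have h1 : is_derive x 1 (fun x => r + c x) (- (x / c x)).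
      by apply: is_derive_eq (is_deriveD (is_derive_cst r x 1) dc) _; rewrite add0r.
    have h2 := @is_deriveV R (fun x => r + c x) x _ 1 (rc x) h1.
    have h3 := is_deriveM (is_derive_id x 1) h2.
    apply: is_derive_eq h3 _; rewrite /GRing.scale/=.
    have -> : x * (- (r + c x) ^- 2 * - (x / c x)) + (r + c x)^-1 * 1 =
      (x ^+ 2 + c x * (r + c x)) / (c x * (r + c x) ^+ 2) by field; rewrite rc gt_eqF.
    have -> : x ^+ 2 = r ^+ 2 - c x ^+ 2 by rewrite cE; ring.
    by field; rewrite rc gt_eqF.
  have da : is_derive x 1 (atan \o q) (2 * c x)^-1.
    have h := @is_derive1_comp R atan q x _ _ (is_derive1_atan (q x)) dq.
    apply: is_derive_eq h _.
    have -> : 1 + q x ^+ 2 = 2 * r / (r + c x).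
      rewrite /q exprMn; have -> : x ^+ 2 = r ^+ 2 - c x ^+ 2 by rewrite cE; ring.
      by field; rewrite rc.
    by field; rewrite rc !gt_eqF.
  have h1 := is_deriveM (is_derive_id x 1) dc.
  have h2 := is_deriveM (is_derive_cst (2 * r ^+ 2) x 1) da.
  have h := is_deriveD h1 h2.
  apply: is_derive_eq h _; rewrite /GRing.scale/=.
  have -> : r ^+ 2 = c x ^+ 2 + x ^+ 2 by rewrite cE subrK.
  by field; rewrite gt_eqF.
have := @continuous_FTC2 R (fun x => 2 * c x) F (- r) r.
move=> ->.
- rewrite -EFinB; congr _%:E; rewrite /F /q.
  have cr : c r = 0 by rewrite /c/= /d subrr sqrtr0.
  have cNr : c (- r) = 0 by rewrite /c/= /d sqrrN subrr sqrtr0.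
  rewrite cr cNr !addr0 !mulNr mulfV ?gt_eqF// atanN atan1; field; lra.
- lra.
- have c2 : continuous (fun x : R => 2 * c x).
    by move=> x; apply: cvgM; [exact: cvg_cst|exact: cc].
  exact: continuous_subspaceT.
- split.
  + by move=> x /dF [].
  + by apply: cvg_at_right_filter; exact: cF.
  + by apply: cvg_at_left_filter; exact: cF.
- by move=> x /dF h; rewrite derive1E derive_val.
Qed.

(** These are the vertical sections of a disc, closed if [b] and open otherwise, with d = r^2 - x^2.
    For d < 0 the section is empty, in agreement with the square root being 0 there. *)
Lemma lebesgue_measure_sqr_lteif (b : bool) (d : R) :
  lebesgue_measure [set y : R | y ^+ 2 < d ?<= if b] = (2 * Num.sqrt d)%:E.
Proof.
have [d0|d0] := ltP d 0.
  rewrite ltr0_sqrtr// mulr0 (_ : [set _ | _] = set0) ?measure0//.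
  apply/seteqP; split => // y /=; have := sqr_ge0 y.
  by case: b => /=; lra.
pose s := Num.sqrt d; have s0 : 0 <= s by rewrite sqrtr_ge0.
have sE : s ^+ 2 = d by rewrite sqr_sqrtr.
rewrite (_ : [set _ | _] = [set` Interval (BSide b (- s)) (BSide (~~ b) s)]).
  rewrite lebesgue_measure_itv/= lte_fin -/s.
  move: s0; rewrite le_eqVlt => /predU1P[<-|s0]; first by rewrite oppr0 ltxx mulr0.
  have h : - s < s by lra.
  by rewrite h -EFinB; congr _%:E; ring.
apply/seteqP; split => y /=; rewrite in_itv/= -sE; case: b => /=.
- by move=> h; apply/andP; split; nra.
- by move=> h; apply/andP; split; nra.
- by move=> /andP[h1 h2]; nra.
- by move=> /andP[h1 h2]; nra.
Qed.

Lemma leb2_disc (b : bool) (r : R) : 0 <= r ->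
  leb2 (@toC R @^-1` [set z | cmod z < r ?<= if b]) = (pi * r ^+ 2)%:E.
Proof.
move=> r0.
transitivity (\int[lebesgue_measure]_x (2 * Num.sqrt (r ^+ 2 - x ^+ 2))%:E)%E.
  apply: eq_integral => x _ /=.
  rewrite -(lebesgue_measure_sqr_lteif b); congr lebesgue_measure.
  apply/seteqP; split => y; rewrite /xsection/= inE/= /toC/=.
    have := cmod_ge0 (x +i* y); have /= := cmod_sqr (x +i* y).
    by case: b => /=; nra.
  have := cmod_ge0 (x +i* y); have /= := cmod_sqr (x +i* y).
  by case: b => /=; nra.
move: r0; rewrite le_eqVlt => /predU1P[<-|r0].
  rewrite expr0n/= mulr0 integral0_eq// => x _.
  by rewrite sub0r ler0_sqrtr ?mulr0// oppr_le0 sqr_ge0.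
rewrite -integral_half_circle// [RHS]integral_mkcond.
apply: eq_integral => x _; rewrite patchE; case: ifPn => // xr.
rewrite ler0_sqrtr ?mulr0//.
have : ~ (- r <= x <= r) by move=> h; move: xr; rewrite notin_setE/= in_itv/= h.
by move=> h; rewrite leNgt; apply/negP => h2; apply: h; apply/andP; split; nra.
Qed.

Lemma measurable_plane_disc (b : bool) (r : R) : measurable_plane [set z | cmod z < r ?<= if b].
Proof.
have := @measurable_plane_cmod [set` Interval -oo%O (BSide (~~ b) r)] (measurable_itv _).
by congr measurable_plane; apply/seteqP; split => z/=; rewrite in_itv/=; case: b.
Qed.

Lemma area_disc (b : bool) (r : R) : 0 <= r ->
  area [set z : R[i] | cmod z < r ?<= if b] = pi * r ^+ 2.
Proof. by move=> r0; rewrite /area leb2_disc. Qed.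

Lemma bndC_disc (b : bool) (r : R) : bndC [set z : R[i] | cmod z < r ?<= if b].
Proof. by exists r => z /lteifW. Qed.

Lemma area_annulus (b : bool) (s r : R) : 0 <= s <= r ->
  area [set z : R[i] | (s < cmod z ?<= if ~~ b) && (cmod z < r ?<= if b)] = pi * (r ^+ 2 - s ^+ 2).
Proof.
move=> /andP[s0 sr]; have r0 := le_trans s0 sr.
set A := [set _ | _].
have AE : A = [set z : R[i] | cmod z < r ?<= if b] `\` [set z : R[i] | cmod z < s ?<= if b].
  apply/seteqP; split => z; rewrite /A/= lteifNE.
    by move=> /andP[/negP h1 h2].
  by move=> [h1 /negP h2]; rewrite h1 h2.
have mA : measurable_plane A by rewrite AE; apply: measurable_planeD; exact: measurable_plane_disc.
have bA : bndC A by apply: sub_bndC (bndC_disc b r); rewrite AE => z [].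
have : area (A `|` [set z : R[i] | cmod z < s ?<= if b]) = pi * r ^+ 2.
  rewrite -(area_disc b r0); congr area; rewrite AE setUC setDUK//.
  by move=> z /=; case: b {A AE mA bA} => /= h; lra.
rewrite areaU//; [|exact: measurable_plane_disc|exact: bndC_disc|]; last first.
  by rewrite AE; apply/seteqP; split => // z [[_ h1] h2].
rewrite area_disc// mulrBr; lra.
Qed.

(** A rotation makes the strip horizontal, and it then lies in a rectangle with sides 2r and 2h.
    When sin t = 0 it is horizontal already, and the rotation lemma does not apply. Such strips
    surround the straight sides of sectors. *)
Lemma area_strip_le (t r h : R) : 0 <= r -> 0 <= h ->
  area [set z : R[i] | cmod z <= r /\ `|Im (z * cis t)| <= h] <= 4 * r * h.
Proof.
move=> r0 h0.
pose B := [set z : R[i] | cmod z <= r /\ `|Im z| <= h].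
have mB : measurable_plane B.
  apply: measurable_planeI; first exact: (measurable_plane_disc true r).
  have := @measurable_plane_ImM 1 `[-h, h]%classic (measurable_itv _).
  by congr measurable_plane; apply/seteqP; split => z/=; rewrite in_itv/= mulr1 -ler_norml.
have aB : area B <= 4 * r * h.
  rewrite -lee_fin -leb2_area//; last by exists r => z [].
  have -> : 4 * r * h = (r - - r) * (h - - h) by ring.
  rewrite -leb2_rect; [|lra|lra].
  apply: le_measure; rewrite ?inE//; first exact: measurableX.
  move=> [x y] [/= h1 h2]; split => /=; rewrite in_itv/= -ler_norml//.
  exact: le_trans (ler_norm_Re (x +i* y)) h1.
apply: le_trans aB.
have [t0|t0] := eqVneq (sin t) 0.
  have E z : `|Im (z * cis t)| = `|Im z|.
    by case: z => x y /=; rewrite t0 mulr0 add0r normrM (sin0cos1 t0) mulr1.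
  by under eq_set do rewrite E.
rewrite -(area_rotate t0 mB) le_eqVlt; apply/orP; left; apply/eqP; congr area.
by apply/seteqP; split => z; rewrite /B/= cmodM cmod_cis mulr1.
Qed.

Lemma Im_rot z (t : R) : Im (z * cis (- t)) = cmod z * sin (arg z - t).
Proof. by rewrite {1}(cmod_cis_arg z) -mulrA -cisD /= mul0r addr0. Qed.

(** Two half-planes instead of an interval of arguments: measurability and the distance to the sides
    become statements about linear forms, and the strict inequality excludes the origin. For Q >= 3
    the opening is less than pi, and this is the angular sector between the two rays. *)
Definition sector (Q q : nat) : set R[i] :=
  [set z | 0 <= Im (z * cis (- (2 * pi * q%:R / Q%:R))) /\
           Im (z * cis (- (2 * pi * q.+1%:R / Q%:R))) < 0].

Lemma sectorP (Q q : nat) z : (3 <= Q)%N -> (q < Q)%N -> z != 0 ->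
  sector Q q z <-> 2 * pi * q%:R / Q%:R <= arg z < 2 * pi * q.+1%:R / Q%:R.
Proof.
move=> Q3 qQ z0; have zp : 0 < cmod z by rewrite cmod_gt0.
rewrite /sector/= !Im_rot pmulr_rge0// pmulr_rlt0//.
have Q0 : 0 < Q%:R :> R by rewrite ltr0n; lia.
have p0 := @pi_gt0 R.
have : 2 * pi * q.+1%:R / Q%:R = 2 * pi * q%:R / Q%:R + 2 * pi / Q%:R :> R.
  by rewrite -natr1; field; rewrite gt_eqF.
set t1 := 2 * pi * q%:R / Q%:R; set t2 := 2 * pi * q.+1%:R / Q%:R; set b := 2 * pi / Q%:R => t12.
have b0 : 0 < b by rewrite divr_gt0// mulr_gt0.
have bpi : b < pi.
  rewrite /b ltr_pdivrMr// mulrC ltr_pM2l//.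
  by rewrite (ltr_nat _ 2); lia.
have t10 : 0 <= t1 by rewrite divr_ge0 ?mulr_ge0// ltW.
have t22 : t2 <= 2 * pi.
  rewrite /t2 ler_pdivrMr// ler_pM2l ?mulr_gt0//.
  by rewrite ler_nat; lia.
have /andP[a0 a2] := arg_itv z0.
have sinD (x : R) : sin (x + 2 * pi) = sin x by rewrite mulr_natl sinD2pi.
split.
  move=> [s1 s2]; have [h1|h1] := leP t1 (arg z).
    rewrite /= ltNge; apply/negP => h2.
    have [h3|h3] := leP (arg z - t2) pi.
      have : 0 <= sin (arg z - t2) by apply: sin_ge0_pi; apply/andP; split; lra.
      lra.
    have : 0 < sin (2 * pi - (arg z - t1)) by apply: sin_gt0_pi; apply/andP; split; lra.
    rewrite addrC sinD sinN; lra.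
  exfalso.
  have [h3|h3] := ltP (- pi) (arg z - t1).
    have : 0 < sin (- (arg z - t1)) by apply: sin_gt0_pi; apply/andP; split; lra.
    rewrite sinN; lra.
  have : 0 <= sin (arg z - t2 + 2 * pi) by apply: sin_ge0_pi; apply/andP; split; lra.
  rewrite sinD; lra.
move=> /andP[h1 h2]; split; first by apply: sin_ge0_pi; apply/andP; split; lra.
have : 0 < sin (- (arg z - t2)) by apply: sin_gt0_pi; apply/andP; split; lra.
rewrite sinN; lra.
Qed.

Lemma sector_neq0 (Q q : nat) z : sector Q q z -> z != 0.
Proof. by move=> [_ h]; apply/eqP => z0; move: h; rewrite z0 mul0r ltxx. Qed.

Lemma sector_exists (Q : nat) z : (3 <= Q)%N -> z != 0 ->
  exists2 q, (q < Q)%N & sector Q q z.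
Proof.
move=> Q3 z0; have Q0 : 0 < Q%:R :> R by rewrite ltr0n; lia.
have p0 := @pi_gt0 R; have /andP[a0 a2] := arg_itv z0.
pose x := arg z * Q%:R / (2 * pi).
have x0 : 0 <= x by rewrite divr_ge0 ?mulr_ge0// ltW// ?mulr_gt0.
have xQ : x < Q%:R by rewrite /x ltr_pdivrMr ?mulr_gt0// mulrC ltr_pM2l.
exists (Num.truncn x).
  by rewrite -(ltr_nat R); apply: le_lt_trans xQ; rewrite truncn_le.
apply/sectorP => //.
  by rewrite -(ltr_nat R); apply: le_lt_trans xQ; rewrite truncn_le.
have aE : arg z = 2 * pi * x / Q%:R by rewrite /x [2 * pi * _]mulrC divfK ?mulfK// ?(gt_eqF Q0)// mulf_neq0// gt_eqF.
rewrite aE ler_pM2r ?invr_gt0// ltr_pM2r ?invr_gt0// ler_pM2l ?ltr_pM2l ?mulr_gt0//.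
by rewrite truncn_le x0 /= truncnS_gt.
Qed.

Lemma sector_uniq (Q q q' : nat) z : (3 <= Q)%N -> (q < Q)%N -> (q' < Q)%N ->
  sector Q q z -> sector Q q' z -> q = q'.
Proof.
move=> Q3 qQ qQ' h h'; have z0 := sector_neq0 h.
move: h h' => /(sectorP Q3 qQ z0) /andP[h1 h2] /(sectorP Q3 qQ' z0) /andP[h3 h4].
have Q0 : 0 < Q%:R :> R by rewrite ltr0n; lia.
have p0 := @pi_gt0 R.
have := le_lt_trans h1 h4; have := le_lt_trans h3 h2.
rewrite !ltr_pM2r ?invr_gt0// !ltr_pM2l ?mulr_gt0// !ltr_nat; lia.
Qed.

Lemma measurable_plane_sector (Q q : nat) : measurable_plane (sector Q q).
Proof.
apply: measurable_planeI.
  have := @measurable_plane_ImM (cis (- (2 * pi * q%:R / Q%:R))) `[0, +oo[%classic (measurable_itv _).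
  by congr measurable_plane; apply/seteqP; split => z/=; rewrite in_itv/= andbT.
have := @measurable_plane_ImM (cis (- (2 * pi * q.+1%:R / Q%:R))) `]-oo, 0[%classic (measurable_itv _).
by congr measurable_plane; apply/seteqP; split => z/=; rewrite in_itv/=.
Qed.

(** Rotation by 2 pi/Q carries each sector to the next, so the Q pieces have equal areas, and they
    fill the rotation invariant set. *)
Lemma area_sector (Q q : nat) (X : set R) (M : R) : (3 <= Q)%N -> (q < Q)%N ->
  measurable X -> (forall x, X x -> 0 < x <= M) ->
  area (sector Q q `&` [set z | X (cmod z)]) = area [set z : R[i] | X (cmod z)] / Q%:R.
Proof.
move=> Q3 qQ mX XM; have Q0 : 0 < Q%:R :> R by rewrite ltr0n; lia.
pose F (k : nat) := sector Q k `&` [set z | X (cmod z)].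
have mF k : measurable_plane (F k).
  by apply: measurable_planeI; [exact: measurable_plane_sector|exact: measurable_plane_cmod].
have bF k : bndC (F k) by exists M => z [_ /XM /andP[]].
have p0 := @pi_gt0 R.
have step k : area (F k.+1) = area (F k).
  have s0 : sin (2 * pi / Q%:R) != 0 :> R.
    rewrite gt_eqF//; apply: sin_gt0_pi; apply/andP; split; first by rewrite divr_gt0// mulr_gt0.
    rewrite ltr_pdivrMr// mulrC ltr_pM2l//.
    by rewrite (ltr_nat _ 2); lia.
  rewrite -(area_rotate s0 (mF k.+1)); congr area.
  have E j z : z * cis (2 * pi / Q%:R) * cis (- (2 * pi * j.+1%:R / Q%:R)) =
      z * cis (- (2 * pi * j%:R / Q%:R)).
    rewrite -mulrA -cisD; congr (_ * cis _); rewrite -natr1; field; rewrite gt_eqF//.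
  by apply/seteqP; split => z; rewrite /F /sector/= !E cmodM cmod_cis mulr1.
have all0 k : area (F k) = area (F 0%N) by elim: k => [|k IH]; [reflexivity|rewrite step].
have dF i j z : F i z -> F j z -> (i < Q)%N -> (j < Q)%N -> i = j.
  by move=> [h _] [h' _] iQ jQ; exact: sector_uniq h h'.
(* Extension by the empty set: [area_bigcup_seq] asks for disjointness over all indices, while
   sectors repeat from index Q on. *)
pose G (k : nat) := if (k < Q)%N then F k else set0.
have mG i : measurable_plane (G i).
  by rewrite /G; case: ifP => _; [exact: mF|rewrite /measurable_plane preimage_set0].
have bG i : bndC (G i) by rewrite /G; case: ifP => _; [exact: bF|exists 0].
have dG i j z : G i z -> G j z -> i = j.
  by rewrite /G; case: ifP => // iQ; case: ifP => // jQ h1 h2; exact: dF h1 h2 iQ jQ.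
have [_ _] := area_bigcup_seq (iota_uniq 0 Q) mG bG dG.
have -> : \bigcup_(i in [set` iota 0 Q]) G i = [set z : R[i] | X (cmod z)].
  apply/seteqP; split => z.
    by move=> [i _]; rewrite /G; case: ifP => // _ [].
  move=> Xz; have z0 : z != 0 by rewrite -cmod_gt0; case/andP: (XM _ Xz).
  have [k kQ kz] := sector_exists Q3 z0.
  by exists k => /=; rewrite ?mem_iota// /G kQ.
move=> ->.
rewrite (eq_big_seq (fun=> area (F q))); last first.
  by move=> i; rewrite mem_iota /G => /= ->; rewrite all0 (all0 q).
by rewrite big_const_seq count_predT size_iota iter_addr_0 -[X in X / _]mulr_natr mulfK ?gt_eqF.
Qed.

End planar_measure.

(** * Counting grid points *)

(** A sequence without repetition, on which finite sums and sizes can be taken. It is empty when the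
    intersection is infinite, so its membership lemmas ask for a bounded [S]. *)
Definition gpts (R : realType) (L S : set R[i]) : seq R[i] :=
  finmap.enum_fset (fset_set (L `&` S)).

(* Otherwise [lra] unfolds the product measure. *)
Opaque area.

Section lattice.
Variables (R : realType) (w1 w2 : R[i]).
Hypothesis hw : Rfree2 w1 w2.
Implicit Types (z w : R[i]) (A B S : set R[i]).

Let det := Re w1 * Im w2 - Im w1 * Re w2.

(** If the determinant vanished, the imaginary parts and the real parts would each provide a real
    relation between w1 and w2; by freeness all four coordinates are 0, and then (1, 1) is a
    relation too. *)
Lemma det_neq0 : det != 0.
Proof.
apply/eqP => d0.
have [h1 h2] : Im w2 = 0 /\ - Im w1 = 0.
  apply: hw; move: d0; rewrite /det; case: w1 => a b; case: w2 => c d /= d0.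
  simpc; apply/eqP; rewrite eq_complex/=; apply/andP; split; apply/eqP; last by ring.
  by rewrite -[RHS]d0; ring.
have [h3 h4] : Re w2 = 0 /\ - Re w1 = 0.
  apply: hw; move: d0; rewrite /det; case: w1 => a b; case: w2 => c d /= d0.
  simpc; apply/eqP; rewrite eq_complex/=; apply/andP; split; apply/eqP; first by ring.
  by rewrite -[RHS]oppr0 -d0; ring.
have [|] := @hw 1 1; last by move=> /eqP; rewrite oner_eq0.
move: h1 h2 h3 h4; case: w1 w2 => a b [c d] /= -> /eqP; rewrite oppr_eq0 => /eqP -> ->.
by move=> /eqP; rewrite oppr_eq0 => /eqP ->; simpc.
Qed.

(** The dual basis: the coordinates of z with respect to w1 and w2 are Im (z k1) and Im (z k2). In
    this form they are bounded by |z||k1| and |z||k2|, and they are measurable for the same reason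
    as the sides of sectors. *)
Let k1 : R[i] := (- Re w2 / det) +i* (Im w2 / det).
Let k2 : R[i] := (Re w1 / det) +i* (- Im w1 / det).

Definition co1 z := Im (z * k1).
Definition co2 z := Im (z * k2).

Lemma ImD z w : Im (z + w) = Im z + Im w.
Proof. by case: z w => ? ? []. Qed.

Lemma ImN z : Im (- z) = - Im z.
Proof. by case: z. Qed.

Lemma co1B z w : co1 (z - w) = co1 z - co1 w.
Proof. by rewrite /co1 mulrBl ImD ImN. Qed.

Lemma co2B z w : co2 (z - w) = co2 z - co2 w.
Proof. by rewrite /co2 mulrBl ImD ImN. Qed.

Lemma co1_comb (s t : R) : co1 (s%:C * w1 + t%:C * w2) = s.
Proof.
rewrite /co1 /k1; have := det_neq0; rewrite /det.
by case: w1 w2 => a b [c d] /= h; field.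
Qed.

Lemma co2_comb (s t : R) : co2 (s%:C * w1 + t%:C * w2) = t.
Proof.
rewrite /co2 /k2; have := det_neq0; rewrite /det.
by case: w1 w2 => a b [c d] /= h; field.
Qed.

Lemma coE z : z = (co1 z)%:C * w1 + (co2 z)%:C * w2.
Proof.
rewrite /co1 /co2 /k1 /k2; have := det_neq0; rewrite /det.
case: w1 w2 z => a b [c d] [x y] /= h; simpc => /=.
by congr (_ +i* _); field.
Qed.

Lemma latticeP z : lattice w1 w2 z <->
  exists i j : int, co1 z = i%:~R /\ co2 z = j%:~R.
Proof.
have E (i j : int) : i%:~R * w1 + j%:~R * w2 = (i%:~R : R)%:C * w1 + (j%:~R : R)%:C * w2.
  by rewrite !rmorph_int.
split => [[i [j ->]]|[i [j [h1 h2]]]]; exists i, j.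
  by rewrite E co1_comb co2_comb.
by rewrite E -h1 -h2 -coE.
Qed.

Lemma gridP z0 z : grid z0 w1 w2 z <-> lattice w1 w2 (z - z0).
Proof.
split => [[p Lp <-]|Lz]; first by rewrite addrC addKr.
by exists (z - z0) => //; rewrite addrC subrK.
Qed.

Lemma latticeB z w : lattice w1 w2 z -> lattice w1 w2 w -> lattice w1 w2 (z - w).
Proof.
move=> /latticeP[i [j [h1 h2]]] /latticeP[i' [j' [h1' h2']]]; apply/latticeP.
by exists (i - i'), (j - j'); rewrite co1B co2B h1 h2 h1' h2' !rmorphB.
Qed.

Lemma gridB z0 z w : grid z0 w1 w2 z -> grid z0 w1 w2 w -> lattice w1 w2 (z - w).
Proof.
move=> /gridP h1 /gridP h2; have := latticeB h1 h2.
by congr lattice; ring.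
Qed.

Lemma gridBl z0 z p : grid z0 w1 w2 z -> lattice w1 w2 p -> grid z0 w1 w2 (z - p).
Proof.
move=> /gridP h1 h2; apply/gridP; have := latticeB h1 h2.
by congr lattice; ring.
Qed.

Lemma lattice_grid : lattice w1 w2 = grid 0 w1 w2.
Proof. by apply/seteqP; split => z; rewrite gridP subr0. Qed.

Definition tdiam : R := cmod w1 + cmod w2.

Lemma w1_neq0 : w1 != 0.
Proof. by apply: contraNneq det_neq0 => h; rewrite /det h !mul0r subrr. Qed.

Lemma tdiam_gt0 : 0 < tdiam.
Proof. by rewrite ltr_pwDl ?cmod_ge0// cmod_gt0 w1_neq0. Qed.

Lemma parallelogramP z :
  parallelogram w1 w2 z <-> (0 <= co1 z < 1) /\ (0 <= co2 z < 1).
Proof.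
split => [[s [t [h1 h2 ->]]]|[h1 h2]]; first by rewrite co1_comb co2_comb.
by exists (co1 z), (co2 z); split => //; exact: coE.
Qed.

Lemma parallelogram_cmod z : parallelogram w1 w2 z -> cmod z <= tdiam.
Proof.
move=> [s [t [/andP[s0 s1] /andP[t0 t1] ->]]].
apply: le_trans (ler_cmodD _ _) _; rewrite !cmodMC//.
by apply: lerD; rewrite ler_piMl ?cmod_ge0// ltW.
Qed.

Lemma measurable_plane_parallelogram : measurable_plane (parallelogram w1 w2).
Proof.
have -> : parallelogram w1 w2 =
    [set z | `[0, 1[%classic (co1 z)] `&` [set z | `[0, 1[%classic (co2 z)].
  by apply/seteqP; split => z; rewrite /= !in_itv/= parallelogramP.
by apply: measurable_planeI; apply: measurable_plane_ImM.
Qed.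

Definition tile (n : R[i]) : set R[i] := (fun z => z - n) @^-1` parallelogram w1 w2.

Lemma tile_exists z0 z : exists2 n, grid z0 w1 w2 n & tile n z.
Proof.
pose i := Num.floor (co1 (z - z0)); pose j := Num.floor (co2 (z - z0)).
pose p := (i%:~R : R)%:C * w1 + (j%:~R : R)%:C * w2.
exists (z0 + p).
  exists p => //; apply/latticeP; exists i, j; by rewrite /p co1_comb co2_comb.
apply/parallelogramP; rewrite opprD addrA co1B co2B /p co1_comb co2_comb.
rewrite !subr_ge0 !floor_le !ltrBlDl.
have f1 (x : R) : x < (Num.floor x)%:~R + 1 by have := floorD1_gt x; rewrite intrD.
by rewrite !f1.
Qed.

Lemma int_small (i : int) : -1 < i%:~R :> R -> i%:~R < 1 :> R -> i = 0.
Proof.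
rewrite -[-1]/((-1)%:~R) -[1]/(1%:~R) !ltr_int => h1 h2; lia.
Qed.

Lemma tile_uniq z0 n m z : grid z0 w1 w2 n -> grid z0 w1 w2 m ->
  tile n z -> tile m z -> n = m.
Proof.
move=> Ln Lm /parallelogramP[/andP[a1 a2] /andP[b1 b2]] /parallelogramP[/andP[c1 c2] /andP[d1 d2]].
have /latticeP[i [j [h1 h2]]] := gridB Ln Lm.
rewrite !co1B in a1 a2 c1 c2 h1; rewrite !co2B in b1 b2 d1 d2 h2.
have i0 : i = 0 by apply: int_small; rewrite -h1; lra.
have j0 : j = 0 by apply: int_small; rewrite -h2; lra.
apply/subr0_eq; rewrite (coE (n - m)) co1B co2B h1 h2 i0 j0.
by rewrite !mul0r addr0.
Qed.

(** A nonzero lattice vector has an integer coordinate of absolute value at least 1, while both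
    coordinates are at most K|p|. *)
Lemma lattice_min : exists2 d0 : R, 0 < d0 &
  forall p, lattice w1 w2 p -> p != 0 -> d0 <= cmod p.
Proof.
pose K := 1 + cmod k1 + cmod k2.
have K0 : 0 < K by rewrite /K; have := cmod_ge0 k1; have := cmod_ge0 k2; lra.
exists K^-1; first by rewrite invr_gt0.
move=> p /latticeP[i [j [h1 h2]]] p0.
rewrite -[K^-1]mul1r ler_pdivrMr//.
have c1 : `|co1 p| <= cmod p * cmod k1 by rewrite -cmodM ler_norm_Im.
have c2 : `|co2 p| <= cmod p * cmod k2 by rewrite -cmodM ler_norm_Im.
have p1 := cmod_ge0 p; have q1 := cmod_ge0 k1; have q2 := cmod_ge0 k2.
have int1 (k : int) : k != 0 -> 1 <= `|k%:~R| :> R.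
  by move=> k0; rewrite -intr_norm -[1]/(1%:~R) ler_int; lia.
have [i0|/int1] := eqVneq i 0; last by rewrite -h1 /K; nra.
have [j0|/int1] := eqVneq j 0; last by rewrite -h2 /K; nra.
by move: p0; rewrite (coE p) h1 h2 i0 j0 !mul0r addr0 eqxx.
Qed.

Lemma finite_grid z0 S : bndC S -> finite_set (grid z0 w1 w2 `&` S).
Proof.
move=> [r Sr].
pose K := (cmod k1 + cmod k2) * (Num.max 0 r + cmod z0).
pose M := Num.bound K.
pose h (x : nat * nat) : R[i] := z0 + ((x.1%:R - M%:R : R)%:C * w1 + (x.2%:R - M%:R : R)%:C * w2).
apply: (@sub_finite_set _ _ (h @` (`I_(M + M).+1 `*` `I_(M + M).+1))); last first.
  by apply: finite_image; apply: finite_setX; exact: finite_II.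
move=> z [/gridP /latticeP[i [j [h1 h2]]] /Sr zr].
have zz : cmod (z - z0) <= Num.max 0 r + cmod z0.
  by apply: le_trans (ler_cmodB _ _) _; rewrite lerD2r le_max zr orbT.
have q1 := cmod_ge0 k1; have q2 := cmod_ge0 k2; have p1 := cmod_ge0 (z - z0).
have KM : K < M%:R.
  by have := archi_boundP; rewrite /M /Num.bound; move=> /(_ _ K); apply; rewrite /K; nra.
have c1 : `|co1 (z - z0)| <= K.
  by apply: le_trans (ler_norm_Im _) _; rewrite cmodM /K; nra.
have c2 : `|co2 (z - z0)| <= K.
  by apply: le_trans (ler_norm_Im _) _; rewrite cmodM /K; nra.
have int_nat (k : int) : `|k%:~R| <= K -> exists2 m : nat, (m < (M + M).+1)%N & k%:~R = m%:R - M%:R :> R.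
  move=> kK; have := le_lt_trans kK KM; rewrite -intr_norm -[M%:R]/(M%:Z%:~R) ltr_int => kM.
  exists (absz (k + M%:Z)); first by lia.
  have -> : (absz (k + M%:Z))%:R = (k + M%:Z)%:~R :> R.
    by rewrite -[LHS]/((absz (k + M%:Z) : int)%:~R); congr (_%:~R); lia.
  by rewrite rmorphD/= addrK.
rewrite h1 in c1; rewrite h2 in c2.
have [m1 m1M e1] := int_nat _ c1; have [m2 m2M e2] := int_nat _ c2.
exists (m1, m2) => //; rewrite /h/= -e1 -e2 -h1 -h2 -coE.
by rewrite addrC subrK.
Qed.

Lemma mem_gpts z0 S z : bndC S ->
  (z \in gpts (grid z0 w1 w2) S) <-> grid z0 w1 w2 z /\ S z.
Proof.
move=> bS; rewrite /gpts in_fset_set; last exact: finite_grid.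
by rewrite inE.
Qed.

Lemma uniq_gpts (L : set R[i]) S : uniq (gpts L S).
Proof. exact: finmap.fset_uniq. Qed.

Let V := covol w1 w2.

(** The tiles attached to the grid points of [S] have total area equal to their number times the
    covolume. Their union differs from [S] only at points whose tile has its corner on the other
    side of the boundary of [S]; [Bd] is any set that catches these. *)
Lemma tiling_count z0 S Bd : bndC S -> measurable_plane S -> measurable_plane Bd -> bndC Bd ->
  (forall z y, S z -> ~ S y -> cmod (z - y) <= tdiam -> Bd z /\ Bd y) ->
  `|(size (gpts (grid z0 w1 w2) S))%:R * V - area S| <= area Bd.
Proof.
move=> bS mS mB bB HB; set s := gpts _ _.
pose G n := if `[< grid z0 w1 w2 n >] then tile n else set0.
have mt n : measurable_plane (tile n).
  exact: (@measurable_plane_translate R (- n) _ measurable_plane_parallelogram).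
have mG n : measurable_plane (G n).
  by rewrite /G; case: ifP => _; [exact: mt|rewrite /measurable_plane preimage_set0].
have bG n : bndC (G n).
  rewrite /G; case: ifP => _; last by exists 0.
  exists (tdiam + cmod n) => z /parallelogram_cmod h.
  have := ler_cmodD (z - n) n; rewrite subrK; lra.
have dG n m z : G n z -> G m z -> n = m.
  rewrite /G; case: ifPn => // /asboolP Ln; case: ifPn => // /asboolP Lm.
  by move=> h1 h2; exact: (tile_uniq Ln Lm h1 h2).
have [mU bU aU] := area_bigcup_seq (uniq_gpts (grid z0 w1 w2) S) mG bG dG.
rewrite -/s in mU bU aU; set U := \bigcup_(i in _) _ in mU bU aU.
have aG : area U = (size s)%:R * V.
  rewrite aU (eq_big_seq (fun=> V)).
    by rewrite big_const_seq count_predT iter_addr_0 mulr_natl.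
  move=> n /(mem_gpts z0 _ bS)[Ln _]; rewrite /G asboolT//.
  exact: (@area_translate R (- n) _ measurable_plane_parallelogram).
rewrite -aG ler_norml; apply/andP; split.
  have : area S <= area (U `|` Bd).
    apply: le_area => //; [exact: measurable_planeU|exact: bndCU|].
    move=> z Sz; have [n Ln nz] := tile_exists z0 z.
    have [Sn|Sn] := pselect (S n).
      left; exists n; first by apply/mem_gpts.
      by rewrite /G asboolT.
    by right; have [] := HB _ _ Sz Sn (parallelogram_cmod nz).
  by move=> h; rewrite lerNl opprB lerBlDl; apply: le_trans h _; exact: area_leU.
have : area U <= area (S `|` Bd).
  apply: le_area => //; [exact: measurable_planeU|exact: bndCU|].
  move=> z [n /= /(mem_gpts z0 _ bS)[Ln Sn]]; rewrite /G asboolT// => nz.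
  have [Sz|Sz] := pselect (S z); first by left.
  right; have [] // := HB _ _ Sn Sz; rewrite cmodB; exact: (parallelogram_cmod nz).
by move=> h; rewrite lerBlDl; apply: le_trans h _; exact: area_leU.
Qed.

Definition ring (s e : R) : set R[i] := [set z | `|cmod z - s| <= e].

Lemma measurable_plane_ring s e : measurable_plane (ring s e).
Proof.
have := @measurable_plane_cmod R `[s - e, s + e]%classic (measurable_itv _).
congr measurable_plane; apply/seteqP; split => z; rewrite /ring/= in_itv/= ler_norml.
  by move=> /andP[? ?]; apply/andP; split; lra.
by move=> /andP[? ?]; apply/andP; split; lra.
Qed.

Lemma bndC_ring s e : bndC (ring s e).
Proof. by exists (s + e) => z; rewrite /ring/= ler_norml => /andP[_ ?]; lra. Qed.

(** For s >= 2e, doubling the half-width places the closed ring inside a half-open annulus; for s <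
    2e the whole disc of radius s + e < 3e is small enough. *)
Lemma area_ring_le s e : 0 <= s -> 0 < e -> area (ring s e) <= 8 * pi * (s + e) * e.
Proof.
move=> s0 e0; have p0 := @pi_gt0 R.
have [es|es] := leP (2 * e) s.
  have h : area (ring s e) <= pi * ((s + 2 * e) ^+ 2 - (s - 2 * e) ^+ 2).
    rewrite -(@area_annulus R true); last by apply/andP; split; lra.
    apply: le_area.
    - exact: measurable_plane_ring.
    - have := @measurable_plane_cmod R `]s - 2 * e, s + 2 * e]%classic (measurable_itv _).
      by congr measurable_plane; apply/seteqP; split => z; rewrite /= in_itv.
    - by exists (s + 2 * e) => z /= /andP[].
    - by move=> z; rewrite /ring/= ler_norml => /andP[? ?]; apply/andP; split; lra.
  apply: le_trans h _; nra.
have h : area (ring s e) <= pi * (s + e) ^+ 2.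
  rewrite -(area_disc true); last by lra.
  apply: le_area.
  - exact: measurable_plane_ring.
  - exact: measurable_plane_disc.
  - exact: bndC_disc.
  - by move=> z; rewrite /ring/= ler_norml => /andP[? ?]; lra.
apply: le_trans h _; rewrite expr2 mulrA.
have : 0 <= pi * (s + e) by rewrite mulr_ge0; lra.
nra.
Qed.

Let d := tdiam.

Lemma count_disc z0 r : 0 <= r ->
  `|(size (gpts (grid z0 w1 w2) [set z | cmod z <= r]))%:R * V - pi * r ^+ 2| <=
  8 * pi * (r + d) * d.
Proof.
move=> r0; have d0 := tdiam_gt0.
rewrite -(area_disc true r0); apply: le_trans (area_ring_le r0 d0).
apply: tiling_count.
- exact: (@bndC_disc R true).
- exact: (@measurable_plane_disc R true).
- exact: measurable_plane_ring.
- exact: bndC_ring.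
move=> z y /= Sz /negP; rewrite -ltNge => Sy zy.
have := le_trans (ler_cmod_dist z y) zy; rewrite -/d /ring/= !ler_norml => /andP[h1 h2].
by split; apply/andP; split; lra.
Qed.

(** Were the covolume 0, the counting estimate would bound the area of every disc by its boundary
    term; at radius 10d this reads 100 <= 88. The area of the parallelogram itself is never
    computed. *)
Lemma covol_gt0 : 0 < V.
Proof.
rewrite lt_neqAle area_ge0 andbT; apply/eqP => V0.
have d0 := tdiam_gt0; have p0 := @pi_gt0 R; rewrite -/d in d0.
have := @count_disc 0 (10 * d); rewrite -V0 mulr0 sub0r normrN.
have h10 : 0 <= 10 * d by lra.
move=> /(_ h10); rewrite ger0_norm; last by rewrite mulr_ge0 ?sqr_ge0// ltW.
have -> : pi * (10 * d) ^+ 2 = 100 * (pi * d ^+ 2) by ring.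
have -> : 8 * pi * (10 * d + d) * d = 88 * (pi * d ^+ 2) by ring.
have : 0 < pi * d ^+ 2 by rewrite mulr_gt0// exprn_gt0.
lra.
Qed.

Lemma count_disc_le z0 r : 0 <= r ->
  (size (gpts (grid z0 w1 w2) [set z | cmod z <= r]))%:R <= 9 * pi * (r + d) ^+ 2 / V.
Proof.
move=> r0; rewrite ler_pdivlMr ?covol_gt0//.
have := count_disc z0 r0; rewrite ler_norml => /andP[_ h].
have d0 := tdiam_gt0; have p0 := @pi_gt0 R; rewrite -/d in d0.
have : pi * r ^+ 2 + 8 * pi * (r + d) * d <= 9 * pi * (r + d) ^+ 2.
  have -> : 9 * pi * (r + d) ^+ 2 = pi * (9 * (r + d) ^+ 2) by ring.
  have -> : pi * r ^+ 2 + 8 * pi * (r + d) * d = pi * (r ^+ 2 + 8 * (r + d) * d) by ring.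
  rewrite ler_pM2l//; nra.
lra.
Qed.

Lemma count_annulus z0 s r : 0 <= s <= r ->
  `|(size (gpts (grid z0 w1 w2) [set z | s < cmod z <= r]))%:R * V - pi * (r ^+ 2 - s ^+ 2)| <=
  16 * pi * (r + d) * d.
Proof.
move=> sr; have d0 := tdiam_gt0; have p0 := @pi_gt0 R; rewrite -/d in d0.
rewrite -(area_annulus true sr); case/andP: sr => s0 sr; have r0 := le_trans s0 sr.
have h : area (ring s d `|` ring r d) <= 16 * pi * (r + d) * d.
  apply: (le_trans (area_leU _ _ _ _)); try exact: measurable_plane_ring; try exact: bndC_ring.
  apply: le_trans (lerD (area_ring_le s0 d0) (area_ring_le r0 d0)) _.
  have : 0 <= pi * d by rewrite mulr_ge0// ltW.
  nra.
apply: le_trans h; apply: tiling_count.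
- by exists r => z /= /andP[].
- have := @measurable_plane_cmod R `]s, r]%classic (measurable_itv _).
  by congr measurable_plane; apply/seteqP; split => z; rewrite /= in_itv.
- by apply: measurable_planeU; exact: measurable_plane_ring.
- by apply: bndCU; exact: bndC_ring.
move=> z y /= /andP[z1 z2] /negP; rewrite negb_and -leNgt -ltNge => Sy zy.
have := le_trans (ler_cmod_dist z y) zy; rewrite -/d /ring/= !ler_norml => /andP[h1 h2].
case/orP: Sy => Sy.
  by split; left; apply/andP; split; lra.
by split; right; apply/andP; split; lra.
Qed.

Lemma count_cell z0 (Q q : nat) s r : (3 <= Q)%N -> (q < Q)%N -> 0 <= s <= r ->
  `|(size (gpts (grid z0 w1 w2) (sector Q q `&` [set z | s < cmod z <= r])))%:R * V
    - pi * (r ^+ 2 - s ^+ 2) / Q%:R| <= 24 * pi * (r + d) * d.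
Proof.
move=> Q3 qQ sr; have d0 := tdiam_gt0; have p1 := @pi_ge2 R; rewrite -/d in d0.
have mX := @measurable_itv R `]s, r].
have XE : [set z : R[i] | s < cmod z <= r] = [set z | `]s, r]%classic (cmod z)].
  by apply/seteqP; split => z; rewrite /= in_itv.
have bX (x : R) : `]s, r]%classic x -> 0 < x <= r.
  by rewrite /= in_itv/= => /andP[h1 ->]; case/andP: sr => h _; rewrite (le_lt_trans h h1).
rewrite -(area_annulus true sr) [X in area X / _](_ : _ = [set z | `]s, r]%classic (cmod z)]); last first.
  by apply/seteqP; split => z; rewrite /= in_itv.
rewrite -(area_sector Q3 qQ mX bX) XE.
case/andP: sr => s0 sr; have r0 := le_trans s0 sr.
pose T (k : nat) := [set z : R[i] | cmod z <= r + d /\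
  `|Im (z * cis (- (2 * pi * k%:R / Q%:R)))| <= d].
have mT k : measurable_plane (T k).
  apply: measurable_planeI; first exact: (measurable_plane_disc true (r + d)).
  have := @measurable_plane_ImM R (cis (- (2 * pi * k%:R / Q%:R))) `[-d, d]%classic (measurable_itv _).
  by congr measurable_plane; apply/seteqP; split => z/=; rewrite in_itv/= -ler_norml.
have bT k : bndC (T k) by exists (r + d) => z [].
have mR x := measurable_plane_ring x d.
have bR x := bndC_ring x d.
have rd : 0 <= r + d by lra.
have e7 : 8 * pi * (s + d) * d <= 8 * pi * (r + d) * d.
  by rewrite !ler_pM2r// ler_pM2l ?lerD2r// mulr_gt0//; lra.
have e8 : (r + d) * d <= pi * ((r + d) * d) by rewrite ler_peMl ?mulr_ge0//; lra.
have h : area ((ring s d `|` ring r d) `|` (T q `|` T q.+1)) <= 24 * pi * (r + d) * d.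
  apply: (le_trans (area_leU _ _ _ _)); [exact: measurable_planeU|exact: measurable_planeU|exact: bndCU|exact: bndCU|].
  have e1 := area_leU (mR s) (mR r) (bR s) (bR r).
  have e2 := area_leU (mT q) (mT q.+1) (bT q) (bT q.+1).
  have e3 := area_ring_le s0 d0; have e4 := area_ring_le r0 d0.
  have e5 : area (T q) <= 4 * (r + d) * d by exact: area_strip_le rd (ltW d0).
  have e6 : area (T q.+1) <= 4 * (r + d) * d by exact: area_strip_le rd (ltW d0).
  apply: le_trans (lerD e1 e2) _; apply: le_trans (lerD (lerD e3 e4) (lerD e5 e6)) _.
  clear -e7 e8; lra.
apply: le_trans h; apply: tiling_count.
- by exists r => z [_ /bX /andP[]].
- by apply: measurable_planeI; [exact: measurable_plane_sector|exact: measurable_plane_cmod].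
- by apply: measurable_planeU; apply: measurable_planeU.
- by apply: bndCU; apply: bndCU.
rewrite -XE => z y [[Sz1 Sz2] /andP[z1 z2]] Sy zy.
have := le_trans (ler_cmod_dist z y) zy; rewrite -/d !ler_norml => /andP[h1 h2].
have [Ay|/negP] := boolP (s < cmod y <= r); last first.
  move=> /negP; rewrite negb_and -leNgt -ltNge => /orP[] Ay.
    by clear -h1 h2 Ay z1 z2; split; left; left; rewrite /ring/= ler_norml; apply/andP; split; lra.
  by clear -h1 h2 Ay z1 z2; split; left; right; rewrite /ring/= ler_norml; apply/andP; split; lra.
have imB w : cmod w = 1 -> `|Im (z * w) - Im (y * w)| <= d.
  move=> w1'; rewrite -ImN -ImD -mulNr -mulrDl; apply: le_trans (ler_norm_Im _) _.
  by rewrite cmodM w1' mulr1.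
have [y1|y1] := leP 0 (Im (y * cis (- (2 * pi * q%:R / Q%:R)))); last first.
  have := imB _ (cmod_cis (- (2 * pi * q%:R / Q%:R))); rewrite ler_norml => /andP[g1 g2].
  case/andP: Ay => Ay1 Ay2; clear -g1 g2 Ay1 Ay2 y1 Sz1 z2 d0.
  by split; right; left; split; rewrite ?ler_norml; try (apply/andP; split); lra.
have [y2|y2] := ltP (Im (y * cis (- (2 * pi * q.+1%:R / Q%:R)))) 0.
  by exfalso; apply: Sy; split.
have := imB _ (cmod_cis (- (2 * pi * q.+1%:R / Q%:R))); rewrite ler_norml => /andP[g1 g2].
case/andP: Ay => Ay1 Ay2; clear -g1 g2 Ay1 Ay2 y2 Sz2 z2 d0.
by split; right; right; split; rewrite ?ler_norml; try (apply/andP; split); lra.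
Qed.

(** Leaving out p = 0 makes the bound homogeneous down to r = 0: below the minimal length e there is
    no point, and above it the boundary width d is at most r d/e. Hence l^2 times the number of
    differences is bounded for large l as well as for small l. *)
Lemma count_lattice_le : exists2 C : R, 0 < C & forall r, 0 < r ->
  (size (gpts (lattice w1 w2) [set p | 0 < cmod p <= r]))%:R <= C * r ^+ 2.
Proof.
have [e e0 He] := lattice_min.
have d0 := tdiam_gt0; have p0 := @pi_gt0 R; rewrite -/d in d0; have V0 := covol_gt0.
pose C := 9 * pi * (1 + d / e) ^+ 2 / V.
have de : 0 < d / e by rewrite divr_gt0.
have bS r : bndC [set p : R[i] | 0 < cmod p <= r] by exists r => z /= /andP[].
have C0 : 0 < C.
  by apply: divr_gt0 => //; apply: mulr_gt0; [apply: mulr_gt0|apply: exprn_gt0; lra].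
exists C => // r r0; rewrite lattice_grid; have [re|re] := ltP r e.
  case E : (gpts _ _) => [|p s] /=.
    by apply: mulr_ge0; [exact: ltW|exact: sqr_ge0].
  have : p \in gpts (grid 0 w1 w2) [set p | 0 < cmod p <= r] by rewrite E inE eqxx.
  move=> /(mem_gpts _ _ (bS r)) [Lp /= /andP[p1 p2]].
  have := He p; rewrite lattice_grid -cmod_gt0 => /(_ Lp p1); lra.
apply: (@le_trans _ _ (size (gpts (grid 0 w1 w2) [set z | cmod z <= r]))%:R).
  rewrite ler_nat; apply: uniq_leq_size; first exact: uniq_gpts.
  move=> z /(mem_gpts _ _ (bS r)) [Lz /= /andP[_ zr]].
  by apply/mem_gpts => //; exists r.
apply: le_trans (count_disc_le 0 (ltW r0)) _.
have -> : C * r ^+ 2 = 9 * pi * (r + r * (d / e)) ^+ 2 / V by rewrite /C; ring.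
rewrite ler_pM2r ?invr_gt0// ler_pM2l ?mulr_gt0//.
have h : d <= r * (d / e) by rewrite mulrCA ler_peMr ?(ltW d0)// ler_pdivlMr// mul1r.
by rewrite lerXn2r ?nnegrE; lra.
Qed.

End lattice.

(** * Test functions and polar Riemann sums *)

Section test_functions.
Variable R : realType.
Implicit Types (z w : R[i]) (f : R[i] -> R).

Lemma normC_cmod z : `|z| = (cmod z)%:C.
Proof. by rewrite normc_def; case: z. Qed.

Lemma nbhs_cmod (x : R[i]^o) (e : R) : 0 < e -> nbhs x [set y : R[i]^o | cmod (y - x) < e].
Proof.
move=> e0; apply/nbhs_ballP; exists e%:C => /=; first by rewrite ltcR.
by move=> y; rewrite /ball/= normC_cmod ltcR cmodB.
Qed.

Lemma continuous_cmod f : continuous (f : R[i]^o -> R) ->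
  forall z (e : R), 0 < e ->
  exists2 d : R, 0 < d & forall w, cmod (w - z) < d -> `|f w - f z| < e.
Proof.
move=> cf z e e0.
have /cvgrPdist_lt/(_ e e0) := cf z.
move=> /nbhs_ballP[d /= d0 Hd].
have dE : d = (Re d)%:C by case: d d0 {Hd} => x y; rewrite ltcE/= => /andP[/eqP -> _].
exists (Re d); first by move: d0; rewrite dE ltcR.
move=> w wz; rewrite distrC; apply: Hd.
by rewrite /ball/= normC_cmod dE ltcR cmodB.
Qed.

(** Near-covering form of compactness along n -> oo: |z| and |f z| are locally bounded, hence
    bounded by a single n on the closed support, and f vanishes off it. *)
Lemma test_function_bound f : test_function f ->
  exists A B : R, [/\ 0 < A, 0 < B, forall z, A <= cmod z -> f z = 0 & forall z, `|f z| <= B].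
Proof.
move=> [cf cK]; set K := closure _ in cK.
have KP z : f z != 0 -> K z by move=> h; exact: subset_closure.
have nc := (compact_near_coveringP K).1 cK.
have [n Kn] : exists n : nat, forall z, K z -> cmod z < n%:R /\ `|f z| < n%:R.
  have [|n _ Hn] := nc nat \oo (fun n z => cmod z < n%:R /\ `|f z| < n%:R) _; last first.
    by exists n => z Kz; apply: (Hn n) => //=.
  move=> x _; have [d d0 Hd] := continuous_cmod cf x ltr01.
  pose M := cmod x + d + `|f x| + 1.
  exists ([set y : R[i]^o | cmod (y - x) < d], [set n : nat | M < n%:R]).
    split => /=; first exact: nbhs_cmod.
    exists (Num.truncn M).+1 => //= n Mn; apply: lt_le_trans (truncnS_gt M) _.
    by rewrite ler_nat.
  move=> [y n] /= [yx Mn].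
  have h1 := ler_cmodD (y - x) x; rewrite subrK in h1.
  have h2 := ler_normD (f y - f x) (f x); rewrite subrK in h2.
  have h3 := Hd _ yx; have h4 := cmod_ge0 x; have h5 := normr_ge0 (f x).
  by rewrite /M in Mn; split; lra.
exists n.+1%:R, n.+1%:R; split; rewrite ?ltr0n//.
  move=> z nz; apply/eqP; apply: contraT => /KP /Kn [h _].
  have : n%:R < n.+1%:R :> R by rewrite ltr_nat.
  lra.
move=> z; have [->|fz] := eqVneq (f z) 0; first by rewrite normr0.
have [_ h] := Kn _ (KP _ fz).
by apply: le_trans (ltW h) _; rewrite ler_nat.
Qed.

(** Uniform continuity on the compact support. If z lies outside, either f vanishes at both points
    or the roles of z and w are exchanged. *)
Lemma test_function_unif f : test_function f -> forall e : R, 0 < e ->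
  exists2 d : R, 0 < d & forall z w, cmod (w - z) < d -> `|f w - f z| <= e.
Proof.
move=> [cf cK] e e0; set K := closure _ in cK.
have KP z : f z != 0 -> K z by move=> h; exact: subset_closure.
have nc := (compact_near_coveringP K).1 cK.
have [d d0 Hd] : exists2 d : R, 0 < d & forall z, K z -> forall w, cmod (w - z) < d -> `|f w - f z| <= e.
  have [|d /= d0 Hd] := nc R (0 : R)^'+ (fun d z => forall w, cmod (w - z) < d -> `|f w - f z| <= e) _; last first.
    exists (d / 2); first by rewrite divr_gt0.
    apply: Hd => /=; last by rewrite divr_gt0.
    by rewrite sub0r normrN gtr0_norm ?divr_gt0//; lra.
  move=> x _; have e2 : 0 < e / 2 by lra.
  have [d d0 Hd] := continuous_cmod cf x e2.
  exists ([set y : R[i]^o | cmod (y - x) < d / 2], [set t : R | t < d / 2]).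
    split => /=; first by apply: nbhs_cmod; lra.
    by apply: nbhs_right_lt; lra.
  move=> [y t] /= [yx td] w wy.
  have h1 := ler_cmodD (w - y) (y - x); rewrite addrA subrK in h1.
  have h2 : `|f w - f x| < e / 2 by apply: Hd; lra.
  have h3 : `|f y - f x| < e / 2 by apply: Hd; lra.
  have h4 := ler_distD (f x) (f w) (f y); rewrite (distrC (f x) (f y)) in h4; lra.
exists d => // z w zw.
have [fz|fz] := eqVneq (f z) 0; last exact: Hd (KP _ fz) _ zw.
have [fw|fw] := eqVneq (f w) 0; first by rewrite fz fw subrr normr0 ltW.
by rewrite distrC; apply: Hd (KP _ fw) _ _; rewrite cmodB.
Qed.

(** Rounding the imaginary part down to a multiple of 1/(m+1) gives functions depending on x alone
    in each of countably many horizontal strips. These are measurable for the product structure and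
    converge pointwise to f by continuity. *)
Lemma measurable_fun_toC f : continuous (f : R[i]^o -> R) ->
  measurable_fun setT (fun p : R * R => f (toC p)).
Proof.
move=> cf.
pose g (m : nat) (y : R) : R := (Num.floor (m.+1%:R * y))%:~R / m.+1%:R.
have gy m y : `|g m y - y| <= m.+1%:R^-1.
  have m0 : 0 < m.+1%:R :> R by rewrite ltr0n.
  have -> : g m y - y = ((Num.floor (m.+1%:R * y))%:~R - m.+1%:R * y) / m.+1%:R.
    by rewrite /g; field; rewrite gt_eqF.
  rewrite normrM normfV (gtr0_norm m0) ler_piMl ?invr_ge0 ?(ltW m0)//.
  have := floor_le (m.+1%:R * y); have := floorD1_gt (m.+1%:R * y); rewrite intrD => h1 h2.
  by rewrite ler_norml; apply/andP; split; lra.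
apply: (@measurable_fun_cvg _ _ _ setT (fun m p => f (p.1 +i* g m p.2))).
  move=> m _ X mX; rewrite setTI.
  have -> : (fun p : R * R => f (p.1 +i* g m p.2)) @^-1` X =
    \bigcup_(k in [set: int]) (((fun x : R => f (x +i* (k%:~R / m.+1%:R))) @^-1` X) `*`
       ((fun y : R => Num.floor (m.+1%:R * y)) @^-1` [set k])).
    apply/seteqP; split => [[x y] /= h|[x y] [k _ [/= h1 h2]]].
      by exists (Num.floor (m.+1%:R * y)).
    by rewrite /g h2.
  apply: countable_bigcupT_measurable => [|k]; [exact: countableP|apply: measurableX].
    apply: measurable_preimageT => //; apply: continuous_measurable_fun => x.
    apply/cvgrPdist_lt => e e0.
    have [d d0 Hd] := continuous_cmod cf (x +i* (k%:~R / m.+1%:R)) e0.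
    apply/nbhs_ballP; exists d => //= t; rewrite /ball/= => xt.
    rewrite distrC; apply: Hd.
    have -> : (t +i* (k%:~R / m.+1%:R)) - (x +i* (k%:~R / m.+1%:R)) = (t - x)%:C.
      by rewrite -[LHS]/((t - x) +i* (k%:~R / m.+1%:R - k%:~R / m.+1%:R)) subrr.
    by rewrite cmodC distrC.
  have -> : (fun y : R => Num.floor (m.+1%:R * y)) @^-1` [set k] =
     [set` `[k%:~R / m.+1%:R, (k + 1)%:~R / m.+1%:R[].
    have m0 : 0 < m.+1%:R :> R by rewrite ltr0n.
    apply/seteqP; split => y /=; rewrite in_itv/= ler_pdivrMr// ltr_pdivlMr// ![y * _]mulrC.
      by move=> <-; rewrite floor_le floorD1_gt.
    by move=> h; apply/eqP; rewrite floor_eq.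
  exact: measurable_itv.
move=> [x y] _; apply/cvgrPdist_lt => e e0.
have [d d0 Hd] := continuous_cmod cf (x +i* y) e0.
exists (Num.truncn d^-1) => //= m dm; rewrite distrC; apply: Hd.
have -> : (x +i* g m y) - (x +i* y) = 0 +i* (g m y - y).
  by rewrite -[LHS]/((x - x) +i* (g m y - y)) subrr.
rewrite cmodE expr0n add0r sqrtr_sqr; apply: le_lt_trans (gy m y) _.
have m0 : 0 < m.+1%:R :> R by rewrite ltr0n.
rewrite -[X in _ < X]invrK ltf_pV2 ?posrE ?invr_gt0//.
by apply: lt_le_trans (truncnS_gt _) _; rewrite ler_nat.
Qed.

End test_functions.

Section polar_riemann_sums.
Variable R : realType.
Implicit Types (z w : R[i]) (G : R[i] -> R).
(* [R] and [measurableTypeR R] carry convertible measurable structures with distinct displays. *)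
Local Notation plane := (measurableTypeR R * measurableTypeR R)%type.

Lemma le_Rintegral_dist (E : set plane) (g : plane -> R) (c e : R) :
  measurable E -> (leb2 E < +oo)%E -> (@leb2 R).-integrable E (EFin \o g) ->
  (forall p, E p -> `|g p - c| <= e) ->
  `|Rintegral (@leb2 R) E g - c * fine (leb2 E)| <= e * fine (leb2 E).
Proof.
move=> mE fE ig h.
have ic (r : R) : (@leb2 R).-integrable E (EFin \o (fun=> r)).
  apply: measurable_bounded_integrable => //.
  by exists `|r|; split => // M rM x _ /=; exact: ltW.
have cE (r : R) : r * fine (leb2 E) = Rintegral (@leb2 R) E (fun=> r).
  by rewrite Rintegral_cst.
rewrite !cE -RintegralB//.
have igc : (@leb2 R).-integrable E (EFin \o (fun p => g p - c)).
  by have := integrableB mE ig (ic c); apply: eq_integrable => // x _ /=; rewrite EFinB.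
apply: le_trans (le_normr_Rintegral mE igc) _.
apply: le_Rintegral => //.
by have := integrable_abse igc; apply: eq_integrable => // x _ /=.
Qed.

Lemma Rintegral_bigcup_seq (I : choiceType) (s : seq I) (F : I -> set R[i])
    (D : set plane) (g : plane -> R) :
  uniq s -> (forall i, measurable_plane (F i)) ->
  (forall i j z, F i z -> F j z -> i = j) ->
  (forall i, i \in s -> @toC R @^-1` F i `<=` D) -> measurable D ->
  (@leb2 R).-integrable D (EFin \o g) ->
  measurable_plane (\bigcup_(i in [set` s]) F i) /\
  Rintegral (@leb2 R) (@toC R @^-1` (\bigcup_(i in [set` s]) F i)) g =
  \sum_(i <- s) Rintegral (@leb2 R) (@toC R @^-1` F i) g.
Proof.
move=> us mF dF sub mD ig; elim: s us sub => [_ _|i s IH /= /andP[si us] sub].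
  rewrite big_nil set_nil bigcup_set0 preimage_set0 Rintegral_set0; split => //.
  by rewrite /measurable_plane preimage_set0.
have [|m e] := IH us; first by move=> j js; apply: sub; rewrite inE js orbT.
have E : \bigcup_(j in [set` i :: s]) F j = F i `|` \bigcup_(j in [set` s]) F j.
  apply/seteqP; split => z.
    by move=> [j /=]; rewrite inE => /predU1P[->|js] Fj; [left|right; exists j].
  by move=> [Fi|[j js Fj]]; [exists i => //=; rewrite inE eqxx|exists j => //=; rewrite inE js orbT].
rewrite E; split; first exact: measurable_planeU.
rewrite preimage_setU Rintegral_setU//.
- by rewrite big_cons e.
- exact: mF.
- apply: integrableS ig => //; first by apply: measurableU; [exact: mF|exact: m].
  move=> p [/= Fi|/= [j js Fj]]; first by apply: (sub i) => //; rewrite inE eqxx.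
  by apply: (sub j) => //; rewrite inE js orbT.
- apply/disj_set2P; apply/seteqP; split => // p [/= Fi [j js Fj]].
  by have ij := dF _ _ _ Fi Fj; move: si; rewrite ij js.
Qed.

(** With [b] true a cell contains its outer arc, which suits the condition |n| <= N; with [b] false
    it contains its inner arc, which suits densities supported on kap <= |z|. *)
Definition cell (b : bool) (Q : nat) (s : nat -> R) (j q : nat) : set R[i] :=
  sector Q q `&` [set z | (s j < cmod z ?<= if ~~ b) && (cmod z < s j.+1 ?<= if b)].

Lemma measurable_shell (b : bool) (x y : R) :
  measurable [set t : R | (x < t ?<= if ~~ b) && (t < y ?<= if b)].
Proof.
have := @measurable_itv R (Interval (BSide (~~ b) x) (BSide (~~ b) y)).
by congr measurable; apply/seteqP; split => t; rewrite /= in_itv/=; case: b.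
Qed.

Lemma measurable_cell b Q s j q : measurable_plane (cell b Q s j q).
Proof.
apply: measurable_planeI; first exact: measurable_plane_sector.
exact: (measurable_plane_cmod (measurable_shell b (s j) (s j.+1))).
Qed.

Lemma bndC_cell b Q s j q : bndC (cell b Q s j q).
Proof. by exists (s j.+1) => z [_ /andP[_ /lteifW]]. Qed.

Lemma area_cell b Q s j q : (3 <= Q)%N -> (q < Q)%N -> 0 <= s j <= s j.+1 ->
  b || (0 < s j) -> area (cell b Q s j q) = pi * (s j.+1 ^+ 2 - s j ^+ 2) / Q%:R.
Proof.
move=> Q3 qQ sj b0; rewrite -(area_annulus b sj).
have := @area_sector R Q q _ (s j.+1) Q3 qQ (measurable_shell b (s j) (s j.+1)).
apply => x /= /andP[h1 h2]; apply/andP; split; last exact: lteifW h2.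
by case: b b0 h1 {h2} => /= b0 h1; case/andP: sj => ? ?; lra.
Qed.

(** Cell by cell, the integral differs from tag times area by at most the oscillation times the
    area. The tags [c] are arbitrary and the oscillation [e] depends on the ring only, so rings
    outside the support can be given e = 0. *)
Lemma polar_riemann_sum (b : bool) (Q J : nat) (s : nat -> R) (c : nat -> nat -> R)
    (e : nat -> R) (B : R) G : (3 <= Q)%N -> {homo s : i j / (i <= j)%N >-> i <= j} -> 0 <= s 0%N ->
  b || (0 < s 0%N) ->
  measurable_fun setT (fun p : R * R => G (toC p)) -> (forall z, `|G z| <= B) ->
  (forall j q z, (j < J)%N -> (q < Q)%N -> cell b Q s j q z -> `|G z - c j q| <= e j) ->
  (forall z, z != 0 -> (forall j q, (j < J)%N -> (q < Q)%N -> ~ cell b Q s j q z) -> G z = 0) ->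
  `|integralC G - \sum_(j < J) \sum_(q < Q) c j q * (pi * (s j.+1 ^+ 2 - s j ^+ 2) / Q%:R)|
    <= \sum_(j < J) e j * (pi * (s j.+1 ^+ 2 - s j ^+ 2)).
Proof.
move=> Q3 sm s0 b0 mG GB Gc G0.
have Q0 : 0 < Q%:R :> R by rewrite ltr0n; lia.
have s_ge0 j : 0 <= s j by apply: le_trans s0 _; exact: sm.
have bj j : b || (0 < s j).
  by case: (b) b0 => //= h; apply: lt_le_trans h _; exact: sm.
pose D : set plane := @toC R @^-1` [set z | cmod z <= s J].
have mD : measurable D := @measurable_plane_disc R true (s J).
have fD : (leb2 D < +oo)%E.
  by rewrite (_ : leb2 D = (pi * s J ^+ 2)%:E) ?ltry//; exact: (@leb2_disc R true).
pose g (p : plane) := G (toC p).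
have ig : (@leb2 R).-integrable D (EFin \o g).
  apply: measurable_bounded_integrable => //.
    by apply: measurable_funTS.
  exists B; split; first exact: num_real.
  by move=> M BM p _ /=; apply: le_trans (GB _) _; exact: ltW.
pose I := [seq (j, q) | j <- iota 0 J, q <- iota 0 Q].
have uI : uniq I by apply: allpairs_uniq; [exact: iota_uniq|exact: iota_uniq|move=> [? ?] [? ?]].
have memI j q : ((j, q) \in I) = (j < J)%N && (q < Q)%N.
  apply/allpairsP/andP => [[[j' q'] /=]|[jJ qQ]].
    by rewrite !mem_iota => -[h1 h2 [-> ->]]; lia.
  by exists (j, q); rewrite /= !mem_iota.
pose F (i : nat * nat) := if i \in I then cell b Q s i.1 i.2 else set0.
have mF i : measurable_plane (F i).
  by rewrite /F; case: ifP => _; [exact: measurable_cell|rewrite /measurable_plane preimage_set0].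
have dF i j z : F i z -> F j z -> i = j.
  rewrite /F; case: i => j1 q1; case: j => j2 q2; rewrite !memI.
  case: ifP => // /andP[j1J q1Q]; case: ifP => // /andP[j2J q2Q] /= [S1 /andP[h1 h2]] [S2 /andP[h3 h4]].
  have -> := sector_uniq Q3 q1Q q2Q S1 S2.
  have aux (i j : nat) x : (i < j)%N -> (x < s i.+1 ?<= if b) -> (s j < x ?<= if ~~ b) -> False.
    move=> ij; have := sm _ _ ij; case: (b) => /=; lra.
  have [lt|lt|->//] := ltngtP j1 j2; first by case: (aux _ _ _ lt h2 h3).
  by case: (aux _ _ _ lt h4 h1).
have sub i : i \in I -> @toC R @^-1` F i `<=` D.
  case: i => j q iI p; rewrite /F iI /= => -[_ /andP[_ /lteifW h]].
  apply: le_trans h _; apply: sm; by move: iI; rewrite memI => /andP[].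
have [mU eU] := Rintegral_bigcup_seq uI mF dF sub mD ig.
set U := \bigcup_(i in _) _ in mU eU.
(* The origin belongs to no sector, so nothing is known of [G] there: it is adjoined to the domain
   and then removed as a null set. *)
have IU : integralC G = Rintegral (@leb2 R) (@toC R @^-1` U) g.
  have mO : measurable ([set (0, 0)] : set plane).
    by rewrite -setX11 || rewrite (_ : [set (0, 0)] = [set 0] `*` [set 0]);
       [apply: measurableX|apply/seteqP; split => [[x y] [-> ->]|[x y] [/= -> ->]]].
  have O0 : leb2 ([set (0, 0)] : set plane) = 0%E.
    rewrite (_ : [set (0, 0)] = `[0, 0]%classic `*` `[0, 0]%classic).
      by rewrite leb2_rect// subrr mul0r.
    apply/seteqP; split => [[x y] [-> ->]|[x y] [/=]]; first by split; rewrite /= in_itv/= lexx.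
    by rewrite !in_itv/= => h1 h2; congr pair; lra.
  have U0 p : p != (0, 0) -> ~ (@toC R @^-1` U) p -> g p = 0.
    move=> p0 pU; apply: G0.
      apply: contra p0 => /eqP; case: p {pU} => x y; rewrite /toC/= => -[-> ->] //.
    move=> j q jJ qQ hc; apply: pU; exists (j, q) => /=; first by rewrite memI jJ qQ.
    by rewrite /F memI jJ qQ.
  have UD p : (@toC R @^-1` U) p -> D p /\ p != (0, 0).
    move=> [[j q] /= iI Fp]; split; first exact: (sub _ iI).
    apply/eqP => p0; move: Fp; rewrite /F iI p0 => -[/sector_neq0].
    by rewrite eqxx.
  transitivity (Rintegral (@leb2 R) (D `|` [set (0, 0)]) g).
    rewrite [RHS]Rintegral_mkcond; apply: eq_Rintegral => p _; rewrite patchE.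
    case: ifPn => //; rewrite notin_setE => pD.
    apply: U0; first by apply/eqP => p0; apply: pD; right.
    by move=> /UD[pD' _]; apply: pD; left.
  have ig' : (@leb2 R).-integrable (D `|` [set (0, 0)]) (EFin \o g).
    apply: measurable_bounded_integrable; first exact: measurableU.
    - apply: le_lt_trans (measureU2 _ _ _) _ => //.
      by rewrite [X in (_ + X)%E]O0 adde0.
    - exact: measurable_funTS.
    - exists B; split; first exact: num_real.
      by move=> M BM p _ /=; apply: le_trans (GB _) _; exact: ltW.
  rewrite /Rintegral (negligible_integral mO _ ig' O0); last exact: measurableU.
  rewrite -/(Rintegral _ _ g) [LHS]Rintegral_mkcond [RHS]Rintegral_mkcond.
  apply: eq_Rintegral => p _; rewrite !patchE.
  case: ifPn; case: ifPn => //.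
    rewrite notin_setE inE => pU [_ p0].
    by apply: U0 => //; apply/eqP.
  rewrite inE notin_setE => /UD[pD p0] pn; exfalso; apply: pn; split; first by left.
  by move=> /eqP; apply/negP.
have sumI (h : nat -> nat -> R) : \sum_(j < J) \sum_(q < Q) h j q = \sum_(i <- I) h i.1 i.2.
  rewrite big_allpairs_dep/=; rewrite -(big_mkord xpredT (fun j => \sum_(q < Q) h j q)) /index_iota subn0.
  by apply: eq_bigr => j _; rewrite -(big_mkord xpredT (fun q => h j q)) /index_iota subn0.
rewrite IU eU (sumI (fun j q => c j q * (pi * (s j.+1 ^+ 2 - s j ^+ 2) / Q%:R))) -sumrB.
apply: le_trans (ler_norm_sum _ _ _) _.
apply: (@le_trans _ _ (\sum_(i <- I) e i.1 * (pi * (s i.1.+1 ^+ 2 - s i.1 ^+ 2) / Q%:R))).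
  rewrite big_seq [leRHS]big_seq; apply: ler_sum => -[j q] iI.
  have := iI; rewrite memI => /andP[jJ qQ].
  have sj : 0 <= s j <= s j.+1 by rewrite s_ge0 sm.
  have aE := area_cell Q3 qQ sj (bj j).
  have FE : F (j, q) = cell b Q s j q by rewrite /F iI.
  rewrite /= -aE FE.
  have := @le_Rintegral_dist (@toC R @^-1` cell b Q s j q) g (c j q) (e j).
  apply.
  - exact: measurable_cell.
  - by apply: leb2_lty; [exact: measurable_cell|exact: bndC_cell].
  - by apply: integrableS ig => //; [exact: measurable_cell|rewrite -FE; exact: sub].
  - by move=> p /= hp; exact: Gc hp.
rewrite -(sumI (fun j q => e j * (pi * (s j.+1 ^+ 2 - s j ^+ 2) / Q%:R))).
apply: ler_sum => j _; rewrite sumr_const card_ord -[leLHS]mulr_natr.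
by rewrite -!mulrA mulVf ?gt_eqF// mulr1.
Qed.

End polar_riemann_sums.

(** * Averages over rotations *)

Section rotation_averages.
Variable R : realType.
Implicit Types (z w : R[i]) (f : R[i] -> R).

Lemma cmod_cisB1 (t : R) : cmod (cis t - 1) <= `|t|.
Proof.
rewrite -ler_sqr ?nnegrE ?cmod_ge0//.
have -> : cis t - 1 = 1%:C * cis t - 1%:C * cis 0 by rewrite cis0 !mul1r.
rewrite cmod_polarB_sqr subrr expr0n add0r !mulr1 subr0.
have : sin (t / 2) ^+ 2 <= (t / 2) ^+ 2.
  rewrite -(real_normK (num_real (sin _))) -(real_normK (num_real (t / 2))).
  by rewrite lerXn2r ?nnegrE// norm_sin_le.
rewrite real_normK ?num_real// expr_div_n; lra.
Qed.

(** For |z| <= 2A this is ordinary uniform continuity; for |z| > 2A the bound d <= 1/2 keeps w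
    outside the support as well. All perturbations met later are multiplicative, so one d serves
    differences p of every size. *)
Lemma test_function_mult f (A : R) : test_function f -> 0 < A ->
  (forall z, A <= cmod z -> f z = 0) ->
  forall e : R, 0 < e -> exists2 d : R, 0 < d <= 1 / 2 &
  forall z w, cmod (w - z) <= d * cmod z -> `|f w - f z| <= e.
Proof.
move=> tf A0 fA e e0; have [d d0 Hd] := test_function_unif tf e0.
pose c := Num.min (1 / 2) (d / (4 * A)).
have c0 : 0 < c by rewrite lt_min; apply/andP; split; [lra|rewrite divr_gt0// mulr_gt0].
have c1 : c <= 1 / 2 by rewrite ge_min lexx.
have c2 : c * (4 * A) <= d.
  by rewrite -ler_pdivlMr ?mulr_gt0// ge_min lexx orbT.
exists c; first by rewrite c0.
move=> z w wz; have [zA|zA] := leP (cmod z) (2 * A).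
  apply: Hd; apply: le_lt_trans wz _.
  have : c * cmod z <= c * (2 * A) by rewrite ler_pM2l.
  nra.
have := ler_cmodD (z - w) w; rewrite subrK cmodB => h.
have : c * cmod z <= 1 / 2 * cmod z by rewrite ler_wpM2r// cmod_ge0.
move=> h2; rewrite !fA; first by rewrite subrr normr0 ltW.
  lra.
lra.
Qed.

Definition avg f (M : nat) (b : R) z : R := M%:R^-1 * \sum_(t < M) f (z * cis (t%:R * b)).

Lemma ler_norm_avg (M : nat) (h : nat -> R) (e : R) : (0 < M)%N ->
  (forall t, (t < M)%N -> `|h t| <= e) -> `|M%:R^-1 * \sum_(t < M) h t| <= e.
Proof.
move=> M0 he; have Mp : 0 < M%:R :> R by rewrite ltr0n.
rewrite normrM normfV (gtr0_norm Mp) mulrC ler_pdivrMr//.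
apply: le_trans (ler_norm_sum _ _ _) _.
apply: (@le_trans _ _ (\sum_(t < M) e)); first by apply: ler_sum => t _; exact: he.
by rewrite sumr_const card_ord mulr_natr.
Qed.

Lemma avg_const (M : nat) (c : R) : (0 < M)%N -> M%:R^-1 * (\sum_(t < M) c) = c.
Proof.
by move=> M0; rewrite sumr_const card_ord -[c *+ M]mulr_natl mulKf// pnatr_eq0 -lt0n.
Qed.

Lemma shift_sum_le (h : nat -> R) (B : R) (M r : nat) : (forall t, `|h t| <= B) ->
  `|\sum_(t < M) h (t + r)%N - \sum_(t < M) h t| <= 2 * B * r%:R.
Proof.
move=> hB; elim: r => [|r IH].
  by under eq_bigr do rewrite addn0; rewrite subrr normr0 mulr0.
have -> : \sum_(t < M) h (t + r.+1)%N = \sum_(t < M) h (t + r)%N + (h (M + r)%N - h r).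
  have := big_ord_recl M (fun t => h (t + r)%N) (op := +%R) (idx := 0).
  rewrite big_ord_recr/= add0n => /eqP; rewrite eq_sym => /eqP e1.
  under eq_bigr do rewrite addnS -addSn.
  have -> : \sum_(i < M) h (i.+1 + r)%N = \sum_(i < M) h (bump 0 i + r)%N by [].
  lra.
have h1 := ler_normD (\sum_(t < M) h (t + r)%N - \sum_(t < M) h t) (h (M + r)%N - h r).
have h2 := ler_normB (h (M + r)%N) (h r); have h3 := hB (M + r)%N; have h4 := hB r.
have -> : r.+1%:R = r%:R + 1 :> R by rewrite natr1.
rewrite mulrDr mulr1.
have -> : \sum_(t < M) h (t + r)%N + (h (M + r)%N - h r) - \sum_(t < M) h t =
  \sum_(t < M) h (t + r)%N - \sum_(t < M) h t + (h (M + r)%N - h r) by ring.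
lra.
Qed.

(** Write t = r b + x with r an integer and 0 <= x <= b. The rotation by x costs e; the rotation by
    r b shifts the summation index, and only r <= 2 pi/b terms at either end fail to cancel. *)
Lemma avg_rot_le f (B e b : R) (M : nat) z (t : R) : (forall z, `|f z| <= B) ->
  0 < b -> (forall z x, 0 <= x <= b -> `|f (z * cis x) - f z| <= e) -> (0 < M)%N ->
  0 <= t <= 2 * pi -> `|avg f M b (z * cis t) - avg f M b z| <= e + 2 * B * (2 * pi / b) / M%:R.
Proof.
move=> fB b0 fe M0 /andP[t0 t2]; have Mp : 0 < M%:R :> R by rewrite ltr0n.
have tb : 0 <= t / b by rewrite divr_ge0// ltW.
pose r := Num.truncn (t / b).
have /andP[r1 r2] : r%:R <= t / b < r.+1%:R by rewrite truncn_le tb truncnS_gt.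
rewrite ler_pdivlMr// in r1; rewrite ltr_pdivrMr// -natr1 in r2.
have B0 : 0 <= B by exact: le_trans (normr_ge0 _) (fB 0).
pose h s := f (z * cis (s%:R * b)).
have e1 : `|avg f M b (z * cis t) - M%:R^-1 * \sum_(s < M) h (s + r)%N| <= e.
  rewrite /avg -mulrBr -sumrB; apply: (ler_norm_avg (h := fun s => f (z * cis t * cis (s%:R * b)) - h (s + r)%N)) => // s sM.
  rewrite /h natrD.
  have -> : z * cis t * cis (s%:R * b) = z * cis ((s%:R + r%:R) * b) * cis (t - r%:R * b).
    by rewrite -!mulrA -!cisD; congr (_ * cis _); ring.
  by apply: fe; apply/andP; split; lra.
have e2 : `|M%:R^-1 * \sum_(s < M) h (s + r)%N - avg f M b z| <= 2 * B * (2 * pi / b) / M%:R.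
  rewrite /avg -mulrBr normrM normfV (gtr0_norm Mp) mulrC ler_pM2r ?invr_gt0//.
  apply: le_trans (@shift_sum_le h B M r (fun s => fB _)) _.
  apply: ler_wpM2l; first by rewrite mulr_ge0.
  by rewrite ler_pdivlMr//; lra.
have := ler_distD (M%:R^-1 * \sum_(s < M) h (s + r)%N) (avg f M b (z * cis t)) (avg f M b z).
lra.
Qed.

Lemma avg_period f (Q K : nat) z : (0 < Q)%N -> (0 < K)%N ->
  avg f (K * Q) (2 * pi / Q%:R) z = avg f Q (2 * pi / Q%:R) z.
Proof.
move=> Q0 K0; have Qp : Q%:R != 0 :> R by rewrite pnatr_eq0; lia.
have Kp : K%:R != 0 :> R by rewrite pnatr_eq0; lia.
rewrite /avg; suff -> : \sum_(t < K * Q) f (z * cis (t%:R * (2 * pi / Q%:R))) =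
    K%:R * \sum_(t < Q) f (z * cis (t%:R * (2 * pi / Q%:R))) :> R.
  by rewrite natrM invfM; field; rewrite Qp Kp.
elim: K {K0 Kp} => [|K IH]; first by rewrite mul0n big_ord0 mul0r.
have -> : K.+1%:R = K%:R + 1 :> R by rewrite natr1.
rewrite mulSn big_split_ord/= [RHS]mulrDl mul1r [LHS]addrC; congr (_ + _).
rewrite -IH; apply: eq_bigr => t _; congr (f (_ * _)).
rewrite natrD mulrDl addrC -[RHS](cis_shift _ 1) mulr1; congr (cis (_ + _)).
by field.
Qed.

(** For the step 2 pi/Q the average over Q terms equals the one over K Q terms, whose end effect
    2B/K is removed by letting K tend to infinity. *)
Lemma avgQ_rot_le f (B e : R) (Q : nat) z (t : R) : (forall z, `|f z| <= B) ->
  (0 < Q)%N -> (forall z x, 0 <= x <= 2 * pi / Q%:R -> `|f (z * cis x) - f z| <= e) ->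
  0 <= t <= 2 * pi ->
  `|avg f Q (2 * pi / Q%:R) (z * cis t) - avg f Q (2 * pi / Q%:R) z| <= e.
Proof.
move=> fB Q0 fe t2; apply/ler_addgt0Pr => x x0.
have B0 : 0 <= B by exact: le_trans (normr_ge0 _) (fB 0).
have Qp : 0 < Q%:R :> R by rewrite ltr0n.
have p0 := @pi_gt0 R.
have [K K0 Kx] : exists2 K : nat, (0 < K)%N & 2 * B / x < K%:R.
  by exists (Num.truncn (2 * B / x)).+1 => //; exact: truncnS_gt.
have Kp : 0 < K%:R :> R by rewrite ltr0n.
have b0 : 0 < 2 * pi / Q%:R :> R by rewrite divr_gt0// mulr_gt0.
have KQ : (0 < K * Q)%N by rewrite muln_gt0 Q0 K0.
have := avg_rot_le z fB b0 fe KQ t2; rewrite !avg_period//.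
move=> h; apply: le_trans h _; rewrite lerD2l natrM.
have -> : 2 * B * (2 * pi / (2 * pi / Q%:R)) / (K%:R * Q%:R) = 2 * B / K%:R.
  have -> : 2 * pi / (2 * pi / Q%:R) = Q%:R :> R.
    by rewrite invf_div mulrCA mulfV ?mulr1// gt_eqF// mulr_gt0.
  by field; rewrite (gt_eqF Kp) (gt_eqF Qp).
by rewrite ler_pdivrMr// [x * _]mulrC -ler_pdivrMr// ltW.
Qed.

(** The mean over Q equally spaced points stands for the mean over a circle: it matches the Q
    sectors of the polar Riemann sums term by term, so no integral over a circle is ever formed. *)
Definition radial_avg f (Q : nat) (s : R) : R := avg f Q (2 * pi / Q%:R) s%:C.

(** Both averages are compared with the double average [D] over the two families of rotations.
    Averaging over M steps of b is almost insensitive to the Q equally spaced rotations, and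
    averaging over the latter is almost insensitive to every rotation, in particular to the one that
    makes z real. *)
Lemma avg_radial f (B e b : R) (Q M : nat) z : (forall z, `|f z| <= B) ->
  (0 < Q)%N -> (0 < M)%N -> 0 < b <= 2 * pi / Q%:R ->
  (forall z x, 0 <= x <= 2 * pi / Q%:R -> `|f (z * cis x) - f z| <= e) ->
  `|avg f M b z - radial_avg f Q (cmod z)| <= 2 * e + 2 * B * (2 * pi / b) / M%:R.
Proof.
move=> fB Q0 M0 /andP[b0 bQ] fe.
have Qp : 0 < Q%:R :> R by rewrite ltr0n.
have p0 := @pi_gt0 R.
pose bq : R := 2 * pi / Q%:R; pose F := avg f Q bq.
pose D := Q%:R^-1 * \sum_(q < Q) avg f M b (z * cis (q%:R * bq)).
have fe' z' x : 0 <= x <= b -> `|f (z' * cis x) - f z'| <= e.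
  by move=> /andP[x0 xb]; apply: fe; rewrite x0 (le_trans xb bQ).
have e1 : `|D - avg f M b z| <= e + 2 * B * (2 * pi / b) / M%:R.
  have -> : avg f M b z = Q%:R^-1 * \sum_(q < Q) avg f M b z.
    by rewrite avg_const.
  rewrite -mulrBr -sumrB.
  apply: (ler_norm_avg (h := fun q => avg f M b (z * cis (q%:R * bq)) - avg f M b z)) => // q qQ.
  apply: avg_rot_le => //; apply/andP; split; first by rewrite mulr_ge0// divr_ge0 ?mulr_ge0// ltW.
  rewrite /bq mulrA ler_pdivrMr// mulrC ler_pM2l ?mulr_gt0//.
  by rewrite ler_nat ltnW.
have DE : D = M%:R^-1 * \sum_(t < M) F (z * cis (t%:R * b)).
  rewrite /D /F /avg.
  under eq_bigr do rewrite mulr_sumr.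
  rewrite mulr_sumr.
  under eq_bigr do rewrite mulr_sumr.
  rewrite exchange_big/= mulr_sumr; apply: eq_bigr => t _.
  rewrite !mulr_sumr; apply: eq_bigr => q _.
  by rewrite !mulrA [Q%:R^-1 * _]mulrC; congr (_ * f (_)); rewrite -!mulrA [cis _ * cis _]mulrC.
have e2 : `|D - radial_avg f Q (cmod z)| <= e.
  rewrite DE.
  have -> : radial_avg f Q (cmod z) = M%:R^-1 * \sum_(t < M) F (cmod z)%:C.
    by rewrite avg_const.
  rewrite -mulrBr -sumrB.
  apply: (ler_norm_avg (h := fun t => F (z * cis (t%:R * b)) - F (cmod z)%:C)) => // t tM.
  set y := z * _.
  have yz : cmod y = cmod z by rewrite cmodM cmod_cis mulr1.
  rewrite -yz; have [->|y0] := eqVneq y 0.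
    by rewrite cmod0 subrr normr0; apply: le_trans (fe 0 0 _); rewrite ?normr_ge0// lexx divr_ge0// mulr_ge0// ltW.
  rewrite {1}(cmod_cis_arg y); apply: (avgQ_rot_le _ fB) => //.
  by have /andP[-> /ltW ->] := arg_itv y0.
have := ler_distD D (avg f M b z) (radial_avg f Q (cmod z)); rewrite (distrC _ D); lra.
Qed.

Lemma sum_blocks (h : nat -> R) (K Q : nat) :
  \sum_(i < K) \sum_(q < Q) h (i * Q + q)%N = \sum_(t < K * Q) h t.
Proof.
elim: K => [|K IH]; first by rewrite mul0n !big_ord0.
rewrite big_ord_recr/= IH mulSn addnC big_split_ord/=; congr (_ + _).
Qed.

(** Sector q at level i - N' occupies the position iQ + q of a single progression, since Q sectors
    make exactly one turn and the next level continues from there. The number N' only rotates the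
    starting point, which the radial average forgets; this is why the bound is uniform in the block
    of levels. *)
Lemma level_avg f (B e a : R) (Q K N' : nat) z : (forall z, `|f z| <= B) ->
  0 < a < 1 -> (0 < Q)%N -> (0 < K)%N ->
  (forall z x, 0 <= x <= 2 * pi / Q%:R -> `|f (z * cis x) - f z| <= e) ->
  `|(K%:R * Q%:R)^-1 * \sum_(i < K) \sum_(q < Q)
      f (z * cis ((a - 1) * (2 * pi * q%:R / Q%:R + 2 * pi * (i%:Z - N'%:Z)%:~R)))
    - radial_avg f Q (cmod z)| <= 2 * e + 2 * B / ((1 - a) * K%:R).
Proof.
move=> fB /andP[a0 a1] Q0 K0 fe.
have Qp : 0 < Q%:R :> R by rewrite ltr0n.
have Kp : 0 < K%:R :> R by rewrite ltr0n.
have p0 := @pi_gt0 R.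
pose b := (1 - a) * (2 * pi / Q%:R).
pose M := (K * Q)%N.
have bq : 0 < 2 * pi / Q%:R :> R by rewrite divr_gt0// mulr_gt0.
have b0 : 0 < b <= 2 * pi / Q%:R.
  by rewrite /b mulr_gt0 ?subr_gt0//= ler_piMl// ?(ltW bq)//; lra.
have M0 : (0 < M)%N by rewrite muln_gt0 K0.
(* The progression has step -b; it is read backwards from its last term, so that the step becomes
   positive. *)
pose z' := z * cis ((1 - a) * (2 * pi) * N'%:R - (M.-1)%:R * b).
have cz : cmod z' = cmod z by rewrite cmodM cmod_cis mulr1.
have -> : (K%:R * Q%:R)^-1 * (\sum_(i < K) \sum_(q < Q)
      f (z * cis ((a - 1) * (2 * pi * q%:R / Q%:R + 2 * pi * (i%:Z - N'%:Z)%:~R))))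
   = avg f M b z'.
  rewrite /avg natrM; congr (_ * _).
  rewrite (eq_bigr (fun i : 'I_K => \sum_(q < Q)
     (fun t : nat => f (z * cis ((1 - a) * (2 * pi) * N'%:R - t%:R * b))) (i * Q + q)%N)); last first.
    move=> i _; apply: eq_bigr => q _; congr (f (_ * cis _)).
    rewrite natrD natrM rmorphB/= /b; field; rewrite gt_eqF//.
  rewrite (sum_blocks (fun t => f (z * cis ((1 - a) * (2 * pi) * N'%:R - t%:R * b)))) -/M.
  rewrite (reindex_inj rev_ord_inj)/=; apply: eq_bigr => t _; congr f.
  rewrite /z' -[in RHS]mulrA -cisD; congr (_ * cis _).
  have -> : (M - t.+1)%N%:R = M.-1%:R - t%:R :> R.
    by rewrite -natrB; [congr (_%:R); have := ltn_ord t; lia|have := ltn_ord t; lia].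
  by ring.
rewrite -cz; apply: le_trans (avg_radial _ fB Q0 M0 b0 fe) _.
rewrite lerD2l /M natrM /b.
have c0 : 2 * pi != 0 :> R by rewrite gt_eqF// mulr_gt0.
have an : 1 - a != 0 by rewrite gt_eqF// subr_gt0.
rewrite le_eqVlt; apply/orP; left; apply/eqP; move: (2 * pi) c0 => c c0.
by field; rewrite an c0 (gt_eqF Kp) (gt_eqF Qp).
Qed.

Lemma powR_MVT (x y k : R) : 0 < x -> x < y ->
  exists2 c, x < c < y & y `^ k - x `^ k = k * c `^ (k - 1) * (y - x).
Proof.
move=> x0 xy.
have d (c : R) : 0 < c -> is_derive c 1 (fun t : R => t `^ k) (k * c `^ (k - 1)).
  move=> c0; have cI : c \in `]0, +oo[ by rewrite in_itv/= c0.
  have dv := @derivable_powR R 1 k c cI.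
  have := @powR_derive1 R k c cI.
  by rewrite derive1E => h; apply: DeriveDef.
have dI c : c \in `]x, y[ -> is_derive c 1 (fun t : R => t `^ k) (k * c `^ (k - 1)).
  by rewrite in_itv/= => /andP[xc _]; apply: d; exact: lt_trans xc.
have cI : {within `[x, y], continuous (fun t : R => t `^ k)}.
  apply: derivable_within_continuous => c; rewrite in_itv/= => /andP[xc _].
  by have [] := d c (lt_le_trans x0 xc).
have [c cxy ->] := MVT xy dI cI.
by exists c => //; move: cxy; rewrite in_itv.
Qed.

End rotation_averages.

(** * Sums over differences *)

Section lattice_sums.
(** [A] and [B] come from [test_function_bound], [C0] from [pow_lvl_chord] and [C2] from
    [count_lattice_le]. *)
Variables (R : realType) (a : R) (z0 w1 w2 : R[i]) (f : R[i] -> R) (A B C0 C2 : R).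
Hypotheses (ha : 0 < a < 1) (hw : Rfree2 w1 w2) (A0 : 0 < A) (B0 : 0 < B)
  (fA : forall z, A <= cmod z -> f z = 0) (fB : forall z, `|f z| <= B)
  (C01 : 1 <= C0)
  (HC0 : forall (k : int) (n m : R[i]) (M : R), n != 0 -> m != 0 ->
    cmod n <= M -> cmod m <= M ->
    cmod (n - m) <= C0 * M `^ (1 - a) * cmod (pow_lvl a k n - pow_lvl a k m))
  (C20 : 0 < C2)
  (HC2 : forall r, 0 < r ->
    (size (gpts (lattice w1 w2) [set p | 0 < cmod p <= r]))%:R <= C2 * r ^+ 2).
Implicit Types (n m p z w : R[i]) (k : int) (N Q : nat).

Definition shell_pts (r : R) := gpts (lattice w1 w2) [set p : R[i] | 0 < cmod p <= r].
Definition disc_pts N := gpts (grid z0 w1 w2) [set n : R[i] | 0 < cmod n <= N%:R].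

Lemma mem_shell_pts (r : R) p : p \in shell_pts r <-> lattice w1 w2 p /\ 0 < cmod p <= r.
Proof.
by rewrite /shell_pts lattice_grid//; apply: mem_gpts => //; exists r => z /= /andP[].
Qed.

Lemma mem_disc_pts N n : n \in disc_pts N <-> grid z0 w1 w2 n /\ 0 < cmod n <= N%:R.
Proof. by apply: mem_gpts => //; exists N%:R => z /= /andP[]. Qed.

Lemma disc_pts_neq0 N n : n \in disc_pts N -> n != 0.
Proof. by move=> /mem_disc_pts[_ /andP[+ _]]; rewrite cmod_gt0. Qed.

Lemma ler_norm_sum_size (I : eqType) (s : seq I) (P : pred I) (F : I -> R) (e : R) :
  0 <= e -> (forall i, i \in s -> P i -> `|F i| <= e) ->
  `|\sum_(i <- s | P i) F i| <= e * (size s)%:R.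
Proof.
move=> e0 h; rewrite big_seq_cond; apply: le_trans (ler_norm_sum _ _ _) _.
apply: (@le_trans _ _ (\sum_(i <- s) e)); last first.
  by rewrite big_const_seq count_predT iter_addr_0 mulr_natr.
rewrite [leRHS]big_seq; rewrite [leRHS](bigID P)/= -[leLHS]addr0; apply: lerD.
  by apply: ler_sum => i /andP[? ?]; exact: h.
exact: sumr_ge0.
Qed.

Lemma sum_disc_shift N (r : R) n (F : R[i] -> R) : n \in disc_pts N ->
  (forall m, m \in disc_pts N -> m != n -> r < cmod (n - m) -> F m = 0) ->
  \sum_(m <- disc_pts N | m != n) F m =
  \sum_(p <- shell_pts r | n - p \in disc_pts N) F (n - p).
Proof.
move=> nD F0.
rewrite -(big_map (fun p => n - p) (fun m => m \in disc_pts N) F).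
rewrite (bigID (fun m => cmod (n - m) <= r))/= [X in _ + X]big1_seq ?addr0; last first.
  by move=> m /andP[/andP[mn]]; rewrite -ltNge => h mD; exact: F0.
rewrite -[LHS]big_filter -[RHS]big_filter; apply: perm_big; apply: uniq_perm.
- by rewrite filter_uniq// uniq_gpts.
- rewrite filter_uniq// map_inj_uniq ?uniq_gpts//.
  by move=> x y /addrI /oppr_inj.
move=> m; rewrite !mem_filter; apply/andP/andP => [[/andP[mn mr] mD]|[mD]].
  split=> //; apply/mapP; exists (n - m); last by rewrite opprB addrC subrK.
  apply/mem_shell_pts; split.
    by move/mem_disc_pts: nD => [Ln _]; move/mem_disc_pts: mD => [Lm _]; exact: gridB Ln Lm.
  by rewrite mr andbT cmod_gt0 subr_eq0 eq_sym.
move=> /mapP[p /mem_shell_pts[Lp /andP[p0 pr]] mE]; split=> //.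
have -> : n - m = p by rewrite mE opprB addrC subrK.
rewrite pr andbT mE -subr_eq0 addrAC subrr sub0r oppr_eq0 -cmod_gt0//.
Qed.

(* Only differences of modulus at most [C1 / l] contribute. *)
Let C1 := C0 * A / a.
(** [B4] bounds l^2 times the number of lattice vectors in the shell of radius C1/l, and [B3] the
    corresponding normalised sums of f, both independently of l. *)
Let B4 := C2 * C1 ^+ 2.
Let B3 := B * B4.

Lemma C1_gt0 : 0 < C1.
Proof.
case/andP: ha => a0 a1; have C0p : 0 < C0 := lt_le_trans ltr01 C01.
by apply: divr_gt0 => //; exact: mulr_gt0.
Qed.

(** Beyond |p| = C1/l the linearised argument leaves the support as well: for r <= 1 its modulus l a
    r^(a-1) |p| is then at least a C1 >= A. *)
Lemma aC1_ge : A <= a * C1.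
Proof.
case/andP: ha => a0 a1; have -> : a * C1 = C0 * A by rewrite /C1; field; rewrite gt_eqF.
by rewrite ler_peMl// ltW.
Qed.

Lemma B4_gt0 : 0 < B4.
Proof. by rewrite mulr_gt0// exprn_gt0// C1_gt0. Qed.

Lemma shell_size_le (l : R) : 0 < l -> l ^+ 2 * (size (shell_pts (C1 / l)))%:R <= B4.
Proof.
move=> l0; have c0 : 0 < C1 / l by rewrite divr_gt0// C1_gt0.
have := ler_wpM2l (sqr_ge0 l) (HC2 c0).
have -> : l ^+ 2 * (C2 * (C1 / l) ^+ 2) = B4 by rewrite /B4; field; rewrite gt_eqF.
exact.
Qed.

Lemma shell_sum_le (l e : R) (P : pred R[i]) (F : R[i] -> R) : 0 < l -> 0 <= e ->
  (forall p, p \in shell_pts (C1 / l) -> P p -> `|F p| <= e) ->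
  `|l ^+ 2 * \sum_(p <- shell_pts (C1 / l) | P p) F p| <= e * B4.
Proof.
move=> l0 e0 h; rewrite normrM (ger0_norm (sqr_ge0 l)).
apply: le_trans (ler_wpM2l (sqr_ge0 l) (ler_norm_sum_size e0 h)) _.
by rewrite mulrCA ler_wpM2l// shell_size_le.
Qed.

(** The share of one point n at level k, with the factor l^2 that comes from 1/psi(N) = l^2/N^2. *)
Definition pair_sum N (l phi : R) k n : R :=
  l ^+ 2 * \sum_(m <- disc_pts N | m != n)
    f (phi%:C * (pow_lvl a k n - pow_lvl a k m)).

Definition Gam (l r u : R) : R :=
  l ^+ 2 * \sum_(p <- shell_pts (C1 / l))
    f ((l * a * r `^ (a - 1))%:C * cis ((a - 1) * u) * p).

Lemma Gam_le l r u : 0 < l -> `|Gam l r u| <= B3.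
Proof. by move=> l0; apply: shell_sum_le => //; exact: ltW. Qed.

Lemma pair_sumE N l phi k n : (0 < N)%N -> 0 < l -> phi = l * N%:R `^ (1 - a) ->
  n \in disc_pts N ->
  pair_sum N l phi k n = l ^+ 2 * \sum_(p <- shell_pts (C1 / l) | n - p \in disc_pts N)
    f (phi%:C * (pow_lvl a k n - pow_lvl a k (n - p))).
Proof.
move=> N0 l0 phiE nD; rewrite /pair_sum; congr (_ * _).
apply: (sum_disc_shift (F := fun m => f (phi%:C * (pow_lvl a k n - pow_lvl a k m)))) => // m mD mn nm.
have N1 : 0 < N%:R `^ (1 - a) :> R by rewrite powR_gt0// ltr0n.
apply: fA; rewrite cmodMC; last by rewrite phiE mulr_ge0// ltW.
have /mem_disc_pts[_ /andP[_ nN]] := nD; have /mem_disc_pts[_ /andP[_ mN]] := mD.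
have h := HC0 k (disc_pts_neq0 nD) (disc_pts_neq0 mD) nN mN.
set D := cmod (pow_lvl a k n - _) in h *.
have h2 : C1 / l < C0 * N%:R `^ (1 - a) * D by exact: lt_le_trans nm h.
case/andP: (ha) => a0 a1.
have h3 : C0 * A / a < C0 * (phi * D).
  rewrite phiE; move: h2; rewrite ltr_pdivrMr//.
  by have -> : C0 * N%:R `^ (1 - a) * D * l = C0 * (l * N%:R `^ (1 - a) * D) by ring.
have C0p : 0 < C0 := lt_le_trans ltr01 C01.
have h4 : A / a < phi * D by rewrite -(ltr_pM2l C0p) mulrA.
by apply: le_trans (ltW h4); rewrite ler_pdivlMr// ler_piMr// ltW.
Qed.

Lemma pair_sum_le N l phi k n : (0 < N)%N -> 0 < l -> phi = l * N%:R `^ (1 - a) ->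
  n \in disc_pts N -> `|pair_sum N l phi k n| <= B3.
Proof.
by move=> N0 l0 phiE nD; rewrite (pair_sumE _ N0 l0 phiE nD); apply: shell_sum_le => //; exact: ltW.
Qed.

Variables (d e : R).
Hypotheses (d0 : 0 < d) (e0 : 0 <= e)
  (UC : forall z w, cmod (w - z) <= d * cmod z -> `|f w - f z| <= e).

(** A difference y beyond pi would mean that n and m face each other across the cut. Since arg n
    keeps the distance t from it, 2 pi - |y| lies between t and pi, so |sin (y/2)| >= t/8. The law
    of cosines with |m| >= |n|/2 then makes the chord longer than assumed. *)
Lemma arg_close n m (t : R) : n != 0 -> m != 0 -> 0 < t ->
  t <= arg n <= 2 * pi - t -> cmod (n - m) <= t / 8 * cmod n ->
  cmod (n - m) <= cmod n / 20 -> `|arg n - arg m| <= pi.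
Proof.
move=> n0 m0 t0 /andP[tn nt] nm1 nm2; rewrite leNgt; apply/negP => y1.
have rp : 0 < cmod n by rewrite cmod_gt0.
have := ler_cmod_dist n m => hd.
have /andP[am0 am2] := arg_itv m0.
set y := arg n - arg m in y1.
have yt : `|y| <= 2 * pi - t by rewrite ler_norml /y; apply/andP; split; lra.
pose v := 2 * pi - `|y|.
have vpi : `|v| <= pi by rewrite ger0_norm /v; lra.
have := norm_sin_half_ge vpi; rewrite ger0_norm; last by rewrite /v; lra.
have -> : v / 2 = pi - `|y| / 2 by rewrite /v; field.
rewrite addrC sinDpi sinN opprK => h.
have sE : `|sin (`|y| / 2)| ^+ 2 = sin (y / 2) ^+ 2.
  rewrite real_normK ?num_real//; have [y0|y0] := leP 0 y; first by rewrite ger0_norm.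
  by rewrite ltr0_norm// mulNr sinN sqrrN.
have s1 : (t / 8) ^+ 2 <= sin (y / 2) ^+ 2.
  by rewrite -sE lerXn2r ?nnegrE//; rewrite /v in h; lra.
have E := cmod_polarB_sqr (cmod n) (cmod m) (arg n) (arg m).
rewrite -!cmod_cis_arg -/y in E.
have hs : cmod n / 2 <= cmod m.
  have := le_trans hd nm2; rewrite ler_norml => /andP[_ ?]; lra.
have u1 : cmod (n - m) ^+ 2 <= (t / 8 * cmod n) ^+ 2.
  by rewrite lerXn2r ?nnegrE ?cmod_ge0//; rewrite mulr_ge0 ?ltW// divr_gt0.
have u2 : 2 * cmod n ^+ 2 * (t / 8) ^+ 2 <= 4 * cmod n * cmod m * sin (y / 2) ^+ 2.
  apply: ler_pM => //; rewrite ?sqr_ge0// ?mulr_ge0 ?sqr_ge0//; nra.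
have u3 := sqr_ge0 (cmod n - cmod m).
have u4 : 0 < (t / 8 * cmod n) ^+ 2 by rewrite exprn_gt0// mulr_gt0// divr_gt0.
have u5 : 2 * cmod n ^+ 2 * (t / 8) ^+ 2 = 2 * (t / 8 * cmod n) ^+ 2 by ring.
lra.
Qed.

(** The conditions on eta serve in turn [pow_lvl_linear], [arg_close] and the passage from the
    quadratic remainder to an error of relative size d. The last hypothesis keeps every n - p inside
    the disc of radius N, so no term of the full lattice sum is missing. *)
Lemma pair_sum_good N l phi k n (t eta : R) : (0 < N)%N -> 0 < l ->
  phi = l * N%:R `^ (1 - a) -> n \in disc_pts N -> 0 < t -> t <= arg n <= 2 * pi - t ->
  0 < eta -> eta <= 1 / 20 -> eta <= t / 8 -> 1600 * eta <= d * a ->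
  C1 / l <= eta * cmod n -> cmod n + C1 / l <= N%:R ->
  `|pair_sum N l phi k n - Gam l (cmod n / N%:R) (arg n + 2 * pi * k%:~R)| <= e * B4.
Proof.
move=> N0 l0 phiE nD t0 tn eta0 eta1 eta2 eta3 h1 h2.
have n0 := disc_pts_neq0 nD; have rp : 0 < cmod n by rewrite cmod_gt0.
case/andP: (ha) => a0 a1; have Np : 0 < N%:R :> R by rewrite ltr0n.
have /mem_disc_pts[Ln /andP[_ nN]] := nD.
rewrite (pair_sumE _ N0 l0 phiE nD) /Gam.
have pD p : p \in shell_pts (C1 / l) -> n - p \in disc_pts N /\ n - p != 0.
  move=> /mem_shell_pts[Lp /andP[p0 pr]].
  have pn : cmod p <= cmod n / 20 by nra.
  have mp : 0 < cmod (n - p).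
    have := ler_cmod_dist n p; have := ler_cmodD (n - p) p; rewrite subrK; lra.
  split; last by rewrite -cmod_gt0.
  apply/mem_disc_pts; split; first exact: gridBl.
  by rewrite mp/=; apply: le_trans (ler_cmodB _ _) _; lra.
rewrite big_seq_cond (eq_bigl (fun p => p \in shell_pts (C1 / l))); last first.
  by move=> p /=; case: (boolP (p \in _)) => //= /pD[-> _].
rewrite -big_seq -mulrBr -sumrB.
apply: (shell_sum_le (P := xpredT) (F := fun p => f (phi%:C * (pow_lvl a k n - pow_lvl a k (n - p))) - f ((l * a * (cmod n / N%:R) `^ (a - 1))%:C *
     cis ((a - 1) * (arg n + 2 * pi * k%:~R)) * p))) => // p pS _.
have [pN m0] := pD _ pS; have /mem_shell_pts[Lp /andP[p0 pr]] := pS.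
have pn : cmod p <= eta * cmod n by exact: le_trans pr h1.
have nmp : n - (n - p) = p by rewrite opprB addrC subrK.
have ac : `|arg n - arg (n - p)| <= pi.
  by apply: (@arg_close _ _ t) => //; rewrite nmp; nra.
have lin := @pow_lvl_linear R a k n (n - p) ha n0 m0 ac.
rewrite nmp in lin; have {lin} lin := lin _.
have lin' := lin (ltac:(nra)).
have phi0 : 0 < phi by rewrite phiE mulr_gt0// powR_gt0.
have ra : phi * cmod n `^ (a - 1) = l * (cmod n / N%:R) `^ (a - 1).
  rewrite phiE powRM ?invr_ge0 ?(ltW rp) ?(ltW Np)//.
  rewrite -powR_inv1 ?(ltW Np)// -powRrM mulN1r opprB; ring.
have zE : (l * a * (cmod n / N%:R) `^ (a - 1))%:C * cis ((a - 1) * (arg n + 2 * pi * k%:~R)) * p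
   = phi%:C * (a%:C * (pow_lvl (a - 1) k n * p)).
  rewrite pow_lvlE// mulrAC -[l * a * _]mulrAC -ra !rmorphM/=; ring.
rewrite zE; apply: UC; rewrite -mulrBr !(cmodMC _ (ltW phi0)) (cmodMC _ (ltW a0)) cmodM.
have -> : cmod (pow_lvl (a - 1) k n) = cmod n `^ (a - 1).
  by rewrite pow_lvlE// cmodMC ?powR_ge0// cmod_cis mulr1.
have -> : d * (phi * (a * (cmod n `^ (a - 1) * cmod p))) = phi * (d * a * (cmod n `^ (a - 1) * cmod p)) by ring.
rewrite ler_pM2l//; apply: le_trans lin' _.
have -> : 1600 * cmod n `^ a * (cmod p / cmod n) ^+ 2 =
   (1600 * (cmod p / cmod n)) * (cmod n `^ (a - 1) * cmod p).
  have -> : cmod n `^ a = cmod n `^ (a - 1) * cmod n.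
    rewrite -[X in _ = _ * X]powRr1 ?ltW// -powRD ?subrK//.
    by apply/implyP => _; rewrite gt_eqF.
  by field; rewrite gt_eqF.
rewrite ler_wpM2r ?mulr_ge0 ?powR_ge0 ?cmod_ge0//.
apply: (le_trans _ eta3); apply: ler_wpM2l; first by rewrite ler0n.
by rewrite (ler_pdivrMr _ _ rp).
Qed.

(** Passing from (r', u') to (r, u) multiplies every argument of f by the same factor, of modulus
    (r'/r)^(1-a) in [1, 1 + e1] and of angle at most e2. *)
Lemma Gam_close l (r r' u u' e1 e2 : R) : 0 < l -> 0 < r -> r <= r' -> r' <= r * (1 + e1) ->
  `|u - u'| <= e2 -> e1 + e2 <= d -> `|Gam l r u - Gam l r' u'| <= e * B4.
Proof.
move=> l0 r0 rr' re uu ed; have r'0 := lt_le_trans r0 rr'; case/andP: (ha) => a0 a1.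
rewrite /Gam -mulrBr -sumrB.
apply: (shell_sum_le (P := xpredT) (F := fun p => f ((l * a * r `^ (a - 1))%:C * cis ((a - 1) * u) * p) -
   f ((l * a * r' `^ (a - 1))%:C * cis ((a - 1) * u') * p))) => // p _ _.
pose q := r' / r; pose m := q `^ (1 - a).
have q1 : 1 <= q by rewrite ler_pdivlMr// mul1r.
have qe : q <= 1 + e1 by rewrite ler_pdivrMr// mulrC.
have m1 : 1 <= m by rewrite -(powRr0 q) ler_powR//; lra.
have mq : m <= q by rewrite ler1_powR//; lra.
have rE : r `^ (a - 1) = m * r' `^ (a - 1).
  rewrite /m /q powRM ?invr_ge0 ?(ltW r0) ?(ltW r'0)//.
  rewrite -powR_inv1 ?(ltW r0)// -powRrM mulN1r opprB mulrAC -powRD; last first.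
    by apply/implyP => _; rewrite gt_eqF.
  by rewrite addrA subrK subrr powRr0 mul1r.
set z := (_ * p in X in _ - f X).
have -> : (l * a * r `^ (a - 1))%:C * cis ((a - 1) * u) * p = z * (m%:C * cis ((a - 1) * (u - u'))).
  rewrite rE /z [(a - 1) * (u - u')]mulrBr cisD !rmorphM/=.
  have cE : cis ((a - 1) * u') * cis (- ((a - 1) * u')) = 1 by rewrite mulrC cisN.
  by rewrite -[LHS]mulr1 -cE; ring.
apply: UC; rewrite -[X in _ - X]mulr1 -mulrBr cmodM mulrC ler_wpM2r ?cmod_ge0//.
set c := cis _.
have -> : m%:C * c - 1 = (m - 1)%:C * c + (c - 1) by rewrite rmorphB/=; ring.
apply: le_trans (ler_cmodD _ _) _.
rewrite cmodMC; last by lra.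
rewrite cmod_cis mulr1; have := cmod_cisB1 ((a - 1) * (u - u')) => h.
have : `|(a - 1) * (u - u')| <= `|u - u'|.
  by rewrite normrM ler_piMl// ler_norml; apply/andP; split; lra.
rewrite -/c in h; lra.
Qed.

End lattice_sums.

(** * Summation over polar cells *)

Section cell_sums.
Variables (R : realType) (a : R) (z0 w1 w2 : R[i]) (f : R[i] -> R) (A B C0 C2 : R).
Hypotheses (ha : 0 < a < 1) (hw : Rfree2 w1 w2) (A0 : 0 < A) (B0 : 0 < B)
  (fA : forall z, A <= cmod z -> f z = 0) (fB : forall z, `|f z| <= B)
  (C01 : 1 <= C0)
  (HC0 : forall (k : int) (n m : R[i]) (M : R), n != 0 -> m != 0 ->
    cmod n <= M -> cmod m <= M ->
    cmod (n - m) <= C0 * M `^ (1 - a) * cmod (pow_lvl a k n - pow_lvl a k m))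
  (C20 : 0 < C2)
  (HC2 : forall r, 0 < r ->
    (size (gpts (lattice w1 w2) [set p | 0 < cmod p <= r]))%:R <= C2 * r ^+ 2).
Implicit Types (n m p z w : R[i]) (k : int) (N Q : nat).

Let C1 := C0 * A / a.
Let B4 := C2 * C1 ^+ 2.
Let B3 := B * B4.
Let V := covol w1 w2.
Let td := tdiam w1 w2.
Local Notation shell := (shell_pts w1 w2).
Local Notation disc := (disc_pts z0 w1 w2).
Local Notation Gm := (Gam a w1 w2 f A C0).
Local Notation psum := (pair_sum a z0 w1 w2 f).

Lemma sum_ord_const (Q : nat) (c : R) : \sum_(i < Q) c = c * Q%:R.
Proof. by rewrite sumr_const card_ord mulr_natr. Qed.

Definition radii N Q (j : nat) : R := j%:R * N%:R / Q%:R.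
Definition cell_pts N Q (j q : nat) := gpts (grid z0 w1 w2) (cell true Q (radii N Q) j q).

Lemma mem_cell_pts N Q j q n : n \in cell_pts N Q j q <->
  grid z0 w1 w2 n /\ (sector Q q n /\ radii N Q j < cmod n <= radii N Q j.+1).
Proof. by apply: mem_gpts => //; exact: bndC_cell. Qed.

Lemma radii_le N Q i j : (0 < Q)%N -> (i <= j)%N -> radii N Q i <= radii N Q j.
Proof.
move=> Q0 ij; have Qp : 0 < Q%:R :> R by rewrite ltr0n.
by rewrite /radii ler_pM2r ?invr_gt0// ler_wpM2r// ler_nat.
Qed.

Lemma radiiQ N Q : (0 < Q)%N -> radii N Q Q = N%:R.
Proof. by move=> Q0; rewrite /radii mulrC mulKf// pnatr_eq0 -lt0n. Qed.

Lemma cell_pts_sub N Q j q n : (0 < Q)%N -> (j < Q)%N -> n \in cell_pts N Q j q -> n \in disc N.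
Proof.
move=> Q0 jQ /mem_cell_pts[Ln [Sn /andP[_ h]]]; apply/mem_disc_pts => //; split => //.
rewrite cmod_gt0 (sector_neq0 Sn)/=; apply: le_trans h _.
by rewrite -(radiiQ N Q0); exact: radii_le.
Qed.

Lemma disc_partition N Q (H : R[i] -> R) : (3 <= Q)%N ->
  \sum_(n <- disc N) H n =
  \sum_(j < Q) \sum_(q < Q) \sum_(n <- cell_pts N Q j q) H n.
Proof.
move=> Q3; have Q0 : (0 < Q)%N := ltn_trans (isT : (0 < 2)%N) Q3.
pose inC n (jq : 'I_Q * 'I_Q) := n \in cell_pts N Q jq.1 jq.2.
have cE (jq : 'I_Q * 'I_Q) : \sum_(n <- cell_pts N Q jq.1 jq.2) H n =
    \sum_(n <- disc N) (if inC n jq then H n else 0).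
  rewrite -big_mkcond -[RHS]big_filter; apply: perm_big; apply: uniq_perm.
  - exact: uniq_gpts.
  - by rewrite filter_uniq// uniq_gpts.
  - move=> n; rewrite mem_filter /inC; case: (boolP (n \in cell_pts _ _ _ _)) => //= h.
    by rewrite (cell_pts_sub _ _ h).
rewrite pair_big/= (eq_bigr _ (fun jq _ => cE jq)) exchange_big/=.
rewrite big_seq [RHS]big_seq; apply: eq_bigr => n nD.
have n0 := disc_pts_neq0 hw nD.
have /(mem_disc_pts z0 hw)[Ln /andP[np nN]] := nD.
have [q qQ Sq] := sector_exists Q3 n0.
have exj : exists j, cmod n <= radii N Q j.+1.
  by exists Q.-1; rewrite prednK// radiiQ.
pose j := ex_minn exj.
have [jn jmin] : cmod n <= radii N Q j.+1 /\ forall i, cmod n <= radii N Q i.+1 -> (j <= i)%N.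
  by rewrite /j; case: ex_minnP.
have jQ : (j < Q)%N.
  by have := jmin Q.-1; rewrite prednK// radiiQ// => /(_ nN); rewrite -ltnS prednK.
have jn' : radii N Q j < cmod n.
  case E : j => [|i]; first by rewrite /radii !mul0r.
  by rewrite ltNge; apply/negP => /jmin; rewrite E ltnn.
have hc : n \in cell_pts N Q j q by apply/mem_cell_pts; rewrite jn' jn.
rewrite (bigD1 (Ordinal jQ, Ordinal qQ))//= /inC/= hc big1 ?addr0// => -[j' q'] /= ne.
case: ifP => // /mem_cell_pts[_ [Sq' /andP[h1 h2]]].
exfalso; move/eqP: ne; apply; congr pair; apply: val_inj => /=; last first.
  exact: sector_uniq Q3 (ltn_ord q') qQ Sq' Sq.
have [lt|lt|//] := ltngtP j' j; exfalso.
  have := radii_le N Q0 lt; lra.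
have := radii_le N Q0 lt; lra.
Qed.

(* [N^2 * cw Q j] is the expected number of grid points in a cell of the [j]-th ring. *)
Definition cw Q (j : nat) : R := pi * (2 * j%:R + 1) / (Q%:R ^+ 3 * V).

Lemma cw_ge0 Q j : 0 <= cw Q j.
Proof.
by rewrite divr_ge0 ?mulr_ge0 ?pi_ge0 ?exprn_ge0 ?addr_ge0 ?mulr_ge0// ltW// covol_gt0.
Qed.

Lemma cw_le Q j : (j < Q)%N -> cw Q j <= 2 * pi / (Q%:R ^+ 2 * V).
Proof.
move=> jQ; have Qp : 0 < Q%:R :> R by rewrite ltr0n; exact: leq_ltn_trans (leq0n j) jQ.
have Vp : 0 < V := covol_gt0 hw; have p0 := @pi_gt0 R.
rewrite /cw ler_pdivrMr ?mulr_gt0 ?exprn_gt0//.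
have -> : 2 * pi / (Q%:R ^+ 2 * V) * (Q%:R ^+ 3 * V) = pi * (2 * Q%:R).
  by field; rewrite !gt_eqF.
rewrite ler_pM2l//; have : j%:R + 1 <= Q%:R :> R by rewrite natr1 ler_nat.
lra.
Qed.

Definition count_err N : R := 24 * pi * (N%:R + td) * td / V.

Lemma count_err_ge0 N : 0 <= count_err N.
Proof.
have td0 : 0 < td := tdiam_gt0 hw; have Vp : 0 < V := covol_gt0 hw.
apply: divr_ge0; last exact: ltW.
apply: mulr_ge0; last exact: ltW.
by apply: mulr_ge0; [rewrite mulr_ge0 ?pi_ge0|rewrite addr_ge0 ?(ltW td0)].
Qed.

Lemma cell_size N Q j q : (3 <= Q)%N -> (j < Q)%N -> (q < Q)%N ->
  `|(size (cell_pts N Q j q))%:R - cw Q j * N%:R ^+ 2| <= count_err N.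
Proof.
move=> Q3 jQ qQ; have Q0 : (0 < Q)%N := ltn_trans (isT : (0 < 2)%N) Q3.
have Qp : 0 < Q%:R :> R by rewrite ltr0n.
have td0 : 0 < td := tdiam_gt0 hw; have Vp : 0 < V := covol_gt0 hw; have p0 := @pi_gt0 R.
have rr : 0 <= radii N Q j <= radii N Q j.+1.
  by rewrite radii_le// andbT divr_ge0// mulr_ge0.
have := count_cell hw z0 Q3 qQ rr; rewrite -/V -/td => h.
rewrite -(ler_pM2r Vp) -[X in _ * X <= _](gtr0_norm Vp) -normrM mulrBl.
have -> : cw Q j * N%:R ^+ 2 * V = pi * (radii N Q j.+1 ^+ 2 - radii N Q j ^+ 2) / Q%:R.
  have j1 : j.+1%:R = j%:R + 1 :> R by rewrite natr1.
  by rewrite /cw /radii j1; field; rewrite !gt_eqF.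
apply: le_trans h _; rewrite /count_err divfK ?gt_eqF// ler_pM2r// ler_pM2l ?mulr_gt0// lerD2r.
by rewrite -(radiiQ N Q0); exact: radii_le.
Qed.

Variables (d e : R).
Hypotheses (d0 : 0 < d) (e0 : 0 <= e)
  (UC : forall z w, cmod (w - z) <= d * cmod z -> `|f w - f z| <= e).

(* The linearisation of the powers fails near 0, near the circle of radius N, and near the cut
   of the argument; there the sums are only bounded. *)
Definition bad Q (j0 j q : nat) : nat := ((j < j0) + (j == Q.-1) + (q == 0%N) + (q == Q.-1))%N.

Lemma bad_eq0 Q (j0 j q : nat) : (j < Q)%N -> (q < Q)%N -> bad Q j0 j q = 0%N ->
  [/\ (j0 <= j)%N, (j.+1 < Q)%N, (0 < q)%N & (q.+1 < Q)%N].
Proof.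
rewrite /bad; case: (ltnP j j0) => //= h1; case: eqP => //= h2; case: eqP => //= h3.
by case: eqP => //= h4 jQ qQ _; split; lia.
Qed.

Lemma bad_le4 Q (j0 j q : nat) : (bad Q j0 j q <= 4)%N.
Proof. exact: leq_add (leq_add (leq_add (leq_b1 _) (leq_b1 _)) (leq_b1 _)) (leq_b1 _). Qed.

Definition cell_tag (l : R) Q k (j q : nat) : R :=
  Gm l (j.+1%:R / Q%:R) (2 * pi * q%:R / Q%:R + 2 * pi * k%:~R).

Lemma B4p : 0 < B4.
Proof. exact: B4_gt0. Qed.

Lemma B3p : 0 < B3.
Proof. by rewrite mulr_gt0// B4p. Qed.

Lemma bad_term_ge0 Q (j0 j q : nat) : 0 <= 2 * e * B4 + 2 * B3 * (bad Q j0 j q)%:R.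
Proof.
have b4 := ltW B4p; have b3 := ltW B3p.
by apply: addr_ge0; apply: mulr_ge0 => //; exact: mulr_ge0.
Qed.

(** A good cell pays e B4 twice, for linearising at n and for moving (|n|/N, arg n) to the tag; a
    ring of index at least j0 has relative width at most 1/j0, a sector has angle 2 pi/Q. A bad cell
    pays the trivial bound 2 B3. *)
Lemma cell_point N Q (j0 : nat) (l phi eta : R) k (j q : nat) n : (3 <= Q)%N -> (0 < j0)%N ->
  (0 < N)%N -> 0 < l -> phi = l * N%:R `^ (1 - a) ->
  j0%:R^-1 + 2 * pi / Q%:R <= d -> 0 < eta -> eta <= 1 / 20 -> eta <= 2 * pi / Q%:R / 8 ->
  1600 * eta <= d * a -> C1 / l <= eta * radii N Q j0 -> C1 / l <= N%:R / Q%:R ->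
  (j < Q)%N -> (q < Q)%N -> n \in cell_pts N Q j q ->
  `|psum N l phi k n - cell_tag l Q k j q| <= 2 * e * B4 + 2 * B3 * (bad Q j0 j q)%:R.
Proof.
move=> Q3 j00 N0 l0 phiE hd eta0 eta1 eta2 eta3 h1 h2 jQ qQ nc.
have Q0 : (0 < Q)%N := ltn_trans (isT : (0 < 2)%N) Q3.
have Qp : 0 < Q%:R :> R by rewrite ltr0n.
have Np : 0 < N%:R :> R by rewrite ltr0n.
have p0 := @pi_gt0 R; have b4 := B4p; have b3 := B3p.
have nD := cell_pts_sub Q0 jQ nc.
have [b0|b0] := posnP (bad Q j0 j q); last first.
  have g1 : `|psum N l phi k n| <= B3 by exact: pair_sum_le.
  have g2 : `|cell_tag l Q k j q| <= B3 by exact: Gam_le.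
  have g3 : 1 <= (bad Q j0 j q)%:R :> R by rewrite ler1n.
  have := ler_normB (psum N l phi k n) (cell_tag l Q k j q).
  have : 0 <= e * B4 by rewrite mulr_ge0// ltW.
  nra.
rewrite b0 mulr0 addr0.
have [jj0 jQ1 q0 qQ1] := bad_eq0 jQ qQ b0.
have /mem_cell_pts[Ln [Sn /andP[n1 n2]]] := nc.
have n0 := sector_neq0 Sn.
have /andP[a1 a2] := (sectorP Q3 qQ n0).1 Sn.
have qS : q.+1%:R = q%:R + 1 :> R by rewrite natr1.
have jS : j.+1%:R = j%:R + 1 :> R by rewrite natr1.
have q1 : 1 <= q%:R :> R by rewrite ler1n.
have q2 : q%:R + 2 <= Q%:R :> R.
  by rewrite -[2]/(2%:R) -natrD ler_nat addn2.
have jl : j%:R + 2 <= Q%:R :> R.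
  by rewrite -[2]/(2%:R) -natrD ler_nat addn2.
have c0 : 0 < 2 * pi / Q%:R :> R by rewrite divr_gt0// mulr_gt0.
have t1 : 2 * pi / Q%:R <= arg n.
  by apply: le_trans a1; rewrite ler_pM2r ?invr_gt0// ler_peMr// mulr_ge0// ltW.
have t2 : arg n <= 2 * pi - 2 * pi / Q%:R.
  apply: le_trans (ltW a2) _.
  have -> : 2 * pi - 2 * pi / Q%:R = 2 * pi * (Q%:R - 1) / Q%:R :> R by field; rewrite gt_eqF.
  rewrite ler_pM2r ?invr_gt0// ler_pM2l ?mulr_gt0//; lra.
have r1 : C1 / l <= eta * cmod n.
  apply: le_trans h1 _; rewrite ler_pM2l//; apply: le_trans (ltW n1).
  exact: radii_le.
have r2 : cmod n + C1 / l <= N%:R.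
  have : radii N Q j.+1 <= N%:R - N%:R / Q%:R.
    have -> : N%:R - N%:R / Q%:R = (Q%:R - 1) * N%:R / Q%:R :> R by field; rewrite gt_eqF.
    by rewrite /radii ler_pM2r ?invr_gt0// ler_pM2r// jS; lra.
  lra.
have t12 : 2 * pi / Q%:R <= arg n <= 2 * pi - 2 * pi / Q%:R by rewrite t1 t2.
have g1 : `|psum N l phi k n - Gm l (cmod n / N%:R) (arg n + 2 * pi * k%:~R)| <= e * B4.
  exact: (pair_sum_good ha hw A0 fA C01 HC0 HC2 e0 UC k N0 l0 phiE nD c0 t12 eta0 eta1 eta2 eta3 r1 r2).
have np : 0 < cmod n by rewrite cmod_gt0.
have j0p : 0 < j0%:R :> R by rewrite ltr0n.
have jj : j0%:R <= j%:R :> R by rewrite ler_nat.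
have g2 : `|Gm l (cmod n / N%:R) (arg n + 2 * pi * k%:~R) - cell_tag l Q k j q| <= e * B4.
  apply: (Gam_close ha A0 C01 HC2 e0 UC (e1 := j0%:R^-1) (e2 := 2 * pi / Q%:R)) => //.
  - by rewrite divr_gt0.
  - rewrite ler_pdivrMr//; apply: le_trans n2 _.
    by rewrite /radii mulrAC.
  - have rn : j%:R / Q%:R <= cmod n / N%:R.
      rewrite ler_pdivlMr// mulrAC; exact: ltW n1.
    have : j%:R / Q%:R * (1 + j0%:R^-1) <= cmod n / N%:R * (1 + j0%:R^-1).
      by rewrite ler_pM2r// addr_gt0// invr_gt0.
    apply: le_trans; rewrite mulrAC ler_pM2r ?invr_gt0// jS mulrDr mulr1 lerD2l.
    by rewrite ler_pdivlMr// mul1r.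
  - have -> : arg n + 2 * pi * k%:~R - (2 * pi * q%:R / Q%:R + 2 * pi * k%:~R) = arg n - 2 * pi * q%:R / Q%:R by ring.
    have : 2 * pi * q.+1%:R / Q%:R = 2 * pi * q%:R / Q%:R + 2 * pi / Q%:R :> R.
      by rewrite qS; field; rewrite gt_eqF.
    move=> E; rewrite E in a2; rewrite ler_norml; apply/andP; split; lra.
have := ler_distD (Gm l (cmod n / N%:R) (arg n + 2 * pi * k%:~R)) (psum N l phi k n) (cell_tag l Q k j q).
lra.
Qed.

Lemma cell_estimate N Q (j0 : nat) (l phi eta : R) k (j q : nat) : (3 <= Q)%N -> (0 < j0)%N ->
  (0 < N)%N -> 0 < l -> phi = l * N%:R `^ (1 - a) ->
  j0%:R^-1 + 2 * pi / Q%:R <= d -> 0 < eta -> eta <= 1 / 20 -> eta <= 2 * pi / Q%:R / 8 ->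
  1600 * eta <= d * a -> C1 / l <= eta * radii N Q j0 -> C1 / l <= N%:R / Q%:R ->
  (j < Q)%N -> (q < Q)%N ->
  `|\sum_(n <- cell_pts N Q j q) psum N l phi k n - cw Q j * N%:R ^+ 2 * cell_tag l Q k j q|
  <= (cw Q j * N%:R ^+ 2 + count_err N) * (2 * e * B4 + 2 * B3 * (bad Q j0 j q)%:R)
     + count_err N * B3.
Proof.
move=> Q3 j00 N0 l0 phiE hd eta0 eta1 eta2 eta3 h1 h2 jQ qQ.
set E := count_err N; set ee := 2 * e * B4 + _; set T := cell_tag _ _ _ _ _; set c := cw _ _ * _.
pose s := (size (cell_pts N Q j q))%:R : R.
have ee0 : 0 <= ee := bad_term_ge0 Q j0 j q.
have sc : `|s - c| <= E by exact: cell_size.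
have g1 : `|\sum_(n <- cell_pts N Q j q) psum N l phi k n - s * T| <= ee * s.
  have -> : s * T = \sum_(n <- cell_pts N Q j q) T.
    by rewrite big_const_seq count_predT iter_addr_0 mulr_natl.
  rewrite -sumrB; apply: (ler_norm_sum_size (P := xpredT)) => // n nc _.
  exact: (cell_point k Q3 j00 N0 l0 phiE hd eta0 eta1 eta2 eta3 h1 h2 jQ qQ nc).
have g2 : `|s * T - c * T| <= E * B3.
  rewrite -mulrBl normrM ler_pM// /T; exact: (Gam_le ha A0 B0 fB C01 HC2 _ _ l0).
have s1 : s <= c + E by move: sc; rewrite ler_norml => /andP[_ ?]; lra.
have g3 : ee * s <= (c + E) * ee by rewrite mulrC ler_wpM2r.
have := ler_distD (s * T) (\sum_(n <- cell_pts N Q j q) psum N l phi k n) (c * T).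
lra.
Qed.

Lemma sum_ltn (n m : nat) : (\sum_(i < n) (i < m) = minn n m)%N.
Proof.
elim: n => [|n IH]; first by rewrite big_ord0 min0n.
by rewrite big_ord_recr/= IH; case: (ltnP n m) => h; lia.
Qed.

Lemma sum_eqn (n m : nat) : (\sum_(i < n) (i == m :> nat) <= 1)%N.
Proof.
suff -> : (\sum_(i < n) (i == m :> nat) = (m < n))%N by case: (m < n)%N.
elim: n => [|n IH]; first by rewrite big_ord0.
by rewrite big_ord_recr/= IH; case: (eqVneq n m) => h; lia.
Qed.

(** The inner j0 rings, the outermost ring and the two sectors along the cut have Q cells each: a
    proportion O(1/Q) of the Q^2 cells. *)
Lemma sum_bad Q (j0 : nat) : (\sum_(j < Q) \sum_(q < Q) bad Q j0 j q <= (j0 + 3) * Q)%N.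
Proof.
rewrite /bad; under eq_bigr do rewrite !big_split/= !sum_nat_const card_ord.
rewrite !big_split/= -!big_distrr/= !sum_nat_const card_ord sum_ltn.
have h1 := sum_eqn Q Q.-1; have h2 := sum_eqn Q 0%N.
set x := (\sum_(i < Q) _)%N in h1 *; set y := (\sum_(i < Q) _)%N in h2 *.
have : (minn Q j0 <= j0)%N by rewrite geq_minr.
nia.
Qed.

(** The three errors are the oscillation of f, the bad cells, and the miscount of grid points in
    each of the Q^2 cells. In the last one 9 B3 is 8 B3, from [bad_le4], plus B3 for replacing the
    size of the cell by its expected value. *)
Lemma level_estimate N Q (j0 : nat) (l phi eta : R) k : (3 <= Q)%N -> (0 < j0)%N ->
  (0 < N)%N -> 0 < l -> phi = l * N%:R `^ (1 - a) ->
  j0%:R^-1 + 2 * pi / Q%:R <= d -> 0 < eta -> eta <= 1 / 20 -> eta <= 2 * pi / Q%:R / 8 ->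
  1600 * eta <= d * a -> C1 / l <= eta * radii N Q j0 -> C1 / l <= N%:R / Q%:R ->
  `|N%:R ^- 2 * \sum_(n <- disc N) psum N l phi k n
    - \sum_(j < Q) \sum_(q < Q) cw Q j * cell_tag l Q k j q|
  <= 4 * pi / V * (e * B4) + 4 * pi * B3 * (j0%:R + 3) / (Q%:R * V)
     + Q%:R ^+ 2 * (2 * e * B4 + 9 * B3) * (count_err N / N%:R ^+ 2).
Proof.
move=> Q3 j00 N0 l0 phiE hd eta0 eta1 eta2 eta3 h1 h2.
have Q0 : (0 < Q)%N := ltn_trans (isT : (0 < 2)%N) Q3.
have Qp : 0 < Q%:R :> R by rewrite ltr0n.
have Np : 0 < N%:R :> R by rewrite ltr0n.
have N2 : 0 < N%:R ^+ 2 :> R by rewrite exprn_gt0.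
have p0 := @pi_gt0 R; have Vp : 0 < V := covol_gt0 hw; have b4 := B4p; have b3 := B3p.
have E0 := count_err_ge0 N.
pose E' := count_err N / N%:R ^+ 2.
have E'0 : 0 <= E' by rewrite divr_ge0// ltW.
pose ee (j q : nat) := 2 * e * B4 + 2 * B3 * (bad Q j0 j q)%:R.
rewrite (disc_partition N _ Q3) mulr_sumr -sumrB.
apply: le_trans (ler_norm_sum _ _ _) _.
have key (j q : 'I_Q) : `|N%:R ^- 2 * (\sum_(n <- cell_pts N Q j q) psum N l phi k n)
     - cw Q j * cell_tag l Q k j q| <=
   2 * pi / (Q%:R ^+ 2 * V) * ee j q + E' * (2 * e * B4 + 9 * B3).
  have := cell_estimate k Q3 j00 N0 l0 phiE hd eta0 eta1 eta2 eta3 h1 h2 (ltn_ord j) (ltn_ord q).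
  set S := \sum_(n <- _) _; set T := cell_tag _ _ _ _ _; rewrite -/(ee j q) => h.
  have -> : N%:R ^- 2 * S - cw Q j * T = (S - cw Q j * N%:R ^+ 2 * T) / N%:R ^+ 2.
    by field; rewrite gt_eqF.
  rewrite normrM normfV (gtr0_norm N2) ler_pdivrMr//; apply: le_trans h _.
  have ee0 : 0 <= ee j q := bad_term_ge0 Q j0 j q.
  have bad4 : (bad Q j0 j q)%:R <= 4 :> R.
    by rewrite -[4]/(4%:R) ler_nat (bad_le4 Q j0 j q).
  have ee1 : ee j q <= 2 * e * B4 + 8 * B3 by rewrite /ee; nra.
  have cl := cw_le (ltn_ord j).
  have q1 : cw Q j * N%:R ^+ 2 * ee j q <= 2 * pi / (Q%:R ^+ 2 * V) * ee j q * N%:R ^+ 2.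
    rewrite mulrAC ler_pM2r// ler_wpM2r//.
  have q2 : count_err N * ee j q <= count_err N * (2 * e * B4 + 8 * B3) by rewrite ler_wpM2l.
  have q3 : E' * (2 * e * B4 + 9 * B3) * N%:R ^+ 2 = count_err N * (2 * e * B4 + 8 * B3) + count_err N * B3.
    by rewrite /E'; field; rewrite gt_eqF.
  rewrite mulrDl [leRHS]mulrDl q3; lra.
apply: (@le_trans _ _ (\sum_(j < Q) \sum_(q < Q) (2 * pi / (Q%:R ^+ 2 * V) * ee j q + E' * (2 * e * B4 + 9 * B3)))).
  apply: ler_sum => j _; rewrite mulr_sumr -sumrB.
  by apply: le_trans (ler_norm_sum _ _ _) _; apply: ler_sum => q _; exact: key.
under eq_bigr do rewrite big_split/= sum_ord_const -mulr_sumr.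
rewrite big_split/= sum_ord_const -mulr_sumr /ee.
under eq_bigr do rewrite big_split/= sum_ord_const -mulr_sumr.
rewrite big_split/= sum_ord_const -mulr_sumr.
have sb : \sum_(j < Q) \sum_(q < Q) (bad Q j0 j q)%:R <= (j0%:R + 3) * Q%:R :> R.
  have -> : \sum_(j < Q) \sum_(q < Q) (bad Q j0 j q)%:R = (\sum_(j < Q) \sum_(q < Q) bad Q j0 j q)%N%:R :> R.
    by rewrite natr_sum; apply: eq_bigr => j _; rewrite natr_sum.
  have -> : (j0%:R + 3) * Q%:R = ((j0 + 3) * Q)%N%:R :> R by rewrite natrM natrD.
  by rewrite ler_nat sum_bad.
set SB := \sum_(j < Q) _ in sb *.
have u1 : 2 * pi / (Q%:R ^+ 2 * V) * (2 * e * B4 * Q%:R * Q%:R) = 4 * pi / V * (e * B4).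
  by field; rewrite !gt_eqF.
have u2 : 2 * pi / (Q%:R ^+ 2 * V) * (2 * B3 * SB) <= 4 * pi * B3 * (j0%:R + 3) / (Q%:R * V).
  have -> : 4 * pi * B3 * (j0%:R + 3) / (Q%:R * V) = 2 * pi / (Q%:R ^+ 2 * V) * (2 * B3 * ((j0%:R + 3) * Q%:R)).
    by field; rewrite !gt_eqF.
  apply: ler_wpM2l.
    by apply: divr_ge0; [exact: mulr_ge0 (ltW p0)|exact: mulr_ge0 (exprn_ge0 _ (ltW Qp)) (ltW Vp)].
  by apply: ler_wpM2l => //; exact: mulr_ge0 (ltW b3).
rewrite -/E' [_ * (_ + 2 * B3 * SB)]mulrDr.
have -> : Q%:R ^+ 2 * (2 * e * B4 + 9 * B3) * E' = E' * (2 * e * B4 + 9 * B3) * Q%:R * Q%:R by ring.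
lra.
Qed.

Definition Gbar (l : R) Q (r : R) : R :=
  l ^+ 2 * \sum_(p <- shell (C1 / l)) radial_avg f Q (l * a * r `^ (a - 1) * cmod p).

Lemma Gam_level_avg (l r : R) Q (K N' : nat) : 0 < l -> (0 < Q)%N -> (0 < K)%N ->
  2 * pi / Q%:R <= d ->
  `|(K%:R * Q%:R)^-1 * \sum_(i < K) \sum_(q < Q)
     Gm l r (2 * pi * q%:R / Q%:R + 2 * pi * (i%:Z - N'%:Z)%:~R) - Gbar l Q r|
  <= (2 * e + 2 * B / ((1 - a) * K%:R)) * B4.
Proof.
move=> l0 Q0 K0 hd; case/andP: (ha) => a0 a1.
have Kp : 0 < K%:R :> R by rewrite ltr0n.
pose z p := (l * a * r `^ (a - 1))%:C * p : R[i].
have -> : (K%:R * Q%:R)^-1 * (\sum_(i < K) \sum_(q < Q)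
     Gm l r (2 * pi * q%:R / Q%:R + 2 * pi * (i%:Z - N'%:Z)%:~R)) - Gbar l Q r
  = l ^+ 2 * \sum_(p <- shell (C1 / l)) ((K%:R * Q%:R)^-1 * (\sum_(i < K) \sum_(q < Q)
     f (z p * cis ((a - 1) * (2 * pi * q%:R / Q%:R + 2 * pi * (i%:Z - N'%:Z)%:~R))))
     - radial_avg f Q (cmod (z p))).
  rewrite sumrB mulrBr /Gbar; congr (_ - _); last first.
    congr (_ * _); apply: eq_bigr => p _; rewrite /z cmodMC//.
    by rewrite !mulr_ge0 ?powR_ge0// ltW.
  rewrite -mulr_sumr [RHS]mulrCA; congr (_ * _).
  rewrite [in RHS]exchange_big/= [RHS]mulr_sumr; apply: eq_bigr => i _.
  rewrite [in RHS]exchange_big/= [RHS]mulr_sumr; apply: eq_bigr => q _; rewrite /Gam; congr (_ * _).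
  by apply: eq_bigr => p _; rewrite /z mulrAC.
apply: (shell_sum_le ha A0 C01 HC2 (P := xpredT) (F := fun p => (K%:R * Q%:R)^-1 * (\sum_(i < K) \sum_(q < Q)
     f (z p * cis ((a - 1) * (2 * pi * q%:R / Q%:R + 2 * pi * (i%:Z - N'%:Z)%:~R))))
     - radial_avg f Q (cmod (z p)))) => //.
  have a1' : 0 <= 1 - a by rewrite subr_ge0 ltW.
  apply: addr_ge0; first exact: mulr_ge0.
  by apply: divr_ge0; apply: mulr_ge0 => //; exact: ltW.
move=> p _ _; apply: level_avg => // y x /andP[x0 xQ]; apply: UC.
rewrite -[X in _ - X]mulr1 -mulrBr cmodM mulrC ler_wpM2r ?cmod_ge0//.
by apply: le_trans (cmod_cisB1 x) _; rewrite ger0_norm//; exact: le_trans xQ hd.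
Qed.

Lemma total_estimate N Q (j0 K N' : nat) (l phi eta : R) : (3 <= Q)%N -> (0 < j0)%N -> (0 < K)%N ->
  (0 < N)%N -> 0 < l -> phi = l * N%:R `^ (1 - a) ->
  j0%:R^-1 + 2 * pi / Q%:R <= d -> 0 < eta -> eta <= 1 / 20 -> eta <= 2 * pi / Q%:R / 8 ->
  1600 * eta <= d * a -> C1 / l <= eta * radii N Q j0 -> C1 / l <= N%:R / Q%:R ->
  `|(K%:R * N%:R ^+ 2)^-1 * \sum_(i < K) \sum_(n <- disc N) psum N l phi (i%:Z - N'%:Z) n
    - \sum_(j < Q) Q%:R * cw Q j * Gbar l Q (j.+1%:R / Q%:R)|
  <= 4 * pi / V * (e * B4) + 4 * pi * B3 * (j0%:R + 3) / (Q%:R * V)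
     + Q%:R ^+ 2 * (2 * e * B4 + 9 * B3) * (count_err N / N%:R ^+ 2)
     + 2 * pi / V * ((2 * e + 2 * B / ((1 - a) * K%:R)) * B4).
Proof.
move=> Q3 j00 K0 N0 l0 phiE hd eta0 eta1 eta2 eta3 h1 h2.
have Q0 : (0 < Q)%N := ltn_trans (isT : (0 < 2)%N) Q3.
have Qp : 0 < Q%:R :> R by rewrite ltr0n.
have Kp : 0 < K%:R :> R by rewrite ltr0n.
have Np : 0 < N%:R :> R by rewrite ltr0n.
have p0 := @pi_gt0 R; have Vp : 0 < V := covol_gt0 hw.
pose W (i : nat) := \sum_(j < Q) \sum_(q < Q) cw Q j * cell_tag l Q (i%:Z - N'%:Z) j q.
pose M := K%:R^-1 * \sum_(i < K) W i.
have g1 : `|(K%:R * N%:R ^+ 2)^-1 * (\sum_(i < K) \sum_(n <- disc N) psum N l phi (i%:Z - N'%:Z) n) - M|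
  <= 4 * pi / V * (e * B4) + 4 * pi * B3 * (j0%:R + 3) / (Q%:R * V)
     + Q%:R ^+ 2 * (2 * e * B4 + 9 * B3) * (count_err N / N%:R ^+ 2).
  have -> : (K%:R * N%:R ^+ 2)^-1 * (\sum_(i < K) \sum_(n <- disc N) psum N l phi (i%:Z - N'%:Z) n)
     = K%:R^-1 * \sum_(i < K) (N%:R ^- 2 * \sum_(n <- disc N) psum N l phi (i%:Z - N'%:Z) n).
    by rewrite invfM -[LHS]mulrA mulr_sumr.
  rewrite /M -mulrBr -sumrB.
  apply: (ler_norm_avg (h := fun i => N%:R ^- 2 * (\sum_(n <- disc N) psum N l phi (i%:Z - N'%:Z) n) - W i)) => // i _.
  exact: (level_estimate _ Q3 j00 N0 l0 phiE hd eta0 eta1 eta2 eta3 h1 h2).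
have g2 : `|M - \sum_(j < Q) Q%:R * cw Q j * Gbar l Q (j.+1%:R / Q%:R)| <=
    2 * pi / V * ((2 * e + 2 * B / ((1 - a) * K%:R)) * B4).
  have -> : M = \sum_(j < Q) Q%:R * cw Q j * ((K%:R * Q%:R)^-1 * \sum_(i < K) \sum_(q < Q)
     Gm l (j.+1%:R / Q%:R) (2 * pi * q%:R / Q%:R + 2 * pi * (i%:Z - N'%:Z)%:~R)).
    rewrite /M /W exchange_big/= mulr_sumr; apply: eq_bigr => j _.
    under eq_bigr do rewrite -mulr_sumr.
    rewrite -mulr_sumr /cell_tag; set S := \sum_(i < K) _.
    by field; rewrite !gt_eqF.
  rewrite -sumrB; apply: le_trans (ler_norm_sum _ _ _) _.
  set X := (2 * e + _) * B4.
  apply: (@le_trans _ _ (\sum_(j < Q) 2 * pi / (Q%:R * V) * X)).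
    apply: ler_sum => j _; rewrite -mulrBr normrM.
    have hQ : 2 * pi / Q%:R <= d.
      by apply: le_trans hd; rewrite lerDr invr_ge0.
    apply: ler_pM => //; last exact: Gam_level_avg.
    rewrite ger0_norm; last exact: mulr_ge0 (ltW Qp) (cw_ge0 _ _).
    have := ler_wpM2l (ltW Qp) (cw_le (ltn_ord j)).
    have -> : Q%:R * (2 * pi / (Q%:R ^+ 2 * V)) = 2 * pi / (Q%:R * V) by field; rewrite !gt_eqF.
    exact.
  rewrite sum_ord_const.
  have -> : 2 * pi / (Q%:R * V) * X * Q%:R = 2 * pi / V * X by field; rewrite !gt_eqF.
  exact: lexx.
set Z := \sum_(j < Q) _ in g2 *.
have := ler_distD M ((K%:R * N%:R ^+ 2)^-1 * (\sum_(i < K) \sum_(n <- disc N) psum N l phi (i%:Z - N'%:Z) n)) Z.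
lra.
Qed.

End cell_sums.

(** * From the correlation functional to a weighted sum over rings *)

Lemma div_nat_small (R : realType) (X e : R) : 0 < e ->
  exists n0 : nat, (0 < n0)%N /\ forall n, (n0 <= n)%N -> X / n%:R <= e.
Proof.
move=> e0; exists (Num.trunc (X / e)).+1; split=> // n hn.
have np : 0 < n%:R :> R by rewrite ltr0n; exact: leq_trans hn.
rewrite ler_pdivrMr// mulrC -ler_pdivrMr//; apply: le_trans (ltW (truncnS_gt _)) _.
by rewrite ler_nat.
Qed.

Section level_correlation.
Variables (R : realType) (a : R) (z0 w1 w2 : R[i]) (f : R[i] -> R) (A B C0 C2 : R).
Hypotheses (ha : 0 < a < 1) (hw : Rfree2 w1 w2) (A0 : 0 < A) (B0 : 0 < B)
  (tf : test_function f)
  (fA : forall z, A <= cmod z -> f z = 0) (fB : forall z, `|f z| <= B)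
  (C01 : 1 <= C0)
  (HC0 : forall (k : int) (n m : R[i]) (M : R), n != 0 -> m != 0 ->
    cmod n <= M -> cmod m <= M ->
    cmod (n - m) <= C0 * M `^ (1 - a) * cmod (pow_lvl a k n - pow_lvl a k m))
  (C20 : 0 < C2)
  (HC2 : forall r, 0 < r ->
    (size (gpts (lattice w1 w2) [set p | 0 < cmod p <= r]))%:R <= C2 * r ^+ 2).

Let C1 := C0 * A / a.
Local Notation disc := (disc_pts z0 w1 w2).
Local Notation psum := (pair_sum a z0 w1 w2 f).

(** The identity psi(N) = N^2/l^2 turns the normalisation into the mean over K levels and division
    by N^2, the factor l^2 being part of [pair_sum]. *)
Lemma corr_lvlE (phi psi : nat -> R) (N N' N'' : nat) (l : R) : (0 < N)%N -> 0 < phi N ->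
  psi N = ((N%:R `^ (2 - a)) / phi N) ^+ 2 -> l = phi N / N%:R `^ (1 - a) ->
  corr_lvl a (grid z0 w1 w2) phi psi N N' N'' f =
  ((N' + N'')%:R * N%:R ^+ 2)^-1 *
    \sum_(i < N' + N'') \sum_(n <- disc N) psum N l (phi N) (i%:Z - N'%:Z) n.
Proof.
move=> N0 phi0 psiE lE; rewrite /corr_lvl; set K := (N' + N'')%N.
have Np : 0 < N%:R :> R by rewrite ltr0n.
have E1 (F : R[i] * R[i] -> R) : \sum_(nm \in pairs (grid z0 w1 w2) N) F nm =
    \sum_(n <- disc N) \sum_(m <- disc N | m != n) F (n, m).
  pose s := [seq nm <- [seq (n, m) | n <- disc N, m <- disc N] | nm.2 != nm.1].
  have -> : pairs (grid z0 w1 w2) N = [set` s].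
    apply/seteqP; split => -[n m] /=; rewrite mem_filter/=.
      move=> [Ln Lm nm n1 m1]; rewrite eq_sym nm/=.
      by apply: allpairs_f; apply/mem_disc_pts.
    move=> /andP[mn /allpairsP[[n' m'] /= [nD mD [nE mE]]]]; subst n' m'.
    have /(mem_disc_pts z0 hw)[Ln n1] := nD; have /(mem_disc_pts z0 hw)[Lm m1] := mD.
    by rewrite /pairs/=; split=> //; rewrite eq_sym.
  rewrite -fsbig_seq; last first.
    rewrite filter_uniq// allpairs_uniq ?uniq_gpts//.
    by move=> [x y] [x' y'] /= _ _ [-> ->].
  rewrite /s big_filter big_mkcond/= big_allpairs_dep/=.
  by apply: eq_bigr => n _; rewrite -big_mkcond.
under eq_bigr do rewrite E1/=.
have -> : \sum_(i < K) \sum_(n <- disc N) psum N l (phi N) (i%:Z - N'%:Z) n =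
   l ^+ 2 * \sum_(i < K) \sum_(n <- disc N) \sum_(m <- disc N | m != n)
      f ((phi N)%:C * (pow_lvl a (i%:Z - N'%:Z) n - pow_lvl a (i%:Z - N'%:Z) m)).
  rewrite mulr_sumr; apply: eq_bigr => i _; rewrite mulr_sumr; apply: eq_bigr => n _.
  by rewrite /pair_sum.
rewrite mulrA; congr (_ * _).
have -> : psi N = N%:R ^+ 2 / l ^+ 2.
  rewrite psiE lE; have -> : N%:R `^ (2 - a) = N%:R `^ (1 - a) * N%:R :> R.
    rewrite -[X in _ * X]powRr1 ?ltW// -powRD; first by congr (_ `^ _); ring.
    by apply/implyP => _; rewrite gt_eqF.
  by field; rewrite !gt_eqF// powR_gt0.
by rewrite mulrA invfM invrK.
Qed.

(** The levels are averaged out, and N survives only through l. *)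
Definition limit_sum (l : R) (Q : nat) : R :=
  \sum_(j < Q) Q%:R * cw w1 w2 Q j * Gbar a w1 w2 f A C0 l Q (j.+1%:R / Q%:R).

(** No convergence of l is assumed: the bound holds for all l and N with C1/l <= eta N. The
    constants are chosen in the order e, d, j0, Q, eta, M0: j0 makes rings thin relative to their
    radius, Q makes bad cells rare, eta makes the shells small against the cells, and M0 absorbs the
    counting and averaging errors. *)
Lemma corr_limit_sum (eps : R) : 0 < eps -> exists Q0 : nat, forall Q, (Q0 <= Q)%N ->
  exists2 eta : R, 0 < eta & exists M0 : nat, forall (N K N' : nat) (l phi : R),
    (M0 <= N)%N -> (M0 <= K)%N -> (0 < N)%N -> (0 < K)%N -> 0 < l ->
    phi = l * N%:R `^ (1 - a) -> C1 / l <= eta * N%:R ->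
  `|(K%:R * N%:R ^+ 2)^-1 * \sum_(i < K) \sum_(n <- disc N) psum N l phi (i%:Z - N'%:Z) n
    - limit_sum l Q| <= eps.
Proof.
move=> eps0; case/andP: (ha) => a0 a1.
pose V := covol w1 w2; have Vp : 0 < V := covol_gt0 hw; have p0 := @pi_gt0 R.
pose td := tdiam w1 w2; have td0 : 0 < td := tdiam_gt0 hw.
have [B4 B4E b4] : exists2 B4, B4 = C2 * C1 ^+ 2 & 0 < B4.
  by exists (C2 * C1 ^+ 2) => //; exact: B4_gt0.
pose B3 := B * B4; have b3 : 0 < B3 by exact: mulr_gt0.
(* With this choice 4 pi/V e B4 is eps/8. It occurs twice, for the cells and for the level average;
   the three other errors get eps/4 each. *)
pose e := eps * V / (32 * pi * B4).
have e0 : 0 < e by apply: divr_gt0; apply: mulr_gt0 => //; exact: mulr_gt0.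
have u1 : 4 * pi / V * (e * B4) = eps / 8.
  rewrite /e; move: (@pi R) p0 => x x0.
  by field; rewrite (gt_eqF Vp) (gt_eqF x0) (gt_eqF b4).
have [d /andP[d0 d1] UC] := test_function_mult tf A0 fA e0.
have d2 : 0 < d / 2 by rewrite divr_gt0.
have [j0 [j00 hj0]] := div_nat_small 1 d2.
have n16 : 0 < 1600 :> R by lra.
have eps4 : 0 < eps / 4 by rewrite divr_gt0.
have [Q1 [Q10 hQ1]] := div_nat_small (2 * pi) d2.
have [Q2 [Q20 hQ2]] := div_nat_small (4 * pi * B3 * (j0%:R + 3) / V) eps4.
exists (3 + Q1 + Q2)%N => Q hQ.
have Q3 : (3 <= Q)%N by apply: leq_trans hQ; rewrite -addnA leq_addr.
have {}hQ1 : 2 * pi / Q%:R <= d / 2 by apply: hQ1; apply: leq_trans hQ; rewrite addnAC leq_addl.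
have {}hQ2 := hQ2 Q (leq_trans (leq_addl _ _) hQ).
have Q0 : (0 < Q)%N := ltn_trans (isT : (0 < 2)%N) Q3.
have Qp : 0 < Q%:R :> R by rewrite ltr0n.
have c0 : 0 < 2 * pi / Q%:R :> R by rewrite divr_gt0// mulr_gt0.
pose h := Num.min (1 / 20) (Num.min (2 * pi / Q%:R / 8) (d * a / 1600)) : R.
have h0 : 0 < h.
  have da : 0 < d * a by exact: mulr_gt0.
  by rewrite !lt_min; apply/andP; split; [exact: divr_gt0|apply/andP; split; [exact: divr_gt0|exact: divr_gt0 da n16]].
have h1 : h <= 1 / 20 by rewrite ge_min lexx.
have h2 : h <= 2 * pi / Q%:R / 8 by rewrite !ge_min lexx orbT.
have h3 : 1600 * h <= d * a.
  have : h <= d * a / 1600 by rewrite !ge_min lexx !orbT.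
  by rewrite (ler_pdivlMr _ _ n16) mulrC.
pose X := 24 * pi * (1 + td) * td / V.
have [M1 [M10 hM1]] := div_nat_small (Q%:R ^+ 2 * (2 * e * B4 + 9 * B3) * X) eps4.
have [M2 [M20 hM2]] := div_nat_small (2 * pi / V * (2 * B / (1 - a) * B4)) eps4.
(* As j0 >= 1, the inner radius j0 N/Q is at least N/Q, so C1/l <= (h/Q) N gives both conditions on
   C1/l, the second because h <= 1. *)
exists (h / Q%:R); first by rewrite divr_gt0.
exists (M1 + M2)%N => N K N' l phi hN hK N0 K0 l0 phiE hl.
have Np : 0 < N%:R :> R by rewrite ltr0n.
have Kp : 0 < K%:R :> R by rewrite ltr0n.
have {}hM1 := hM1 N (leq_trans (leq_addr _ _) hN).
have {}hM2 := hM2 K (leq_trans (leq_addl _ _) hK).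
have NQ : 0 < N%:R / Q%:R :> R by exact: divr_gt0.
have hlE : h / Q%:R * N%:R = h * (N%:R / Q%:R) by rewrite mulrAC mulrA.
have r1 : C1 / l <= h * radii R N Q j0.
  apply: le_trans hl _; rewrite hlE ler_pM2l// /radii -[_ * _ / _]mulrA.
  by rewrite ler_peMl ?(ltW NQ)// ler1n.
have r2 : C1 / l <= N%:R / Q%:R.
  by apply: le_trans hl _; rewrite hlE ler_piMl ?(ltW NQ)//; apply: le_trans h1 _; rewrite ler_pdivrMr// mul1r ler1n.
have hd : j0%:R^-1 + 2 * pi / Q%:R <= d.
  by rewrite [leRHS]splitr; apply: lerD => //; rewrite -[leLHS]mul1r; exact: hj0.
have := @total_estimate R a z0 w1 w2 f A B C0 C2 ha hw A0 B0 fA fB C01 HC0 C20 HC2 d e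
  d0 (ltW e0) UC N Q j0 K N' l phi h Q3 j00 K0 N0 l0 phiE hd h0 h1 h2 h3 r1 r2.
rewrite /limit_sum -/V -/C1 -B4E -/B3 => hh; apply: le_trans hh _.
have u2 : 4 * pi * B3 * (j0%:R + 3) / (Q%:R * V) <= eps / 4.
  apply: le_trans hQ2; rewrite le_eqVlt; apply/orP; left; apply/eqP.
  by field; rewrite !gt_eqF.
have u3 : Q%:R ^+ 2 * (2 * e * B4 + 9 * B3) * (count_err w1 w2 N / N%:R ^+ 2) <= eps / 4.
  apply: le_trans hM1; rewrite -[leRHS]mulrA; apply: ler_wpM2l.
    apply: mulr_ge0; first exact: sqr_ge0.
    apply: addr_ge0; last exact: mulr_ge0 (ltW b3).
    by apply: mulr_ge0 (ltW b4); apply: mulr_ge0 (ltW e0).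
  rewrite /X /count_err -/td -/V ler_pdivrMr ?exprn_gt0//.
  have -> : 24 * pi * (1 + td) * td / V / N%:R * N%:R ^+ 2 = 24 * pi * ((1 + td) * N%:R) * td / V.
    by field; rewrite !gt_eqF.
  rewrite ler_pM2r ?invr_gt0// ler_pM2r// ler_pM2l ?mulr_gt0//.
  by rewrite mulrDl mul1r lerD2l ler_peMr ?(ltW td0)// ler1n.
have u4 : 2 * pi / V * ((2 * e + 2 * B / ((1 - a) * K%:R)) * B4) <= eps / 8 + eps / 4.
  have -> : 2 * pi / V * ((2 * e + 2 * B / ((1 - a) * K%:R)) * B4) =
     4 * pi / V * (e * B4) + 2 * pi / V * (2 * B / (1 - a) * B4) / K%:R.
    by field; rewrite !gt_eqF// subr_gt0.
  by rewrite u1 lerD2l.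
rewrite u1; apply: le_trans (lerD (lerD (lerD (lexx _) u2) u3) u4) _.
by rewrite le_eqVlt; apply/orP; left; apply/eqP; field.
Qed.

Lemma pair_sum_shell0 (N : nat) (l phi : R) (k : int) (n : R[i]) : (0 < N)%N -> 0 < l ->
  phi = l * N%:R `^ (1 - a) -> n \in disc N ->
  (forall p, lattice w1 w2 p -> p != 0 -> C1 / l < cmod p) -> psum N l phi k n = 0.
Proof.
move=> N0 l0 phiE nD hp; rewrite (pair_sumE ha hw A0 fA C01 HC0 k N0 l0 phiE nD).
rewrite big1_seq ?mulr0// => p /andP[_ /(mem_shell_pts hw)[Lp /andP[p0 pr]]].
by have := hp p Lp; rewrite -cmod_gt0 => /(_ p0); rewrite ltNge pr.
Qed.

End level_correlation.

(** * Radial Riemann sums *)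

Section radial.
Variable R : realType.
Implicit Types (z w : R[i]) (f G : R[i] -> R).
Local Notation plane := (measurableTypeR R * measurableTypeR R)%type.

Lemma integrable_supp G (A B : R) : measurable_fun setT (fun p : R * R => G (toC p)) ->
  (forall z, `|G z| <= B) -> (forall z, A <= cmod z -> G z = 0) ->
  (@leb2 R).-integrable setT (EFin \o (fun p : plane => G (toC p))).
Proof.
move=> mG GB GA.
pose D : set plane := @toC R @^-1` [set z | cmod z <= A].
have mD : measurable D := @measurable_plane_disc R true A.
have fD : (leb2 D < +oo)%E.
  apply: leb2_lty; first exact: mD.
  by exists A.
have ig : (@leb2 R).-integrable D (EFin \o (fun p : plane => G (toC p))).
  apply: measurable_bounded_integrable => //.
    by apply: measurable_funTS.
  exists B; split; first exact: num_real.
  by move=> M BM p _ /=; apply: le_trans (GB _) _; exact: ltW.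
have := (integrable_mkcond _ mD).1 ig; apply: eq_integrable => // p _.
rewrite /= patchE; case: ifPn => //; rewrite notin_setE /D/= => /negP; rewrite -ltNge => h.
by rewrite GA// ltW.
Qed.

Lemma integralC_sum (I : eqType) (s : seq I) (G : I -> R[i] -> R) (A : R) :
  (forall i, i \in s -> [/\ measurable_fun setT (fun p : R * R => G i (toC p)),
     exists B, forall z, `|G i z| <= B & forall z, A <= cmod z -> G i z = 0]) ->
  integralC (fun z => \sum_(i <- s) G i z) = \sum_(i <- s) integralC (G i).
Proof.
move=> h.
suff [_ ->] : (@leb2 R).-integrable setT (EFin \o (fun p : plane => \sum_(i <- s) G i (toC p))) /\
  integralC (fun z => \sum_(i <- s) G i z) = \sum_(i <- s) integralC (G i) by [].
elim: s h => [h|i s IH h].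
  split; first by under eq_fun do rewrite big_nil; exact: integrable0.
  rewrite big_nil /integralC; under eq_Rintegral do rewrite big_nil.
  by rewrite Rintegral_cst// mul0r.
have [|i1 e1] := IH; first by move=> j js; apply: h; rewrite inE js orbT.
have [|mG [B GB] GA] := h i; first by rewrite inE eqxx.
have i2 := integrable_supp mG GB GA.
split.
  have := integrableD measurableT i2 i1; apply: eq_integrable => // p _ /=.
  by rewrite big_cons EFinD.
rewrite big_cons -e1 /integralC -RintegralD//.
by apply: eq_Rintegral => p _; rewrite big_cons.
Qed.

Lemma polar_dist (r s x y : R) : 0 <= s ->
  cmod (r%:C * cis x - s%:C * cis y) <= `|r - s| + s * `|x - y|.
Proof.
move=> s0; have -> : r%:C * cis x - s%:C * cis y = (r - s)%:C * cis x + s%:C * (cis y * (cis (x - y) - 1)).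
  have -> : cis y * (cis (x - y) - 1) = cis x - cis y.
    by rewrite mulrBr mulr1 -cisD [y + _]addrC subrK.
  by rewrite rmorphB/=; ring.
apply: le_trans (ler_cmodD _ _) _; apply: lerD.
  by rewrite cmodM cmodC cmod_cis mulr1.
by rewrite cmodMC// cmodM cmod_cis mul1r ler_wpM2l// cmod_cisB1.
Qed.

Lemma sector_dist (Q q : nat) (s : R) z : (3 <= Q)%N -> (q < Q)%N -> 0 <= s -> sector Q q z ->
  cmod (z - s%:C * cis (q%:R * (2 * pi / Q%:R))) <= `|cmod z - s| + s * (2 * pi / Q%:R).
Proof.
move=> Q3 qQ s0 Sz; rewrite {1}(cmod_cis_arg z).
have Qp : 0 < Q%:R :> R by rewrite ltr0n; exact: ltn_trans (isT : (0 < 2)%N) Q3.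
have /andP[h1 h2] := (sectorP Q3 qQ (sector_neq0 Sz)).1 Sz.
apply: le_trans (polar_dist _ _ _ s0) _; rewrite lerD2l ler_wpM2l//.
have qS : q.+1%:R = q%:R + 1 :> R by rewrite natr1.
have E1 : q%:R * (2 * pi / Q%:R) = 2 * pi * q%:R / Q%:R :> R by rewrite mulrC mulrAC.
have E2 : 2 * pi * q.+1%:R / Q%:R = 2 * pi * q%:R / Q%:R + 2 * pi / Q%:R :> R.
  by rewrite qS mulrDr mulr1 mulrDl.
rewrite E2 in h2; rewrite E1 ler_norml; apply/andP; split; lra.
Qed.

Lemma sum_radial_avg f (Q : nat) (s c x : R) : (0 < Q)%N ->
  \sum_(q < Q) f (s%:C * cis (q%:R * (2 * pi / Q%:R))) * c * (x / Q%:R) = c * x * radial_avg f Q s.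
Proof.
move=> Q0; rewrite /radial_avg /avg mulrCA -mulr_suml -mulr_suml; ring.
Qed.

(** The last radius may lie far beyond the support, so s^2 is truncated at (2A)^2 before
    telescoping. Truncation changes nothing on the rings that count: from s i < A the next radius is
    at most 2A. *)
Lemma telescope_min (s : nat -> R) (A th e : R) (J : nat) : 0 <= e -> 0 <= A -> 0 <= th <= 1 ->
  (forall i, 0 <= s i) -> (forall i, s i <= s i.+1) ->
  (forall i, (i < J)%N -> s i < A -> s i.+1 <= s i * (1 + th)) ->
  \sum_(i < J) (if s i < A then e else 0) * (pi * (s i.+1 ^+ 2 - s i ^+ 2)) <= e * (4 * pi * A ^+ 2).
Proof.
move=> e0 A0 /andP[th0 th1] s0 sm st; have p0 := @pi_ge0 R.
pose u i := Num.min (s i) (2 * A) ^+ 2.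
have hA : 0 <= 2 * A by lra.
have u0 i : 0 <= u i by exact: sqr_ge0.
have u4 i : u i <= 4 * A ^+ 2.
  have -> : 4 * A ^+ 2 = (2 * A) ^+ 2 by ring.
  by rewrite lerXn2r ?nnegrE// ?le_min ?s0 ?hA// ge_min lexx orbT.
have um i : u i <= u i.+1.
  rewrite lerXn2r ?nnegrE// ?le_min ?s0 ?hA//.
  by rewrite ge_min sm/= ge_min lexx orbT.
apply: (@le_trans _ _ (\sum_(i < J) e * (pi * (u i.+1 - u i)))).
  apply: ler_sum => i _; case: ifPn => hi; last first.
    by rewrite mul0r mulr_ge0// mulr_ge0// subr_ge0.
  rewrite ler_wpM2l// ler_wpM2l//.
  have h1 : s i.+1 <= 2 * A.
    apply: le_trans (st i (ltn_ord i) hi) _; have := s0 i; nra.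
  have h2 : s i <= 2 * A by apply: le_trans (sm i) h1.
  by rewrite /u (min_idPl h1) (min_idPl h2).
rewrite -mulr_sumr -mulr_sumr ler_wpM2l// [4 * pi]mulrC -mulrA ler_wpM2l//.
rewrite -(big_mkord xpredT (fun i => u i.+1 - u i)) telescope_sumr//.
by apply: le_trans (u4 J); rewrite gerBl.
Qed.

(** On a cell meeting the support, f varies by e and h by e2, whence e H + B e2; further out both
    sides vanish, so the rings need be thin only below A. The weight h is sampled at its own point
    [sg], because the weights arise from a mean value theorem. *)
Lemma radial_riemann f (Q J : nat) (s sg : nat -> R) (h : R -> R) (A B H d e th e2 : R) :
  (3 <= Q)%N -> 0 < A -> 0 < B -> 0 <= H -> (forall z, A <= cmod z -> f z = 0) ->
  (forall z, `|f z| <= B) -> 0 <= e -> 0 <= e2 ->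
  (forall z w, cmod (w - z) <= d * cmod z -> `|f w - f z| <= e) ->
  measurable_fun setT (fun p : R * R => f (toC p)) ->
  0 <= th <= 1 -> th + 2 * pi / Q%:R <= d ->
  {homo s : i j / (i <= j)%N >-> i <= j} -> 0 < s 0%N -> A <= s J ->
  (forall i, (i < J)%N -> s i <= sg i <= s i.+1) ->
  measurable_fun setT h -> (forall x, s 0%N <= x -> 0 <= h x <= H) ->
  (forall x y, s 0%N <= x -> x <= y -> h y <= h x) ->
  (forall i, (i < J)%N -> s i < A -> s i.+1 <= s i * (1 + th) /\ h (s i) - h (s i.+1) <= e2) ->
  `|integralC (fun z => if s 0%N <= cmod z then f z * h (cmod z) else 0) -
    \sum_(i < J) h (sg i) * (pi * (s i.+1 ^+ 2 - s i ^+ 2)) * radial_avg f Q (s i)|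
  <= (e * H + B * e2) * (4 * pi * A ^+ 2).
Proof.
move=> Q3 A0 B0 H0 fA fB e0 e20 UC mf th01 hd sm s0 sJ sgP mh hH hm hs.
have Q0 : (0 < Q)%N := ltn_trans (isT : (0 < 2)%N) Q3.
have Qp : 0 < Q%:R :> R by rewrite ltr0n.
have sp i : 0 < s i by apply: lt_le_trans s0 _; exact: sm.
set G := fun z => _.
pose c i q := f ((s i)%:C * cis (q%:R * (2 * pi / Q%:R))) * h (sg i).
pose ee := e * H + B * e2.
have ee0 : 0 <= ee by rewrite addr_ge0// mulr_ge0// ltW.
under eq_bigr do rewrite -sum_radial_avg//.
apply: le_trans (telescope_min (J := J) ee0 (ltW A0) th01 (fun i => ltW (sp i)) (fun i => sm _ _ (leqnSn i)) (fun i iJ iA => (hs i iJ iA).1)).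
apply: (@polar_riemann_sum R false Q J s c (fun i => if s i < A then ee else 0) (B * H) G) => //.
- exact: ltW.
- rewrite /G; apply: measurable_fun_ifT => //.
  + apply: measurable_fun_ler => //; exact: measurable_fun_cmod.
  + apply: measurable_funM => //; apply: measurableT_comp => //; exact: measurable_fun_cmod.
- move=> z; rewrite /G; case: ifPn => [zs|_]; last by rewrite normr0 mulr_ge0// ltW.
  have /andP[h0 h1] := hH _ zs; rewrite normrM ler_pM// ger0_norm//.
- move=> i q z iJ qQ [Sz /= /andP[z1 z2]].
  have /andP[g1 g2] := sgP _ iJ.
  have s0i : s 0%N <= s i by exact: sm.
  rewrite /G (le_trans s0i z1) /c.
  case: ifPn => hi; last first.
    rewrite -leNgt in hi; rewrite !fA ?mul0r ?subrr ?normr0//.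
      by rewrite cmodMC ?(ltW (sp _))// cmod_cis mulr1.
    exact: le_trans hi z1.
  have [t1 t2] := hs i iJ hi.
  set w := _ * cis _.
  have cw : cmod w = s i by rewrite cmodMC ?(ltW (sp _))// cmod_cis mulr1.
  have dz : `|f z - f w| <= e.
    apply: UC; rewrite cw; apply: le_trans (sector_dist Q3 qQ (ltW (sp i)) Sz) _.
    rewrite ger0_norm ?subr_ge0//.
    have := sp i; have := ler_wpM2l (ltW (sp i)) hd; lra.
  have dh : `|h (cmod z) - h (sg i)| <= e2.
    have a1 := hm _ _ s0i z1; have a2 := hm _ _ (le_trans s0i z1) (ltW z2).
    have a3 := hm _ _ s0i g1; have a4 := hm _ _ (le_trans s0i g1) g2.
    rewrite ler_norml; apply/andP; split; lra.
  have -> : f z * h (cmod z) - f w * h (sg i) = (f z - f w) * h (cmod z) + f w * (h (cmod z) - h (sg i)) by ring.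
  apply: le_trans (ler_normD _ _) _; rewrite !normrM; apply: lerD; apply: ler_pM => //.
  have /andP[h0 h1] := hH _ (le_trans s0i z1); by rewrite ger0_norm.
- move=> z z0 nc; rewrite /G; case: ifPn => // zs.
  have [zA|zA] := leP A (cmod z); first by rewrite fA// mul0r.
  have [q qQ Sq] := sector_exists Q3 z0.
  have exi : exists i, cmod z < s i.+1.
    by exists J; apply: lt_le_trans zA _; apply: le_trans sJ _; exact: sm.
  pose i := ex_minn exi.
  have [iz imin] : cmod z < s i.+1 /\ forall j, cmod z < s j.+1 -> (i <= j)%N.
    by rewrite /i; case: ex_minnP.
  exfalso; have si : s i <= cmod z.
    case E : i => [|i']; first by [].
    by rewrite leNgt; apply/negP => /imin; rewrite E ltnn.
  have iJ : (i < J)%N.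
    rewrite ltnNge; apply/negP => Ji; have := sm _ _ Ji; lra.
  by apply: (nc i q iJ qQ); split => //=; rewrite si.
Qed.

End radial.

(** * Power functions and the radial change of variables *)

Section powers.
Variable R : realType.
Implicit Types x y k q : R.

Lemma powRVN x k : 0 < x -> x^-1 `^ k = x `^ (- k).
Proof. by move=> x0; rewrite -powR_inv1 ?ltW// -powRrM mulN1r. Qed.

Lemma ler_powRN x y q : 0 < x -> x <= y -> 0 <= q -> y `^ (- q) <= x `^ (- q).
Proof.
move=> x0 xy q0; have y0 := lt_le_trans x0 xy.
rewrite -!powRVN//; apply: ge0_ler_powR => //; rewrite ?nnegrE ?invr_ge0 ?(ltW x0) ?(ltW y0)//.
by rewrite lef_pV2 ?posrE.
Qed.

Lemma powRN_dist x m q : 0 < x -> 1 <= m -> 0 <= q ->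
  x `^ (- q) - (x * m) `^ (- q) <= x `^ (- q) * (q * (m - 1)).
Proof.
move=> x0 m1 q0; have m0 : 0 < m := lt_le_trans ltr01 m1.
rewrite powRM ?(ltW x0) ?(ltW m0)// -{1}[x `^ (- q)]mulr1 -mulrBr.
apply: ler_wpM2l; first exact: powR_ge0.
have [->|mne] := eqVneq m 1; first by rewrite powR1 !subrr mulr0.
have m1' : 1 < m by rewrite lt_neqAle eq_sym mne.
have [c /andP[c1 cm]] := powR_MVT (- q) ltr01 m1'; rewrite powR1 => E.
have -> : 1 - m `^ (- q) = c `^ (- q - 1) * (q * (m - 1)).
  by rewrite -opprB E; ring.
apply: ler_piMl; first by rewrite mulr_ge0// subr_ge0.
have -> : - q - 1 = - (q + 1) by ring.
have E1 : 1 `^ (- (q + 1)) = 1 :> R by rewrite powR1.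
rewrite -[leRHS]E1; apply: ler_powRN => //; first exact: ltW.
by rewrite addr_ge0.
Qed.

Lemma powR_cancel x k : 0 < x -> k != 0 -> (x `^ k) `^ k^-1 = x.
Proof. by move=> x0 k0; rewrite -powRrM mulfV// powRr1// ltW. Qed.

Lemma powR_natV x (n : nat) : 0 < x -> x `^ (- n%:R) = x ^- n.
Proof. by move=> x0; rewrite powRN powR_mulrn// ltW. Qed.

Lemma powR_two_sqr x k : 0 < x -> (x `^ k) ^+ 2 = x `^ (2 * k).
Proof. by move=> x0; rewrite -[_ ^+ 2]powR_mulrn ?powR_ge0// -powRrM mulrC. Qed.

(* Change of variables s = kap * u^(1-a) in the weights u^-2. *)
Lemma radial_weight_MVT (a kap u v : R) : 0 < a < 1 -> 0 < kap -> 0 < u -> u < v ->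
  exists2 sg, kap * u `^ (1 - a) <= sg <= kap * v `^ (1 - a) &
    kap `^ (2 / (1 - a)) / (1 - a) * sg `^ (- (2 + 2 / (1 - a))) *
      ((kap * v `^ (1 - a)) ^+ 2 - (kap * u `^ (1 - a)) ^+ 2) = u ^- 2 - v ^- 2.
Proof.
move=> /andP[a0 a1] k0 u0 uv; have v0 := lt_trans u0 uv.
have b0 : 0 < 1 - a by rewrite subr_gt0.
set g := 2 / (1 - a).
(* In the variable x = (s/kap)^2 the weight u^-2 is x^(-1/(1-a)); the ordinary mean value theorem
   yields an intermediate c, and [sg] is kap times its square root. *)
pose x := u `^ (2 * (1 - a)); pose y := v `^ (2 * (1 - a)).
have x0 : 0 < x by rewrite powR_gt0.
have xy : x < y by rewrite /x /y gt0_ltr_powR ?nnegrE ?mulr_gt0 ?ltW.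
have [c /andP[xc cy] E] := powR_MVT (- (1 - a)^-1) x0 xy.
have c0 := lt_trans x0 xc.
have sq w : 0 < w -> (w `^ (2 * (1 - a))) `^ 2^-1 = w `^ (1 - a).
  move=> w0; rewrite -powRrM; congr (_ `^ _); by field.
exists (kap * c `^ 2^-1).
  rewrite -(sq u)// -(sq v)// !ler_pM2l//; apply/andP; split;
    apply: ge0_ler_powR; rewrite ?nnegrE ?powR_ge0 ?invr_ge0 ?(ltW c0)//; exact: ltW.
have e1 w : 0 < w -> (w `^ (2 * (1 - a))) `^ (- (1 - a)^-1) = w ^- 2.
  move=> w0; rewrite -(powR_natV 2 w0) -powRrM; congr (_ `^ _).
  by field; rewrite gt_eqF.
rewrite /x /y !e1// in E.
rewrite !exprMn !powR_two_sqr// -mulrBr -/x -/y.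
have -> : u ^- 2 - v ^- 2 = (1 - a)^-1 * c `^ (- (1 - a)^-1 - 1) * (y - x).
  by transitivity (- (v ^- 2 - u ^- 2)); [ring|rewrite E -/x -/y; ring].
rewrite powRM ?powR_ge0 ?(ltW k0)// -(powRrM c).
have -> : 2^-1 * - (2 + g) = - (1 - a)^-1 - 1 by rewrite /g; field; rewrite gt_eqF.
have kk : kap `^ g * kap `^ (- (2 + g)) * kap ^+ 2 = 1.
  rewrite -(powR_mulrn 2 (ltW k0)) -!powRD ?(gt_eqF k0) ?implybT//.
  have -> : g + - (2 + g) + 2%:R = 0 by ring.
  by rewrite powRr0.
set C := c `^ _.
transitivity (kap `^ g * kap `^ (- (2 + g)) * kap ^+ 2 * ((1 - a)^-1 * C * (y - x))); first by ring.
by rewrite kk mul1r.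
Qed.

End powers.

(** * Contribution of a single lattice vector when lam > 0 *)

Section shell_limits.
Variables (R : realType) (a : R) (w1 w2 : R[i]) (f : R[i] -> R) (A B : R).
Hypotheses (ha : 0 < a < 1) (hw : Rfree2 w1 w2) (A0 : 0 < A) (B0 : 0 < B)
  (tf : test_function f)
  (fA : forall z, A <= cmod z -> f z = 0) (fB : forall z, `|f z| <= B).

Let V := covol w1 w2.
Let g := 2 / (1 - a).
Let q := 2 + g.

Lemma radial_avg_supp (Q : nat) (s : R) : A <= s -> radial_avg f Q s = 0.
Proof.
move=> As; have s0 : 0 <= s := le_trans (ltW A0) As.
rewrite /radial_avg /avg big1 ?mulr0// => t _; apply: fA.
by rewrite cmodMC// cmod_cis mulr1.
Qed.

(** Ring j enters through s = kap u^(1-a) with u = Q/(j+1), and its weight is pi/V times an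
    increment of u^-2. [radial_weight_MVT] converts this exactly into the density h at an
    intermediate point times an increment of s^2, so the sum is a polar Riemann sum with unequal
    radii. *)
Lemma shell_limit (lam kap eps : R) : 0 < lam -> 0 < kap -> 0 < eps ->
  exists Q0 : nat, forall Q, (Q0 <= Q)%N ->
  `|\sum_(j < Q) Q%:R * cw w1 w2 Q j * (lam ^+ 2 * radial_avg f Q (kap * (Q%:R / j.+1%:R) `^ (1 - a)))
    - integralC (fun z => if kap <= cmod z then
        f z * (lam ^+ 2 * kap `^ g / ((1 - a) * V) * cmod z `^ (- q)) else 0)| <= eps.
Proof.
move=> l0 k0 eps0; case/andP: (ha) => a0 a1; have b0 : 0 < 1 - a by rewrite subr_gt0.
have Vp : 0 < V := covol_gt0 hw; have p0 := @pi_gt0 R.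
have g0 : 0 < g by rewrite divr_gt0.
have q0 : 0 < q by rewrite addr_gt0.
pose D := lam ^+ 2 * kap `^ g / ((1 - a) * V).
have D0 : 0 < D.
  apply: divr_gt0; first by apply: mulr_gt0; [exact: exprn_gt0|exact: powR_gt0].
  exact: mulr_gt0.
pose H := D * kap `^ (- q).
have H0 : 0 < H by apply: mulr_gt0 => //; exact: powR_gt0.
pose h x := D * x `^ (- q).
have A4 : 0 < 4 * pi * A ^+ 2 :> R.
  by apply: mulr_gt0; [exact: mulr_gt0|exact: exprn_gt0].
pose e := eps / ((H + B) * (4 * pi * A ^+ 2)).
have HB : 0 < H + B by exact: addr_gt0.
have e0 : 0 < e by apply: divr_gt0 => //; exact: mulr_gt0.
have eE : (e * H + B * e) * (4 * pi * A ^+ 2) = eps.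
  rewrite /e; move: (4 * pi * A ^+ 2) A4 => x x0.
  by field; rewrite (gt_eqF HB) (gt_eqF x0).
have [d /andP[d0 d1] UC] := test_function_mult tf A0 fA e0.
have d2 : 0 < d / 2 by rewrite divr_gt0.
pose th := Num.min 1 (Num.min (d / 2) (e / (H * q))).
have Hq : 0 < H * q by exact: mulr_gt0.
have th0 : 0 < th by rewrite !lt_min ltr01 d2/= divr_gt0.
have th1 : th <= 1 by rewrite ge_min lexx.
have thd : th <= d / 2 by rewrite !ge_min lexx orbT.
have the : H * q * th <= e.
  by rewrite mulrC -ler_pdivlMr// !ge_min lexx !orbT.
(* s reaches A at u = U: only rings with u < U meet the support. *)
pose U := (A / kap) `^ (1 - a)^-1.
have Ak : 0 < A / kap by exact: divr_gt0.
have U0 : 0 < U by rewrite powR_gt0.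
have UE : U `^ (1 - a) = A / kap.
  by rewrite /U -{2}[1 - a]invrK powR_cancel// invr_eq0 gt_eqF.
have [Q1 [Q10 hQ1]] := div_nat_small (2 * pi) d2.
(* For u = Q/m < U this forces m > 1 + 1/th, so consecutive values of u have ratio m/(m-1) at most 1
   + th. *)
have [Q2 [Q20 hQ2]] := div_nat_small (U * (1 + th^-1)) (@ltr01 R).
exists (3 + Q1 + Q2)%N => Q hQ.
have Q3 : (3 <= Q)%N by apply: leq_trans hQ; rewrite -addnA leq_addr.
have {}hQ1 : 2 * pi / Q%:R <= d / 2 by apply: hQ1; apply: leq_trans hQ; rewrite addnAC leq_addl.
have {}hQ2 := hQ2 Q (leq_trans (leq_addl _ _) hQ).
have Q0 : (0 < Q)%N := ltn_trans (isT : (0 < 2)%N) Q3.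
have Qp : 0 < Q%:R :> R by rewrite ltr0n.
rewrite ler_pdivrMr// mul1r in hQ2.
(* s decreases in j, so the rings are numbered backwards by m = j + 1 = Q - i. The maximum with 1
   keeps the radii defined and monotone for all i. *)
pose m i := maxn 1 (Q - i).
have m1 i : (0 < m i)%N by rewrite leq_max.
have mp i : 0 < (m i)%:R :> R by rewrite ltr0n.
have mm i j : (i <= j)%N -> (m j <= m i)%N.
  by move=> ij; rewrite geq_max !leq_max leqnn/= leq_sub2l ?orbT.
pose u i : R := Q%:R / (m i)%:R.
have u0 i : 0 < u i by exact: divr_gt0.
pose s i := kap * u i `^ (1 - a).
have um i j : (i <= j)%N -> u i <= u j.
  by move=> ij; rewrite ler_pM2l// lef_pV2 ?posrE// ler_nat mm.
have sm : {homo s : i j / (i <= j)%N >-> i <= j}.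
  by move=> i j ij; rewrite ler_pM2l//; apply: ge0_ler_powR; rewrite ?nnegrE ?(ltW b0) ?(ltW (u0 _))// um.
have s0 : s 0%N = kap.
  rewrite /s; have -> : u 0%N = 1 by rewrite /u /m subn0 (maxn_idPr Q0) divff ?gt_eqF.
  by rewrite powR1 mulr1.
pose J := Q.-1.
have QJ : Q = J.+1 by rewrite prednK.
have mJ i : (i < J)%N -> m i = (J - i).+1 /\ m i.+1 = (J - i)%N.
  by move=> iJ; rewrite /m QJ subSn ?(ltnW iJ)// subSS; split; apply/maxn_idPr; rewrite ?subn_gt0.
have UQ : U <= Q%:R by apply: le_trans hQ2; rewrite ler_peMr ?(ltW U0)// lerDl invr_ge0 ltW.
have sJ : A <= kap * Q%:R `^ (1 - a).
  rewrite -ler_pdivrMl// mulrC -UE.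
  by apply: ge0_ler_powR; rewrite ?nnegrE ?(ltW b0) ?(ltW U0) ?(ltW Qp).
have uJ : u J = Q%:R by rewrite /u /m QJ subSnn maxnn divr1.
have exsg i : exists sg, (i < J)%N -> s i <= sg <= s i.+1 /\
    h sg * (s i.+1 ^+ 2 - s i ^+ 2) = lam ^+ 2 / V * ((u i) ^- 2 - (u i.+1) ^- 2).
  case: (ltnP i J) => iJ; last by exists 0.
  have uu : u i < u i.+1.
    rewrite /u; have [-> ->] := mJ i iJ.
    by rewrite ltr_pM2l// ltf_pV2 ?posrE ?ltr0n ?subn_gt0// ltr_nat.
  have [sg sg1 sg2] := radial_weight_MVT ha k0 (u0 i) uu.
  exists sg => _; split => //; rewrite -sg2 -/g -/q /h /D -/(s i) -/(s i.+1).
  by field; rewrite (gt_eqF b0) (gt_eqF Vp).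
have [sg sgP] := choice exsg.
have sumE : \sum_(j < Q) Q%:R * cw w1 w2 Q j * (lam ^+ 2 * radial_avg f Q (kap * (Q%:R / j.+1%:R) `^ (1 - a)))
   = \sum_(i < J) h (sg i) * (pi * (s i.+1 ^+ 2 - s i ^+ 2)) * radial_avg f Q (s i).
  pose F j := Q%:R * cw w1 w2 Q j * (lam ^+ 2 * radial_avg f Q (kap * (Q%:R / j.+1%:R) `^ (1 - a))).
  rewrite -/(\sum_(j < Q) F j).
  have -> : \sum_(j < Q) F j = \sum_(i < J) F (J - i)%N.
    (* The innermost ring, where s is largest, already has s >= A: it drops out, and Q - 1 rings
       remain. *)
    have F0 : F 0%N = 0 by rewrite /F divr1 radial_avg_supp// !mulr0.
    rewrite [in LHS]QJ (reindex_inj rev_ord_inj) big_ord_recr/= subSS subnn F0 addr0.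
    by apply: eq_bigr => i _; rewrite subSS.
  apply: eq_bigr => i _; have [mi mi1] := mJ i (ltn_ord i).
  have sE : s i = kap * (Q%:R / (J - i).+1%:R) `^ (1 - a) by rewrite /s /u mi.
  have [_ hE] := sgP i (ltn_ord i).
  have -> : h (sg i) * (pi * (s i.+1 ^+ 2 - s i ^+ 2)) = pi * (lam ^+ 2 / V * (u i ^- 2 - u i.+1 ^- 2)).
    by rewrite -hE; ring.
  rewrite /F -sE mulrA; congr (_ * _).
  rewrite /u mi mi1 /cw -/V; have x0 : 0 < (J - i)%:R :> R by rewrite ltr0n subn_gt0.
  have -> : (J - i).+1%:R = (J - i)%:R + 1 :> R by rewrite natr1.
  move: ((J - i)%:R : R) x0 (@pi R) => x x0 y.
  by field; rewrite (gt_eqF x0) (gt_eqF Vp) (gt_eqF Qp)/= gt_eqF// addr_gt0.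
have hs i : (i < J)%N -> s i < A -> s i.+1 <= s i * (1 + th) /\ h (s i) - h (s i.+1) <= e.
  move=> iJ iA; have [mi mi1] := mJ i iJ.
  pose x := (J - i)%:R : R.
  have x0 : 0 < x by rewrite ltr0n subn_gt0.
  have miE : (m i)%:R = x + 1 :> R by rewrite mi -natr1.
  have mi1E : (m i.+1)%:R = x by rewrite mi1.
  have uU : u i < U.
    rewrite ltNge; apply/negP => Uu; move: iA; rewrite ltNge => /negP; apply.
    rewrite /s -ler_pdivrMl// mulrC -UE.
    by apply: ge0_ler_powR; rewrite ?nnegrE ?(ltW b0) ?(ltW U0) ?(ltW (u0 _)).
  have xth : th^-1 <= x.
    move: uU; rewrite /u miE ltr_pdivrMr ?addr_gt0// => h1.
    have := le_lt_trans hQ2 h1; rewrite ltr_pM2l// [x + 1]addrC ltrD2l; exact: ltW.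
  pose w := (x + 1) / x.
  have w1' : 1 <= w by rewrite ler_pdivlMr// mul1r lerDl.
  have wth : w <= 1 + th.
    rewrite ler_pdivrMr// mulrDl mul1r lerD2l.
    by rewrite -ler_pdivrMl// mulr1.
  pose n := w `^ (1 - a).
  have n1 : 1 <= n by rewrite -(powRr0 w) ler_powR// ltW.
  have nw : n <= w by rewrite ler1_powR//; lra.
  have sE : s i.+1 = s i * n.
    rewrite /s -mulrA; congr (_ * _); rewrite /n -powRM ?(ltW (u0 _)) ?(le_trans ler01 w1')//.
    congr (_ `^ _); rewrite /u miE mi1E /w; field; rewrite (gt_eqF x0) gt_eqF//; exact: addr_gt0.
  have si0 : kap <= s i by rewrite -s0; exact: sm.
  have sip := lt_le_trans k0 si0.
  split.
    by rewrite sE ler_pM2l//; exact: le_trans nw wth.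
  rewrite /h -mulrBr sE; apply: le_trans (ler_wpM2l (ltW D0) (powRN_dist sip n1 (ltW q0))) _.
  apply: le_trans the.
  have c1 : D * s i `^ (- q) <= H.
    by apply: ler_wpM2l; [exact: ltW|apply: ler_powRN => //; exact: ltW].
  have c2 : q * (n - 1) <= q * th.
    by apply: ler_wpM2l; [exact: ltW|rewrite lerBlDl; exact: le_trans nw wth].
  have c3 : 0 <= D * s i `^ (- q) by apply: mulr_ge0; [exact: ltW|exact: powR_ge0].
  have c4 : 0 <= q * (n - 1) by apply: mulr_ge0; [exact: ltW|rewrite subr_ge0].
  by move: (ler_pM c3 c4 c1 c2); rewrite !mulrA.
rewrite distrC sumE -eE -/D.
have := @radial_riemann R f Q J s sg h A B H d e th e Q3 A0 B0 (ltW H0) fA fB (ltW e0) (ltW e0) UC.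
rewrite s0; apply => //.
- by apply: measurable_fun_toC; case: tf.
- by rewrite (ltW th0).
- lra.
- by rewrite /s uJ.
- by move=> i iJ; case: (sgP i iJ).
- by apply: measurable_funM => //; exact: measurable_powR.
- move=> x kx; apply/andP; split; first by apply: mulr_ge0; [exact: ltW|exact: powR_ge0].
  by apply: ler_wpM2l; [exact: ltW|apply: ler_powRN => //; exact: ltW].
- move=> x y kx xy; apply: ler_wpM2l; first exact: ltW.
  by apply: ler_powRN => //; [exact: lt_le_trans kx|exact: ltW].
Qed.

End shell_limits.

(** * Positive limit ratio *)

Section positive_limit.
Variables (R : realType) (a : R) (w1 w2 : R[i]) (f : R[i] -> R) (A B C0 : R).
Hypotheses (ha : 0 < a < 1) (hw : Rfree2 w1 w2) (A0 : 0 < A) (B0 : 0 < B)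
  (tf : test_function f)
  (fA : forall z, A <= cmod z -> f z = 0) (fB : forall z, `|f z| <= B)
  (C01 : 1 <= C0).

Let C1 := C0 * A / a.
Let V := covol w1 w2.
Let g := 2 / (1 - a).
Let q := 2 + g.
Local Notation shell := (shell_pts w1 w2).

Lemma powR_ge1 (r : R) : 0 < r <= 1 -> 1 <= r `^ (a - 1).
Proof.
move=> /andP[r0 r1]; have E1 : 1 `^ (- (1 - a)) = 1 :> R by rewrite powR1.
rewrite -[leLHS]E1 -[a - 1]opprB; apply: ler_powRN => //.
by rewrite subr_ge0 ltW//; case/andP: ha.
Qed.

(** Frees the range of p from l: any larger shell may be used, since for |p| > C1/l the radial
    average is taken outside the support. This lets l vary while the set of p is fixed. *)
Lemma GbarE (l r rad : R) (Q : nat) : 0 < l -> 0 < r <= 1 -> C1 / l <= rad ->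
  Gbar a w1 w2 f A C0 l Q r =
  l ^+ 2 * \sum_(p <- shell rad) radial_avg f Q (l * a * r `^ (a - 1) * cmod p).
Proof.
move=> l0 r01 hrad; rewrite /Gbar -/C1; congr (_ * _).
have r1 := powR_ge1 r01; case/andP: (ha) => a0 a1.
rewrite [RHS](bigID (fun p => cmod p <= C1 / l))/= [X in _ = _ + X]big1_seq ?addr0; last first.
  move=> p /andP[]; rewrite -ltNge => h _; apply: (radial_avg_supp A0 fA).
  have h1 : A <= a * C1 by exact: aC1_ge.
  have h2 : a * C1 <= l * a * cmod p.
    rewrite ltr_pdivrMr// in h; have := ltW h; rewrite -(ler_pM2l a0).
    by have -> : a * (cmod p * l) = l * a * cmod p by ring.
  have h3 : 0 <= l * a * cmod p by rewrite mulr_ge0 ?cmod_ge0// mulr_ge0 ?ltW.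
  have h4 := ler_wpM2r h3 r1; rewrite mul1r in h4.
  have -> : l * a * r `^ (a - 1) * cmod p = r `^ (a - 1) * (l * a * cmod p) by ring.
  exact: le_trans h1 (le_trans h2 h4).
rewrite -[RHS]big_filter; apply: perm_big; apply: uniq_perm.
- exact: uniq_gpts.
- by rewrite filter_uniq// uniq_gpts.
- move=> p; rewrite mem_filter; apply/idP/andP.
    move=> /(mem_shell_pts hw)[Lp /andP[p0 p1]]; split => //; apply/(mem_shell_pts hw).
    by split => //; rewrite p0/=; exact: le_trans p1 hrad.
  by move=> [p1 /(mem_shell_pts hw)[Lp /andP[p0 _]]]; apply/(mem_shell_pts hw); rewrite p0 p1.
Qed.

Lemma sum_cw_le (Q : nat) : (0 < Q)%N -> \sum_(j < Q) Q%:R * cw w1 w2 Q j <= 2 * pi / V.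
Proof.
move=> Q0; have Qp : 0 < Q%:R :> R by rewrite ltr0n.
have Vp : 0 < V := covol_gt0 hw.
apply: (@le_trans _ _ (\sum_(j < Q) 2 * pi / (Q%:R * V))).
  apply: ler_sum => j _; have := ler_wpM2l (ltW Qp) (cw_le hw (ltn_ord j)); rewrite -/V.
  move: (@pi R) => x; have -> : Q%:R * (2 * x / (Q%:R ^+ 2 * V)) = 2 * x / (Q%:R * V) by field; rewrite !gt_eqF.
  exact.
rewrite sum_ord_const; move: (@pi R) => x.
have -> : 2 * x / (Q%:R * V) * Q%:R = 2 * x / V by field; rewrite !gt_eqF.
exact: lexx.
Qed.

Lemma weighted_sum_le (Q : nat) (F : nat -> R) (e : R) : (0 < Q)%N -> 0 <= e ->
  (forall j, (j < Q)%N -> `|F j| <= e) ->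
  `|\sum_(j < Q) Q%:R * cw w1 w2 Q j * F j| <= 2 * pi / V * e.
Proof.
move=> Q0 e0 h; apply: le_trans (ler_norm_sum _ _ _) _.
apply: (@le_trans _ _ (\sum_(j < Q) Q%:R * cw w1 w2 Q j * e)).
  apply: ler_sum => j _; have c0 : 0 <= Q%:R * cw w1 w2 Q j by rewrite mulr_ge0// cw_ge0.
  by rewrite normrM (ger0_norm c0) ler_wpM2l// h.
by rewrite -mulr_suml ler_wpM2r// sum_cw_le.
Qed.

Lemma eventually_seq (I : eqType) (s : seq I) (P : I -> nat -> Prop) :
  (forall i, i \in s -> exists n0, forall n, (n0 <= n)%N -> P i n) ->
  exists n0, forall n, (n0 <= n)%N -> forall i, i \in s -> P i n.
Proof.
elim: s => [_|i s IH h]; first by exists 0%N.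
have [|n1 h1] := IH; first by move=> j js; apply: h; rewrite inE js orbT.
have [|n2 h2] := h i; first by rewrite inE eqxx.
exists (n1 + n2)%N => n hn j; rewrite inE => /predU1P[->|js].
  by apply: h2; apply: leq_trans hn; rewrite leq_addl.
by apply: h1 => //; apply: leq_trans hn; rewrite leq_addr.
Qed.

Definition shell_density (lam : R) (p z : R[i]) : R :=
  let kap := lam * a * cmod p in
  if kap <= cmod z then
    f z * (lam ^+ 2 * kap `^ g / ((1 - a) * V) * cmod z `^ (- q)) else 0.

(** The range of p in the density grows with |z|, but f vanishes for |z| >= A, and below A the range
    fits into the fixed shell. The exponents agree because (4 - 2a)/(1 - a) = 2 + 2/(1 - a). *)
Lemma integralC_rho (lam rad : R) : 0 < lam -> C1 / lam <= rad ->
  integralC (fun z => f z * rho a w1 w2 lam%:E z) =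
  \sum_(p <- shell rad) integralC (shell_density lam p).
Proof.
move=> l0 hrad; case/andP: (ha) => a0 a1; have b0 : 0 < 1 - a by rewrite subr_gt0.
have Vp : 0 < V := covol_gt0 hw.
have g0 : 0 < g by rewrite divr_gt0.
have q0 : 0 < q by rewrite addr_gt0.
rewrite -(@integralC_sum R _ (shell rad) (shell_density lam) A); last first.
  move=> p /(mem_shell_pts hw)[Lp /andP[p0 _]].
  have k0 : 0 < lam * a * cmod p by rewrite mulr_gt0// mulr_gt0.
  set kap := lam * a * cmod p in k0.
  set D := lam ^+ 2 * kap `^ g / ((1 - a) * V).
  have D0 : 0 <= D.
    apply: divr_ge0; first by apply: mulr_ge0; [exact: sqr_ge0|exact: powR_ge0].
    by apply: mulr_ge0; exact: ltW.
  split.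
  - rewrite /shell_density -/kap; apply: measurable_fun_ifT => //.
    + by apply: measurable_fun_ler => //; exact: measurable_fun_cmod.
    + apply: measurable_funM; first by apply: measurable_fun_toC; case: tf.
      apply: measurable_funM; first exact: measurable_cst.
      exact: (measurableT_comp (measurable_powR (- q)) (@measurable_fun_cmod R)).
  - exists (B * (D * kap `^ (- q))) => z; rewrite /shell_density -/kap -/D; case: ifPn => [kz|_].
      rewrite normrM; apply: ler_pM => //; rewrite ger0_norm; last by rewrite mulr_ge0 ?powR_ge0.
      by apply: ler_wpM2l => //; apply: ler_powRN => //; exact: ltW.
    by rewrite normr0; apply: mulr_ge0; [exact: ltW|rewrite mulr_ge0 ?powR_ge0].
  - by move=> z zA; rewrite /shell_density fA// mul0r if_same.
congr integralC; apply/funext => z.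
have [zA|zA] := leP A (cmod z).
  by rewrite fA// mul0r big1// => p _; rewrite /shell_density fA// mul0r if_same.
have [->|z0] := eqVneq z 0.
  rewrite /rho (gt_eqF l0) eqxx mulr0 big1_seq// => p /andP[_ /(mem_shell_pts hw)[Lp /andP[p0 _]]].
  by rewrite /shell_density cmod0 leNgt mulr_gt0// mulr_gt0.
rewrite /rho (gt_eqF l0) (negbTE z0) -/V -/g.
have zp : 0 < cmod z by rewrite cmod_gt0.
pose s := [seq p <- shell rad | lam * a * cmod p <= cmod z].
have kz p : (lam * a * cmod p <= cmod z) = (cmod p <= cmod z / (a * lam)).
  by rewrite ler_pdivlMr ?mulr_gt0//; congr (_ <= _); ring.
have -> : \sum_(p \in [set p | lattice w1 w2 p /\ cmod p <= cmod z / (a * lam)]) cmod p `^ g =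
   \sum_(p <- s) cmod p `^ g.
  have us : uniq s by rewrite filter_uniq// uniq_gpts.
  rewrite (fsbig_seq _ _ us).
  apply/esym/fsbig_widen.
    move=> p /=; rewrite mem_filter => /andP[pz /(mem_shell_pts hw)[Lp _]].
    by split => //; rewrite -kz.
  move=> p /= [[Lp pz] /negP np].
  (* The density admits p = 0, which the shell omits; its term is 0 because the exponent is
     positive. *)
  have [->|p0] := eqVneq p 0; first by rewrite cmod0 powR0// gt_eqF.
  exfalso; move/negP: np; rewrite mem_filter kz pz/=; apply.
  apply/(mem_shell_pts hw); split => //; rewrite cmod_gt0 p0/=.
  apply: le_trans pz _; apply: le_trans hrad.
  have h1 : A <= a * C1 by exact: aC1_ge.
  rewrite ler_pdivrMr ?mulr_gt0//.
  have -> : C1 / lam * (a * lam) = a * C1 by field; rewrite gt_eqF.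
  by apply: le_trans h1; exact: ltW.
rewrite mulr_sumr mulr_sumr /s big_filter big_mkcond/= big_seq [RHS]big_seq.
apply: eq_bigr => p /(mem_shell_pts hw)[Lp /andP[p0 _]].
rewrite /shell_density; case: ifP => // _; congr (_ * _).
have -> : - ((4 - 2 * a) / (1 - a)) = - q by rewrite /q /g; field; rewrite gt_eqF.
rewrite powRM ?invr_ge0 ?(ltW zp) ?(ltW l0)// powRVN// opprK.
have -> : lam `^ q = lam ^+ 2 * lam `^ g.
  by rewrite /q powRD ?(gt_eqF l0) ?implybT// -(powR_mulrn 2 (ltW l0)).
have -> : (lam * a * cmod p) `^ g = lam `^ g * a `^ g * cmod p `^ g.
  by rewrite !powRM ?mulr_ge0 ?(ltW l0) ?(ltW a0) ?cmod_ge0.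
rewrite -!/(powR _ _); move: (lam `^ g) (a `^ g) (cmod p `^ g) (cmod z `^ (- q)) => x1 x2 x3 x4.
by field; rewrite (gt_eqF Vp) (gt_eqF b0).
Qed.

Lemma radial_avg_close (Q : nat) (s t d e : R) : (0 < Q)%N -> 0 <= t ->
  (forall z w, cmod (w - z) <= d * cmod z -> `|f w - f z| <= e) -> `|s - t| <= d * t ->
  `|radial_avg f Q s - radial_avg f Q t| <= e.
Proof.
move=> Q0 t0 UC h; rewrite /radial_avg /avg -mulrBr -sumrB.
apply: (ler_norm_avg (h := fun i : nat => f (s%:C * cis (i%:R * (2 * pi / Q%:R))) - f (t%:C * cis (i%:R * (2 * pi / Q%:R))))) => // i _.
apply: UC; set c := cis _.
have -> : s%:C * c - t%:C * c = (s - t)%:C * c by rewrite rmorphB mulrBl.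
by rewrite cmodM cmodC cmodMC// cmod_cis !mulr1.
Qed.

Lemma radial_avg_le (Q : nat) (s : R) : (0 < Q)%N -> `|radial_avg f Q s| <= B.
Proof.
by move=> Q0; apply: (ler_norm_avg (h := fun i : nat => f (s%:C * cis (i%:R * (2 * pi / Q%:R))))).
Qed.

(** The vectors p are frozen in the shell of radius 2 C1/lam, which contains that of radius C1/l for
    all l > lam/2. Replacing l by lam in this finite sum costs eps/2; at lam, [shell_limit] applies
    to each of the finitely many p. *)
Lemma limit_sum_pos (lam eps : R) : 0 < lam -> 0 < eps ->
  exists Q0 : nat, forall Q, (Q0 <= Q)%N -> exists2 del, 0 < del &
  forall l, `|l - lam| < del ->
  `|limit_sum a w1 w2 f A C0 l Q - integralC (fun z => f z * rho a w1 w2 lam%:E z)| <= eps.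
Proof.
move=> l0 eps0; case/andP: (ha) => a0 a1; have b0 : 0 < 1 - a by rewrite subr_gt0.
have Vp : 0 < V := covol_gt0 hw; have p0 := @pi_gt0 R.
have C10 : 0 < C1 by exact: C1_gt0.
pose rad := 2 * C1 / lam.
have hrad : C1 / lam <= rad by rewrite /rad ler_pM2r ?invr_gt0//; lra.
pose P := shell rad.
have [n nE n1] : exists2 n : R, n = (size P)%:R + 1 & 0 < n.
  by exists ((size P)%:R + 1) => //; rewrite ltr_pwDr.
have Pn : (size P)%:R <= n by rewrite nE lerDl.
pose W := 2 * pi / V; have W0 : 0 < W by rewrite divr_gt0// mulr_gt0.
have en : 0 < eps / 2 / n by rewrite !divr_gt0.
pose X (p : R[i]) (Q : nat) := \sum_(j < Q) Q%:R * cw w1 w2 Q j *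
   (lam ^+ 2 * radial_avg f Q (lam * a * cmod p * (Q%:R / j.+1%:R) `^ (1 - a))).
have [Q0 hQ0] : exists Q0, forall Q, (Q0 <= Q)%N -> forall p, p \in P ->
    `|X p Q - integralC (shell_density lam p)| <= eps / 2 / n.
  apply: (@eventually_seq _ P (fun p Q => `|X p Q - integralC (shell_density lam p)| <= eps / 2 / n)).
  move=> p /(mem_shell_pts hw)[Lp /andP[pp _]].
  have k0 : 0 < lam * a * cmod p by rewrite mulr_gt0// mulr_gt0.
  exact: (shell_limit ha hw A0 B0 tf fA fB l0 k0 en).
exists Q0.+1 => Q hQ; have Qn0 : (0 < Q)%N by exact: leq_trans hQ.
have Qp : 0 < Q%:R :> R by rewrite ltr0n.
pose e := eps / 4 / (W * (lam ^+ 2 * n)).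
have e0 : 0 < e.
  apply: divr_gt0; first exact: divr_gt0.
  by apply: mulr_gt0 => //; apply: mulr_gt0 => //; exact: exprn_gt0.
have [d /andP[d0 d1] UC] := test_function_mult tf A0 fA e0.
(* lam/2 keeps C1/l within [rad] and l + lam <= 3 lam; d lam makes the change in the argument of f
   relatively smaller than d; the last entry pays for l^2 replacing lam^2. *)
pose del := Num.min (lam / 2) (Num.min (d * lam) (eps / 4 / (W * (3 * lam * B * n)))).
have XX : 0 < W * (3 * lam * B * n).
  by apply: mulr_gt0 => //; apply: mulr_gt0 => //; apply: mulr_gt0 => //; exact: mulr_gt0.
have del0 : 0 < del.
  rewrite !lt_min divr_gt0//= mulr_gt0//=; apply: divr_gt0 => //; exact: divr_gt0.
exists del => // l; rewrite !lt_min => /andP[h1 /andP[h2 h3]].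
have /andP[h1a h1b] : (- (lam / 2) < l - lam) && (l - lam < lam / 2) by rewrite -ltr_norml.
have lp : 0 < l by lra.
have rE (j : nat) : (j.+1%:R / Q%:R) `^ (a - 1) = (Q%:R / j.+1%:R) `^ (1 - a) :> R.
  by rewrite -[Q%:R / _]invf_div powRVN ?divr_gt0// opprB.
have r01 (j : nat) : (j < Q)%N -> 0 < (j.+1%:R / Q%:R : R) <= 1.
  by move=> jQ; rewrite divr_gt0//= ler_pdivrMr// mul1r ler_nat.
pose T (x : R) (j : nat) := x ^+ 2 * \sum_(p <- P) radial_avg f Q (x * a * cmod p * (Q%:R / j.+1%:R) `^ (1 - a)).
have lsE (x : R) : 0 < x -> C1 / x <= rad -> limit_sum a w1 w2 f A C0 x Q =
    \sum_(j < Q) Q%:R * cw w1 w2 Q j * T x j.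
  move=> x0 xr; apply: eq_bigr => j _; congr (_ * _).
  rewrite (GbarE _ x0 (r01 _ (ltn_ord j)) xr) rE// /T; congr (_ * _).
  by apply: eq_bigr => p _; congr radial_avg; ring.
have lr : C1 / l <= rad.
  have -> : rad = C1 * (2 / lam) by rewrite /rad; ring.
  rewrite ler_pM2l// -[leLHS]mul1r ler_pdivrMr// mulrAC ler_pdivlMr//; lra.
have s1 : `|limit_sum a w1 w2 f A C0 l Q - \sum_(j < Q) Q%:R * cw w1 w2 Q j * T lam j| <= eps / 2.
  rewrite lsE// -sumrB; under eq_bigr do rewrite -mulrBr.
  have -> : eps / 2 = W * (eps / 2 / W) by rewrite [RHS]mulrC divfK// gt_eqF.
  apply: (weighted_sum_le (F := fun j => T l j - T lam j)) => //.
    by apply: divr_ge0; [exact: ltW (divr_gt0 _ _)|exact: ltW].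
  move=> j jQ.
  have -> : T l j - T lam j = (l ^+ 2 - lam ^+ 2) * (\sum_(p <- P) radial_avg f Q (l * a * cmod p * (Q%:R / j.+1%:R) `^ (1 - a)))
     + lam ^+ 2 * \sum_(p <- P) (radial_avg f Q (l * a * cmod p * (Q%:R / j.+1%:R) `^ (1 - a))
        - radial_avg f Q (lam * a * cmod p * (Q%:R / j.+1%:R) `^ (1 - a))).
    by rewrite /T sumrB; ring.
  apply: le_trans (ler_normD _ _) _; rewrite normrM [X in _ + X <= _]normrM (ger0_norm (sqr_ge0 lam)).
  have S1 : `|\sum_(p <- P) radial_avg f Q (l * a * cmod p * (Q%:R / j.+1%:R) `^ (1 - a))| <= B * n.
    apply: le_trans (ler_wpM2l (ltW B0) Pn).
    by apply: (ler_norm_sum_size (P := xpredT)); [exact: ltW|move=> p _ _; exact: radial_avg_le].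
  have S2 : `|\sum_(p <- P) (radial_avg f Q (l * a * cmod p * (Q%:R / j.+1%:R) `^ (1 - a))
        - radial_avg f Q (lam * a * cmod p * (Q%:R / j.+1%:R) `^ (1 - a)))| <= e * n.
    apply: le_trans (ler_wpM2l (ltW e0) Pn).
    apply: (ler_norm_sum_size (P := xpredT)); first exact: ltW.
    move=> p _ _.
    have c0 : 0 <= a * cmod p * (Q%:R / j.+1%:R) `^ (1 - a).
      by apply: mulr_ge0; [apply: mulr_ge0; [exact: ltW|exact: cmod_ge0]|exact: powR_ge0].
    rewrite -![_ * a * cmod p]mulrA -[l * _ * _]mulrA -[lam * _ * _]mulrA.
    apply: (radial_avg_close Qn0 _ UC); first by apply: mulr_ge0 => //; exact: ltW.
    rewrite -mulrBl normrM (ger0_norm c0) mulrA ler_wpM2r//; exact: ltW.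
  have S3 : `|l ^+ 2 - lam ^+ 2| <= eps / 4 / (W * (3 * lam * B * n)) * (3 * lam).
    rewrite subr_sqr normrM; apply: ler_pM => //; first exact: ltW.
    by rewrite ger0_norm; lra.
  have S4 := ler_pM (normr_ge0 _) (normr_ge0 _) S3 S1.
  have S5 := ler_wpM2l (ltW (exprn_gt0 2 l0)) S2.
  have E1 : eps / 4 / (W * (3 * lam * B * n)) * (3 * lam) * (B * n) = eps / 4 / W.
    by field; rewrite !gt_eqF.
  have E2 : lam ^+ 2 * (e * n) = eps / 4 / W by rewrite /e; field; rewrite !gt_eqF.
  rewrite E1 in S4; rewrite E2 in S5.
  have -> : eps / 2 / W = eps / 4 / W + eps / 4 / W by field; rewrite gt_eqF.
  exact: lerD.
have s2 : `|\sum_(j < Q) Q%:R * cw w1 w2 Q j * T lam j - integralC (fun z => f z * rho a w1 w2 lam%:E z)| <= eps / 2.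
  rewrite (integralC_rho l0 hrad).
  have -> : \sum_(j < Q) Q%:R * cw w1 w2 Q j * T lam j = \sum_(p <- P) X p Q.
    rewrite [RHS]exchange_big/=; apply: eq_bigr => j _.
    by rewrite /T mulr_sumr mulr_sumr.
  rewrite -sumrB.
  have -> : eps / 2 = eps / 2 / n * n by rewrite divfK// gt_eqF.
  apply: le_trans (ler_wpM2l (ltW en) Pn).
  apply: (ler_norm_sum_size (P := xpredT)); first exact: ltW.
  by move=> p pP _; apply: hQ0 => //; exact: ltnW.
have := ler_distD (\sum_(j < Q) Q%:R * cw w1 w2 Q j * T lam j) (limit_sum a w1 w2 f A C0 l Q) (integralC (fun z => f z * rho a w1 w2 lam%:E z)).
move: s1 s2; set x1 := limit_sum _ _ _ _ _ _ _ _; set x2 := \sum_(j < Q) _; set x3 := integralC _ => s1 s2 s3.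
by apply: le_trans s3 _; rewrite [eps]splitr; exact: lerD.
Qed.

End positive_limit.

(** * Zero limit ratio *)

Section zero_limit.
Variables (R : realType) (a : R) (w1 w2 : R[i]) (f : R[i] -> R) (A B C0 C2 : R).
Hypotheses (ha : 0 < a < 1) (hw : Rfree2 w1 w2) (A0 : 0 < A) (B0 : 0 < B)
  (tf : test_function f)
  (fA : forall z, A <= cmod z -> f z = 0) (fB : forall z, `|f z| <= B)
  (C01 : 1 <= C0)
  (C20 : 0 < C2)
  (HC2 : forall r, 0 < r ->
    (size (gpts (lattice w1 w2) [set p | 0 < cmod p <= r]))%:R <= C2 * r ^+ 2).

Let C1 := C0 * A / a.
Let V := covol w1 w2.
Let td := tdiam w1 w2.
Local Notation shell := (shell_pts w1 w2).

Definition annulus_pts (r s : R) := gpts (lattice w1 w2) [set p : R[i] | r < cmod p <= s].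

Lemma mem_annulus_pts (r s : R) p : p \in annulus_pts r s <-> lattice w1 w2 p /\ r < cmod p <= s.
Proof. by rewrite /annulus_pts lattice_grid//; apply: mem_gpts => //; exists s => z /= /andP[]. Qed.

Lemma sum_annuli (rad : R) (Q : nat) (s : nat -> R) (F : R[i] -> R) :
  s 0%N = 0 -> {homo s : i j / (i <= j)%N >-> i <= j} -> s Q <= rad ->
  (forall p, s Q < cmod p -> F p = 0) ->
  \sum_(p <- shell rad) F p = \sum_(j < Q) \sum_(p <- annulus_pts (s j) (s j.+1)) F p.
Proof.
move=> s0 sm srad F0.
have cE (j : 'I_Q) : \sum_(p <- annulus_pts (s j) (s j.+1)) F p =
    \sum_(p <- shell rad) (if p \in annulus_pts (s j) (s j.+1) then F p else 0).
  rewrite -big_mkcond -[RHS]big_filter; apply: perm_big; apply: uniq_perm.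
  - exact: uniq_gpts.
  - by rewrite filter_uniq// uniq_gpts.
  - move=> p; rewrite mem_filter; case: (boolP (p \in annulus_pts _ _)) => //= /mem_annulus_pts[Lp /andP[h1 h2]].
    apply/esym/(mem_shell_pts hw); split => //; apply/andP; split.
      by apply: le_lt_trans h1; rewrite -s0; exact: sm.
    by apply: le_trans h2 _; apply: le_trans srad; exact: sm.
rewrite (eq_bigr _ (fun j _ => cE j)) exchange_big/= big_seq [RHS]big_seq.
apply: eq_bigr => p /(mem_shell_pts hw)[Lp /andP[p0 _]].
have [pQ|pQ] := ltP (s Q) (cmod p).
  by rewrite F0// big1// => j _; rewrite if_same.
have exj : exists j, cmod p <= s j.+1.
  by exists Q; apply: le_trans pQ _; exact: sm.
pose j := ex_minn exj.
have [jp jmin] : cmod p <= s j.+1 /\ forall i, cmod p <= s i.+1 -> (j <= i)%N.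
  by rewrite /j; case: ex_minnP.
have jp' : s j < cmod p.
  case E : j => [|i]; first by rewrite s0.
  by rewrite ltNge; apply/negP => /jmin; rewrite E ltnn.
have jQ : (j < Q)%N.
  rewrite ltnNge; apply/negP => Qj; have := sm _ _ Qj; lra.
have hc : p \in annulus_pts (s j) (s j.+1) by apply/mem_annulus_pts; rewrite jp' jp.
rewrite (bigD1 (Ordinal jQ))//= hc big1 ?addr0// => i ne.
case: ifP => // /mem_annulus_pts[_ /andP[h1 h2]]; exfalso.
move/eqP: ne; apply; apply: val_inj => /=.
have [lt|lt|//] := ltngtP i j; exfalso.
  have := sm _ _ lt; lra.
have := sm _ _ lt; lra.
Qed.

Lemma integralC_radial (Q : nat) (d e : R) : (3 <= Q)%N -> 0 <= e ->
  (forall z w, cmod (w - z) < d -> `|f w - f z| <= e) -> A * (1 + 2 * pi) / Q%:R < d ->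
  `|integralC f - \sum_(j < Q) pi * ((j.+1%:R * A / Q%:R) ^+ 2 - (j%:R * A / Q%:R) ^+ 2)
      * radial_avg f Q (j.+1%:R * A / Q%:R)| <= e * (pi * A ^+ 2).
Proof.
move=> Q3 e0 UC hd; have Q0 : (0 < Q)%N := ltn_trans (isT : (0 < 2)%N) Q3.
have Qp : 0 < Q%:R :> R by rewrite ltr0n.
pose s (j : nat) : R := j%:R * A / Q%:R.
have s0 j : 0 <= s j by apply: divr_ge0 => //; apply: mulr_ge0 => //; exact: ltW.
have sm : {homo s : i j / (i <= j)%N >-> i <= j}.
  by move=> i j ij; rewrite /s ler_pM2r ?invr_gt0// ler_pM2r// ler_nat.
have sQ : s Q = A by rewrite /s mulrAC divff ?mul1r// gt_eqF.
have sS j : s j.+1 = s j + A / Q%:R.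
  have j1 : j.+1%:R = j%:R + 1 :> R by rewrite natr1.
  by rewrite /s j1; ring.
under eq_bigr => j _.
  have -> : pi * ((j.+1%:R * A / Q%:R) ^+ 2 - (j%:R * A / Q%:R) ^+ 2) = 1 * (pi * (s j.+1 ^+ 2 - s j ^+ 2)) :> R.
    by rewrite mul1r.
  rewrite -/(s j.+1) -sum_radial_avg//.
  over.
have -> : e * (pi * A ^+ 2) = \sum_(j < Q) e * (pi * (s j.+1 ^+ 2 - s j ^+ 2)).
  rewrite -mulr_sumr -mulr_sumr -(big_mkord xpredT (fun j => s j.+1 ^+ 2 - s j ^+ 2)).
  by rewrite telescope_sumr// sQ /s !mul0r expr0n subr0.
apply: (@polar_riemann_sum R true Q Q s (fun j q => f ((s j.+1)%:C * cis (q%:R * (2 * pi / Q%:R))) * 1) (fun=> e) B f) => //.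
- by apply: measurable_fun_toC; case: tf.
- move=> j q z jQ qQ [Sz /= /andP[z1 z2]]; rewrite mulr1; apply: UC.
  apply: le_lt_trans hd; apply: le_trans (sector_dist Q3 qQ (s0 _) Sz) _.
  have h1 : `|cmod z - s j.+1| <= A / Q%:R.
    by rewrite ler0_norm ?subr_le0// opprB; have := sS j; lra.
  have h2 : s j.+1 * (2 * pi / Q%:R) <= A * (2 * pi / Q%:R).
    rewrite ler_wpM2r//; last by rewrite -sQ; exact: sm.
    by apply: divr_ge0 => //; apply: mulr_ge0 => //; exact: pi_ge0.
  have -> : A * (1 + 2 * pi) / Q%:R = A / Q%:R + A * (2 * pi / Q%:R) by ring.
  exact: lerD.
- move=> z z0 nc; have [zA|zA] := leP A (cmod z); first exact: fA.
  have [q qQ Sq] := sector_exists Q3 z0.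
  have exj : exists j, cmod z <= s j.+1.
    by exists Q; apply: le_trans (ltW zA) _; rewrite -sQ; exact: sm.
  pose j := ex_minn exj.
  have [jz jmin] : cmod z <= s j.+1 /\ forall i, cmod z <= s i.+1 -> (j <= i)%N.
    by rewrite /j; case: ex_minnP.
  have jz' : s j < cmod z.
    case E : j => [|i]; first by rewrite /s !mul0r cmod_gt0.
    by rewrite ltNge; apply/negP => /jmin; rewrite E ltnn.
  have jQ : (j < Q)%N.
    rewrite ltnNge; apply/negP => Qj; have := sm _ _ Qj; rewrite sQ; lra.
  exfalso; apply: (nc j q jQ qQ); split => //=; by rewrite jz' jz.
Qed.

(** A Riemann sum over the lattice scaled by c. The disc of radius A is cut into Q annuli; each
    contains its area over c^2 V points up to a boundary term O(1/c), so after multiplication by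
    c^2, and with Q fixed, the counting error is O(c). *)
Lemma lattice_radial_sum (eps : R) : 0 < eps -> exists Q0 : nat, forall Q, (Q0 <= Q)%N ->
  exists2 t0 : R, 0 < t0 & forall c rad : R, 0 < c -> c < t0 -> A / c <= rad ->
  `|c ^+ 2 * \sum_(p <- shell rad) radial_avg f Q (c * cmod p) - integralC f / V| <= eps.
Proof.
move=> eps0; have Vp : 0 < V := covol_gt0 hw; have td0 : 0 < td := tdiam_gt0 hw.
have p0 := @pi_gt0 R.
have A2 : 0 < A ^+ 2 by exact: exprn_gt0.
(* The oscillation e is charged twice: to the normalised number of lattice points, at most C2 A^2,
   and to the area of the disc of radius A divided by V. *)
pose X := C2 * A ^+ 2 + pi * A ^+ 2 / V.
have X0 : 0 < X.
  by apply: addr_gt0; [exact: mulr_gt0|apply: divr_gt0 => //; exact: mulr_gt0].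
pose e := eps / 2 / X.
have e0 : 0 < e by apply: divr_gt0 => //; exact: divr_gt0.
have [d d0 UC] := test_function_unif tf e0.
have d2 : 0 < d / 2 by exact: divr_gt0.
have [Q1 [Q10 hQ1]] := div_nat_small (A * (1 + 2 * pi)) d2.
exists (3 + Q1)%N => Q hQ.
have Q3 : (3 <= Q)%N by apply: leq_trans hQ; rewrite leq_addr.
have Q0 : (0 < Q)%N := ltn_trans (isT : (0 < 2)%N) Q3.
have Qp : 0 < Q%:R :> R by rewrite ltr0n.
have hd : A * (1 + 2 * pi) / Q%:R < d.
  by apply: le_lt_trans (hQ1 Q (leq_trans (leq_addl _ _) hQ)) _; lra.
have AQ : A / Q%:R < d.
  apply: le_lt_trans hd; rewrite ler_pM2r ?invr_gt0// ler_peMr ?(ltW A0)//; lra.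
pose Y := Q%:R * (B * (16 * pi * (A + td) * td)) / V.
have Y0 : 0 < Y.
  apply: divr_gt0 => //; apply: mulr_gt0 => //; apply: mulr_gt0 => //.
  by apply: mulr_gt0 => //; apply: mulr_gt0; [exact: mulr_gt0|exact: addr_gt0].
exists (Num.min 1 (eps / 2 / Y)).
  by rewrite lt_min ltr01/=; apply: divr_gt0 => //; exact: divr_gt0.
move=> c rad c0; rewrite lt_min => /andP[c1 cY] hrad.
pose s (j : nat) : R := j%:R * A / Q%:R.
have s0 j : 0 <= s j by apply: divr_ge0 => //; apply: mulr_ge0 => //; exact: ltW.
have sm : {homo s : i j / (i <= j)%N >-> i <= j}.
  by move=> i j ij; rewrite /s ler_pM2r ?invr_gt0// ler_pM2r// ler_nat.
have sQ : s Q = A by rewrite /s mulrAC divff ?mul1r// gt_eqF.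
have sS j : s j.+1 = s j + A / Q%:R.
  have j1 : j.+1%:R = j%:R + 1 :> R by rewrite natr1.
  by rewrite /s j1; ring.
pose s' j := s j / c.
have s'm : {homo s' : i j / (i <= j)%N >-> i <= j}.
  by move=> i j ij; rewrite /s' ler_pM2r ?invr_gt0// sm.
have s'0 : s' 0%N = 0 by rewrite /s' /s !mul0r.
pose F p := radial_avg f Q (c * cmod p).
have F0 p : s' Q < cmod p -> F p = 0.
  rewrite /s' sQ ltr_pdivrMr// mulrC => h; apply: (radial_avg_supp A0 fA); exact: ltW.
have s'Q : s' Q <= rad by rewrite /s' sQ.
have E1 := sum_annuli s'0 s'm s'Q F0.
pose n j := (size (annulus_pts (s' j) (s' j.+1)))%:R : R.
have nsum : \sum_(j < Q) n j <= C2 * (A / c) ^+ 2.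
  have G0 (p : R[i]) : s' Q < cmod p -> (if cmod p <= s' Q then 1 else 0) = 0 :> R.
    by rewrite ltNge => /negbTE ->.
  have := sum_annuli s'0 s'm (lexx (s' Q)) G0.
  have -> : \sum_(p <- shell (s' Q)) (if cmod p <= s' Q then 1 else 0) = (size (shell (s' Q)))%:R :> R.
    rewrite -sum1_size natr_sum big_seq [RHS]big_seq; apply: eq_bigr => p.
    by move=> /(mem_shell_pts hw)[_ /andP[_ ->]].
  have -> : \sum_(j < Q) \sum_(p <- annulus_pts (s' j) (s' j.+1)) (if cmod p <= s' Q then 1 else 0) = \sum_(j < Q) n j.
    apply: eq_bigr => j _; rewrite /n -sum1_size natr_sum big_seq [RHS]big_seq.
    apply: eq_bigr => p /mem_annulus_pts[_ /andP[_ h]].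
    by rewrite (le_trans h)// s'm.
  move=> <-; rewrite /s' sQ; apply: HC2; exact: divr_gt0.
have g1 : `|c ^+ 2 * (\sum_(p <- shell rad) F p) - c ^+ 2 * \sum_(j < Q) n j * radial_avg f Q (s j.+1)|
    <= e * (C2 * A ^+ 2).
  rewrite E1 -mulrBr -sumrB normrM (ger0_norm (sqr_ge0 c)).
  have -> : e * (C2 * A ^+ 2) = c ^+ 2 * (e * (C2 * (A / c) ^+ 2)) by field; rewrite gt_eqF.
  apply: ler_wpM2l; first exact: sqr_ge0.
  apply: (@le_trans _ _ (\sum_(j < Q) e * n j)); last first.
    by rewrite -mulr_sumr ler_wpM2l ?(ltW e0).
  apply: le_trans (ler_norm_sum _ _ _) _; apply: ler_sum => j _.
  have -> : n j * radial_avg f Q (s j.+1) = \sum_(p <- annulus_pts (s' j) (s' j.+1)) radial_avg f Q (s j.+1).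
    by rewrite big_const_seq count_predT iter_addr_0 /n mulr_natl.
  rewrite -sumrB; apply: (ler_norm_sum_size (P := xpredT)); first exact: ltW.
  move=> p /mem_annulus_pts[_ /andP[h1 h2]] _.
  rewrite /F /radial_avg /avg -mulrBr -sumrB.
  apply: (ler_norm_avg (h := fun i : nat => f ((c * cmod p)%:C * cis (i%:R * (2 * pi / Q%:R))) - f ((s j.+1)%:C * cis (i%:R * (2 * pi / Q%:R))))) => // i _.
  apply: UC; set x := cis _.
  have -> : (c * cmod p)%:C * x - (s j.+1)%:C * x = (c * cmod p - s j.+1)%:C * x by rewrite rmorphB mulrBl.
  rewrite cmodM cmodC cmod_cis mulr1; apply: le_lt_trans AQ.
  rewrite /s' ltr_pdivrMr// mulrC in h1; rewrite /s' ler_pdivlMr// mulrC in h2.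
  by rewrite ler0_norm ?subr_le0// opprB; have := sS j; lra.
have g2 : `|c ^+ 2 * (\sum_(j < Q) n j * radial_avg f Q (s j.+1)) -
    (\sum_(j < Q) pi * (s j.+1 ^+ 2 - s j ^+ 2) * radial_avg f Q (s j.+1)) / V| <= Y * c.
  have -> : c ^+ 2 * (\sum_(j < Q) n j * radial_avg f Q (s j.+1)) -
    (\sum_(j < Q) pi * (s j.+1 ^+ 2 - s j ^+ 2) * radial_avg f Q (s j.+1)) / V =
    \sum_(j < Q) (c ^+ 2 / V * ((n j * V - pi * (s' j.+1 ^+ 2 - s' j ^+ 2)) * radial_avg f Q (s j.+1))).
    rewrite mulr_sumr mulr_suml -sumrB; apply: eq_bigr => j _; rewrite /s'.
    move: (@pi R) => x.
    by field; rewrite (gt_eqF Vp) (gt_eqF c0).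
  apply: le_trans (ler_norm_sum _ _ _) _.
  have -> : Y * c = \sum_(j < Q) (c / V * (B * (16 * pi * (A + td) * td))).
    rewrite sum_ord_const /Y; ring.
  apply: ler_sum => j _.
  have c2V : 0 < c ^+ 2 / V by apply: divr_gt0 => //; exact: exprn_gt0.
  rewrite normrM (ger0_norm (ltW c2V)).
  have -> : c / V * (B * (16 * pi * (A + td) * td)) = c ^+ 2 / V * ((16 * pi * ((A + td) / c) * td) * B).
    move: (@pi R) => x; by field; rewrite (gt_eqF Vp) (gt_eqF c0).
  apply: ler_wpM2l; first exact: ltW.
  rewrite normrM; apply: ler_pM => //; last exact: radial_avg_le.
  have rr : 0 <= s' j <= s' j.+1 by rewrite s'm// andbT divr_ge0// ltW.
  have := count_annulus hw 0 rr; rewrite -lattice_grid// -/(annulus_pts _ _) -/V -/td -/(n j) => h.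
  apply: le_trans h _; rewrite ler_pM2r// ler_pM2l ?mulr_gt0//.
  rewrite mulrDl; apply: lerD.
    by rewrite /s' ler_pM2r ?invr_gt0// -sQ sm.
  by rewrite ler_pdivlMr// ler_piMr ?ltW.
have g3 := integralC_radial Q3 (ltW e0) UC hd.
rewrite -/(\sum_(j < Q) pi * (s j.+1 ^+ 2 - s j ^+ 2) * radial_avg f Q (s j.+1)) in g3.
move: g1 g2 g3; set x1 := _ * (\sum_(p <- _) _); set x2 := c ^+ 2 * _; set x3 := \sum_(j < Q) _.
set I := integralC f => g1 g2 g3.
have g4 : `|x3 / V - I / V| <= e * (pi * A ^+ 2 / V).
  rewrite -mulrBl normrM distrC (gtr0_norm (_ : 0 < V^-1)) ?invr_gt0//.
  by rewrite [e * (_ / V)]mulrA ler_pM2r ?invr_gt0.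
have Yc : Y * c <= eps / 2 by rewrite mulrC -ler_pdivlMr// ltW.
have eX : e * (C2 * A ^+ 2) + e * (pi * A ^+ 2 / V) = eps / 2.
  by rewrite -mulrDr -/X /e divfK// gt_eqF.
have h1 := ler_distD x2 x1 (I / V); have h2 := ler_distD (x3 / V) x2 (I / V).
lra.
Qed.

(** In x = (j/Q)^2 this is the right Riemann sum of x^b over [0, 1]. For an increasing function the
    error is at most the mesh, here 2/Q, times the total increase, here 1. *)
Lemma powR_riemann_sum (b : R) (Q : nat) : 0 < b -> (0 < Q)%N ->
  `|\sum_(j < Q) ((j.+1%:R / Q%:R) ^+ 2 - (j%:R / Q%:R) ^+ 2) * ((j.+1%:R / Q%:R) ^+ 2) `^ b - (1 + b)^-1|
    <= 2 / Q%:R.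
Proof.
move=> b0 Q0; have Qp : 0 < Q%:R :> R by rewrite ltr0n.
have b1 : 0 < 1 + b by exact: addr_gt0.
pose x (j : nat) : R := (j%:R / Q%:R) ^+ 2.
have x0 j : 0 <= x j by exact: sqr_ge0.
have xS j : x j < x j.+1.
  by rewrite /x ltrXn2r// ?nnegrE ?divr_ge0// ltr_pM2r ?invr_gt0// ltr_nat.
have x00 : x 0%N = 0 by rewrite /x mul0r expr0n.
have xQ : x Q = 1 by rewrite /x divff ?gt_eqF// expr1n.
have pw y : 0 <= y -> y `^ (1 + b) = y * y `^ b.
  move=> y0; have [->|yn] := eqVneq y 0; first by rewrite mul0r powR0// gt_eqF.
  by rewrite powRD ?yn ?implybT// powRr1.
pose G j := x j.+1 `^ b * (x j.+1 - x j) - (1 + b)^-1 * (x j.+1 `^ (1 + b) - x j `^ (1 + b)).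
have hG j : 0 <= G j <= (x j.+1 `^ b - x j `^ b) * (x j.+1 - x j).
  have dx : 0 < x j.+1 - x j by rewrite subr_gt0.
  have [xj0|xjn] := eqVneq (x j) 0.
    have u0 : 0 <= x j.+1 * x j.+1 `^ b by rewrite mulr_ge0// powR_ge0.
    have i1 : 0 < (1 + b)^-1 by rewrite invr_gt0.
    have i2 : (1 + b)^-1 <= 1 by rewrite invf_le1// lerDl ltW.
    rewrite /G xj0 !powR0 ?gt_eqF// !subr0 pw//; apply/andP; split; nra.
  have xjp : 0 < x j by rewrite lt_neqAle eq_sym xjn x0.
  have [c /andP[c1 c2] E] := powR_MVT (1 + b) xjp (xS j).
  have c0 := lt_trans xjp c1.
  have eb : 1 + b - 1 = b by rewrite addrC addrA addNr add0r.
  rewrite eb in E.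
  have -> : G j = (x j.+1 `^ b - c `^ b) * (x j.+1 - x j).
    by rewrite /G E; field; rewrite gt_eqF.
  have m1 : c `^ b <= x j.+1 `^ b by apply: ge0_ler_powR; rewrite ?nnegrE ?(ltW b0) ?(ltW c0) ?(ltW c2).
  have m2 : x j `^ b <= c `^ b by apply: ge0_ler_powR; rewrite ?nnegrE ?(ltW b0) ?(ltW c0) ?(ltW c1).
  apply/andP; split; first by rewrite mulr_ge0 ?subr_ge0// ltW.
  by rewrite ler_pM2r// lerD2l lerN2.
have dx j : (j < Q)%N -> x j.+1 - x j <= 2 / Q%:R.
  move=> jQ; rewrite /x; have -> : j.+1%:R = j%:R + 1 :> R by rewrite natr1.
  have -> : ((j%:R + 1) / Q%:R) ^+ 2 - (j%:R / Q%:R) ^+ 2 = ((2 * j%:R + 1) / Q%:R) / Q%:R :> R.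
    by field; rewrite gt_eqF.
  rewrite ler_pM2r ?invr_gt0// ler_pdivrMr//.
  have : j%:R + 1 <= Q%:R :> R by rewrite natr1 ler_nat.
  lra.
have -> : \sum_(j < Q) ((j.+1%:R / Q%:R) ^+ 2 - (j%:R / Q%:R) ^+ 2) * ((j.+1%:R / Q%:R) ^+ 2) `^ b - (1 + b)^-1
    = \sum_(j < Q) G j.
  rewrite /G sumrB -mulr_sumr -(big_mkord xpredT (fun j => x j.+1 `^ (1 + b) - x j `^ (1 + b))).
  rewrite telescope_sumr// xQ powR1 x00 powR0 ?gt_eqF// subr0 mulr1.
  by congr (_ - _); apply: eq_bigr => j _; rewrite mulrC.
rewrite ger0_norm; last by apply: sumr_ge0 => j _; case/andP: (hG j).
apply: (@le_trans _ _ (\sum_(j < Q) (x j.+1 `^ b - x j `^ b) * (2 / Q%:R))).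
  apply: ler_sum => j _; have /andP[_ h] := hG j; apply: le_trans h _.
  apply: ler_wpM2l; last exact: dx.
  by rewrite subr_ge0; apply: ge0_ler_powR; rewrite ?nnegrE ?(ltW b0) ?(ltW (xS _)).
rewrite -mulr_suml -(big_mkord xpredT (fun j => x j.+1 `^ b - x j `^ b)) telescope_sumr//.
by rewrite xQ powR1 ler_piMl ?divr_ge0// gerBl powR_ge0.
Qed.

(** On the ring of radius r the lattice is scaled by c = l a r^(a-1), so that l^2 = c^2
    r^(2-2a)/a^2. The lattice sum tends to I/V in each ring, and the factor left over is summed by
    [powR_riemann_sum] with b = 1 - a. *)
Lemma limit_sum_zero (eps : R) : 0 < eps ->
  exists Q0 : nat, forall Q, (Q0 <= Q)%N -> exists2 del, 0 < del &
  forall l, 0 < l -> l < del ->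
  `|limit_sum a w1 w2 f A C0 l Q - integralC (fun z => f z * rho a w1 w2 0%:E z)| <= eps.
Proof.
move=> eps0; case/andP: (ha) => a0 a1; have b0 : 0 < 1 - a by rewrite subr_gt0.
have Vp : 0 < V := covol_gt0 hw; have p0 := @pi_gt0 R.
have a2 : 0 < a ^+ 2 by exact: exprn_gt0.
have aC : A <= a * C1 by exact: aC1_ge.
pose I := integralC f.
pose W := 2 * pi / V; have W0 : 0 < W by apply: divr_gt0 => //; exact: mulr_gt0.
pose e := eps / 2 / W * a ^+ 2.
have eps2 : 0 < eps / 2 by exact: divr_gt0.
have e0 : 0 < e by apply: mulr_gt0 => //; exact: divr_gt0.
have [Q1 hQ1] := lattice_radial_sum e0.
have [Q2 [Q20 hQ2]] := div_nat_small (`|I / V / a ^+ 2 * (pi / V)| * 2) eps2.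
exists (Q1 + Q2)%N => Q hQ.
have Q0 : (0 < Q)%N by apply: leq_trans Q20 _; apply: leq_trans hQ; rewrite leq_addl.
have Qp : 0 < Q%:R :> R by rewrite ltr0n.
have {}hQ2 := hQ2 Q (leq_trans (leq_addl _ _) hQ).
have [t0 t00 ht] := hQ1 Q (leq_trans (leq_addr _ _) hQ).
have Qb : 0 < Q%:R `^ (1 - a) :> R by exact: powR_gt0.
(* As r >= 1/Q, the scale c is at most l Q^(1-a), so one bound on l gives c < t0 in all Q rings. *)
exists (t0 / Q%:R `^ (1 - a)); first exact: divr_gt0.
move=> l l0; rewrite ltr_pdivlMr// => lt.
have -> : integralC (fun z => f z * rho a w1 w2 0%:E z) = I * (pi / (a ^+ 2 * (2 - a) * V ^+ 2)).
  have mf : measurable_fun setT (fun p : R * R => f (toC p)) by apply: measurable_fun_toC; case: tf.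
  have := RintegralZr (pi / (a ^+ 2 * (2 - a) * V ^+ 2)) measurableT (integrable_supp mf fB fA).
  by rewrite /integralC /rho eqxx => ->.
pose r (j : nat) : R := j.+1%:R / Q%:R.
have r0 j : 0 < r j by exact: divr_gt0.
have r1 j : (j < Q)%N -> r j <= 1 by move=> jQ; rewrite /r ler_pdivrMr// mul1r ler_nat.
pose H j := I / V * ((r j ^+ 2) `^ (1 - a) / a ^+ 2).
have s1 : `|limit_sum a w1 w2 f A C0 l Q - \sum_(j < Q) Q%:R * cw w1 w2 Q j * H j| <= eps / 2.
  rewrite /limit_sum -sumrB; under eq_bigr do rewrite -mulrBr.
  have -> : eps / 2 = W * (eps / 2 / W) by rewrite [RHS]mulrC divfK// gt_eqF.
  apply: (weighted_sum_le hw (F := fun j => Gbar a w1 w2 f A C0 l Q (j.+1%:R / Q%:R) - H j)) => //.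
    by apply: divr_ge0; exact: ltW.
  move=> j jQ; rewrite -/(r j).
  have rp := powR_ge1 ha (_ : 0 < r j <= 1); rewrite r0 r1// in rp; have {}rp := rp isT.
  pose c := l * a * r j `^ (a - 1).
  have c0 : 0 < c by apply: mulr_gt0; [exact: mulr_gt0|exact: powR_gt0].
  have ct : c < t0.
    apply: le_lt_trans lt; rewrite /c -mulrA ler_pM2l//.
    apply: (@le_trans _ _ (r j `^ (a - 1))); first by rewrite ler_piMl ?powR_ge0// ltW.
    have -> : a - 1 = - (1 - a) by rewrite opprB.
    rewrite -powRVN//; apply: ge0_ler_powR; rewrite ?nnegrE ?invr_ge0 ?(ltW b0) ?(ltW (r0 _)) ?(ltW Qp)//.
    by rewrite /r invf_div ler_pdivrMr// ler_peMr ?(ltW Qp)// ler1n.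
  have Ac : A / c <= C1 / l.
    rewrite ler_pdivrMr// mulrAC ler_pdivlMr//.
    have -> : C1 * c = a * C1 * r j `^ (a - 1) * l by rewrite /c; ring.
    have aC0 := le_trans (ltW A0) aC.
    by rewrite ler_pM2r//; apply: le_trans aC _; rewrite ler_peMr.
  have := ht c (C1 / l) c0 ct Ac.
  rewrite /Gbar -/C1 -/c -/I; set S := \sum_(p <- _) _ => h.
  pose m := (r j ^+ 2) `^ (1 - a) / a ^+ 2.
  have r20 : 0 <= r j ^+ 2 by exact: sqr_ge0.
  have mE : l ^+ 2 = c ^+ 2 * m.
    have rE : (r j ^+ 2) `^ (1 - a) = r j `^ (2%:R * (1 - a)).
      by rewrite -(powR_mulrn 2 (ltW (r0 j))) -powRrM.
    rewrite /c /m rE exprMn exprMn (powR_two_sqr _ (r0 j)).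
    have -> : l ^+ 2 * a ^+ 2 * r j `^ (2 * (a - 1)) * (r j `^ (2%:R * (1 - a)) / a ^+ 2)
      = l ^+ 2 * (r j `^ (2 * (a - 1)) * r j `^ (2%:R * (1 - a))) by field; rewrite gt_eqF.
    rewrite -powRD ?(gt_eqF (r0 j)) ?implybT//.
    have -> : 2 * (a - 1) + 2%:R * (1 - a) = 0 by ring.
    by rewrite powRr0 mulr1.
  have m0 : 0 <= m by apply: divr_ge0; [exact: powR_ge0|exact: ltW].
  have m1 : m <= (a ^+ 2)^-1.
    rewrite /m ler_piMl ?invr_ge0 ?(ltW a2)//.
    have E1 : 1 `^ (1 - a) = 1 :> R by rewrite powR1.
    rewrite -[leRHS]E1; apply: ge0_ler_powR; rewrite ?nnegrE ?(ltW b0)//.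
    by rewrite expr_le1 ?r1// ltW.
  have -> : l ^+ 2 * S - H j = (c ^+ 2 * S - I / V) * m by rewrite mE /H -/m; ring.
  rewrite normrM (ger0_norm m0).
  have -> : eps / 2 / W = e * (a ^+ 2)^-1 by rewrite /e mulfK// gt_eqF.
  by apply: ler_pM.
have s2 : `|\sum_(j < Q) Q%:R * cw w1 w2 Q j * H j - I * (pi / (a ^+ 2 * (2 - a) * V ^+ 2))| <= eps / 2.
  have := powR_riemann_sum b0 Q0.
  set S := \sum_(j < Q) _ => h.
  have -> : \sum_(j < Q) Q%:R * cw w1 w2 Q j * H j = I / V / a ^+ 2 * (pi / V) * S.
    rewrite mulr_sumr; apply: eq_bigr => j _; rewrite /H /cw -/V /r.
    have -> : j.+1%:R = j%:R + 1 :> R by rewrite natr1.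
    move: (_ `^ (1 - a)) (@pi R) => x y.
    by field; rewrite (gt_eqF Vp) (gt_eqF Qp) (gt_eqF a0).
  have -> : I * (pi / (a ^+ 2 * (2 - a) * V ^+ 2)) = I / V / a ^+ 2 * (pi / V) * (1 + (1 - a))^-1.
    have a20 : 0 < 2 - a by lra.
    have -> : 1 + (1 - a) = 2 - a by ring.
    move: (@pi R) (2 - a) a20 => y b b0'.
    by field; rewrite (gt_eqF Vp) (gt_eqF a0) (gt_eqF b0').
  by rewrite -mulrBr normrM; apply: le_trans hQ2; rewrite -[leRHS]mulrA ler_wpM2l.
have := ler_distD (\sum_(j < Q) Q%:R * cw w1 w2 Q j * H j) (limit_sum a w1 w2 f A C0 l Q) (I * (pi / (a ^+ 2 * (2 - a) * V ^+ 2))).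
move: s1 s2; set x1 := limit_sum _ _ _ _ _ _ _ _; set x2 := \sum_(j < Q) _; set x3 := I * _ => s1 s2 s3.
by apply: le_trans s3 _; rewrite [eps]splitr; exact: lerD.
Qed.

End zero_limit.

(** [cl del l] stands for l being within [del] of the limit ratio, so that lam = 0 and lam > 0 share
    one argument. Q is fixed large enough for both approximations before N and N' + N'' grow; two
    errors eps/3 leave room for the strict inequality. *)
Lemma vague_cvg_limit (R : realType) (a : R) (z0 w1 w2 : R[i]) (phi psi : nat -> R)
    (f : R[i] -> R) (A B C0 C2 I : R) (cl : R -> R -> Prop) :
  0 < a < 1 -> Rfree2 w1 w2 -> 0 < A -> 0 < B -> test_function f ->
  (forall z, A <= cmod z -> f z = 0) -> (forall z, `|f z| <= B) -> 1 <= C0 ->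
  (forall (k : int) (n m : R[i]) (M : R), n != 0 -> m != 0 -> cmod n <= M -> cmod m <= M ->
    cmod (n - m) <= C0 * M `^ (1 - a) * cmod (pow_lvl a k n - pow_lvl a k m)) ->
  0 < C2 ->
  (forall r, 0 < r ->
    (size (gpts (lattice w1 w2) [set p | 0 < cmod p <= r]))%:R <= C2 * r ^+ 2) ->
  (forall N : nat, (1 <= N)%N -> 0 < phi N) ->
  phi N @[N --> \oo] --> +oo%R ->
  (forall N : nat, (1 <= N)%N -> psi N = ((N%:R `^ (2 - a)) / phi N) ^+ 2) ->
  (forall del : R, 0 < del -> exists M, forall N, (M <= N)%N -> (1 <= N)%N -> cl del (phi N / N%:R `^ (1 - a))) ->
  (forall eps : R, 0 < eps -> exists Q0 : nat, forall Q, (Q0 <= Q)%N -> exists2 del : R, 0 < del &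
    forall l : R, 0 < l -> cl del l -> `|limit_sum a w1 w2 f A C0 l Q - I| <= eps) ->
  forall eps : R, 0 < eps -> exists M : nat, forall N N' N'' : nat,
    (1 <= N)%N -> (1 <= N' + N'')%N -> (M <= N)%N -> (M <= N' + N'')%N ->
    `|corr_lvl a (grid z0 w1 w2) phi psi N N' N'' f - I| < eps.
Proof.
move=> ha hw A0 B0 tf fA fB C01 HC0 C20 HC2 hphi0 hphi hpsi hcl hlim eps eps0.
case/andP: (ha) => a0 a1.
have e3 : 0 < eps / 3 by rewrite divr_gt0.
have [Q1 hQ1] := corr_limit_sum z0 ha hw A0 B0 tf fA fB C01 HC0 C20 HC2 e3.
have [Q2 hQ2] := hlim _ e3.
pose Q := (Q1 + Q2)%N.
have [eta eta0 [M0 hM0]] := hQ1 Q (leq_addr _ _).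
have [del del0 hdel] := hQ2 Q (leq_addl _ _).
have [M1 hM1] := hcl _ del0.
pose C1 := C0 * A / a.
have C10 : 0 < C1 by exact: C1_gt0.
have [M2 hM2] : exists M2, forall N, (M2 <= N)%N -> C1 / eta <= phi N.
  move/cvgryPge: hphi => /(_ (C1 / eta)) [M2 _ h].
  by exists M2 => N hN; exact: h.
exists (M0 + M1 + M2)%N => N N' N'' N1 K1 hN hK.
have Np : 0 < N%:R :> R by rewrite ltr0n.
pose l := phi N / N%:R `^ (1 - a).
have pb : 0 < N%:R `^ (1 - a) :> R by exact: powR_gt0.
have ph := hphi0 N N1.
have l0 : 0 < l by exact: divr_gt0.
have phiE : phi N = l * N%:R `^ (1 - a) by rewrite /l divfK// gt_eqF.
rewrite (corr_lvlE z0 f hw _ _ N1 ph (hpsi N N1) (erefl l)).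
(* This is where phi(N) -> +oo enters: C1 <= eta phi(N) gives C1/l <= eta N^(1-a) <= eta N. *)
have c1 : C1 / l <= eta * N%:R.
  have h := hM2 N (leq_trans (leq_addl _ _) hN).
  rewrite ler_pdivrMr// -mulrA; rewrite ler_pdivrMr// mulrC in h.
  apply: le_trans h _; rewrite ler_pM2l// {1}phiE mulrC ler_pM2r//.
  by rewrite ler1_powR ?ler1n//; lra.
have g1 := hM0 N (N' + N'')%N N' l (phi N) _ _ N1 K1 l0 phiE c1.
have {}g1 := g1 (leq_trans (leq_trans (leq_addr _ _) (leq_addr _ _)) hN).
have {}g1 := g1 (leq_trans (leq_trans (leq_addr _ _) (leq_addr _ _)) hK).
have g2 := hdel l l0 (hM1 N (leq_trans (leq_trans (leq_addl _ _) (leq_addr _ _)) hN) N1).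
move: g1 g2; set x1 := _ * _; set x2 := limit_sum _ _ _ _ _ _ _ _ => g1 g2.
have := ler_distD x2 x1 I; lra.
Qed.

Theorem theorem2p3 (R : realType) (a : R) (z0 w1 w2 : R[i])
    (phi psi : nat -> R) (lam : \bar R)
    (ha : 0 < a < 1)
    (hw : Rfree2 w1 w2)
    (hphi0 : forall N : nat, (1 <= N)%N -> 0 < phi N)
    (hpsi0 : forall N : nat, (1 <= N)%N -> 0 < psi N)
    (hphi : phi N @[N --> \oo] --> +oo%R)
    (hlam0 : (0 <= lam)%E)
    (hlam : (phi N / (N%:R `^ (1 - a)))%:E @[N --> \oo] --> lam)
    (hpsi : forall N : nat, (1 <= N)%N ->
       psi N = ((N%:R `^ (2 - a)) / phi N) ^+ 2) :
  vague_cvg (corr_lvl a (grid z0 w1 w2) phi psi) (rho a w1 w2 lam).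
Proof.
move=> f tf; have [A [B [A0 B0 fA fB]]] := test_function_bound tf.
have [C0 C01 HC0] := pow_lvl_chord ha.
have [C2 C20 HC2] := count_lattice_le hw.
case: lam hlam0 hlam => [lam| |] // hlam0 hlam.
- have cl (del : R) : 0 < del -> exists M : nat, forall N, (M <= N)%N -> (1 <= N)%N ->
      `|phi N / N%:R `^ (1 - a) - lam| < del.
    move=> del0; have hl : phi N / N%:R `^ (1 - a) @[N --> \oo] --> lam by have [_] := (fine_cvgP _ _).1 hlam.
    move/cvgrPdist_lt: hl => /(_ _ del0)[M _ h].
    by exists M => N hN _; rewrite distrC; exact: h.
  rewrite lee_fin le_eqVlt in hlam0; case/orP: hlam0 => [/eqP l0|l0].
    rewrite -l0 in cl *; have := limit_sum_zero ha hw A0 B0 tf fA fB C01 C20 HC2 => hz.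
    apply: (vague_cvg_limit (cl := fun del x => `|x - 0| < del) z0 ha hw A0 B0 tf fA fB C01 HC0 C20 HC2 hphi0 hphi hpsi cl).
    move=> eps eps0; have [Q0 hQ0] := hz _ eps0; exists Q0 => Q hQ; have [del del0 h] := hQ0 Q hQ.
    by exists del => // l lp; rewrite subr0 gtr0_norm// => ld; exact: h.
  apply: (vague_cvg_limit (cl := fun del x => `|x - lam| < del) z0 ha hw A0 B0 tf fA fB C01 HC0 C20 HC2 hphi0 hphi hpsi cl).
  move=> eps eps0; have [Q0 hQ0] := limit_sum_pos ha hw A0 B0 tf fA fB C01 l0 eps0.
  exists Q0 => Q hQ; have [del del0 h] := hQ0 Q hQ.
  by exists del => // l _ ld; exact: h.
(* With d0 a lower bound for the nonzero lattice lengths, l > C1/d0 leaves no p with 0 < |p| <=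
   C1/l, so the functional is exactly 0 from some N on. *)
- move=> eps eps0; have [d0 d00 hd0] := lattice_min hw.
  pose C1 := C0 * A / a.
  have C10 : 0 < C1 by exact: C1_gt0.
  have [M hM] : exists M : nat, forall N, (M <= N)%N -> C1 / d0 < phi N / N%:R `^ (1 - a).
    have : \forall N \near \oo, ((C1 / d0)%:E < (phi N / N%:R `^ (1 - a))%:E)%E.
      by move/cvgeyPgt: hlam => /(_ (C1 / d0)).
    by case=> M _ h; exists M => N hN; have := h N hN; rewrite /= lte_fin.
  exists M => N N' N'' N1 K1 hN hK.
  have Np : 0 < N%:R :> R by rewrite ltr0n.
  have pb : 0 < N%:R `^ (1 - a) :> R by exact: powR_gt0.
  pose l := phi N / N%:R `^ (1 - a).
  have ph := hphi0 N N1; have l0 : 0 < l by exact: divr_gt0.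
  have phiE : phi N = l * N%:R `^ (1 - a) by rewrite /l divfK// gt_eqF.
  rewrite (corr_lvlE z0 f hw _ _ N1 ph (hpsi N N1) (erefl l)).
  rewrite big1 => [|i _]; last first.
    rewrite big1_seq// => n /andP[_ nD].
    apply: (pair_sum_shell0 ha hw A0 fA C01 HC0 _ N1 l0 phiE nD) => p Lp p0.
    apply: lt_le_trans (hd0 p Lp p0); rewrite -/C1.
    by have := hM N hN; rewrite -/l ltr_pdivrMr// => h; rewrite ltr_pdivrMr// [ltRHS]mulrC.
  have -> : integralC (fun z => f z * rho a w1 w2 +oo z) = 0.
    rewrite /integralC /rho; under eq_Rintegral do rewrite mulr0.
    by rewrite Rintegral_cst// mul0r.
  by rewrite mulr0 subr0 normr0.
Qed.
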